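(* Let $r\ge 1$ be an integer. For any integer $m$ with $0\le m\le r$ the following identity of formal power series in $q$ holds: $$\sum_{n\ge 0}h_0\left(\mathcal{M}(r,n)^{T_{1,1}^{\vec w(m)}}\right)q^n=\frac{(-q;q)_\infty}{(q;q)_\infty}\,(q^{m+1},q^{r-m+1},q^{r+2};q^{r+2})_\infty .$$ Here $\mathcal{M}(r,n)^{T_{1,1}^{\vec w(m)}}$ is the fixed-point set of the one-dimensional torus $T_{1,1}^{\vec w(m)}$ acting on the moduli space $\mathcal{M}(r,n)$.
   Context: $\mathcal{M}(r,n)$ is the moduli space of framed torsion free sheaves on $\mathbb{P}^2$ of rank $r$ and second Chern class $n$: isomorphism classes of pairs $(E,\Phi)$ with $E$ a torsion free sheaf on $\mathbb{P}^2$, $\mathrm{rank}(E)=r$, $c_2(E)=n$, and $\Phi\colon E|_{l_\infty}\to\mathcal{O}_{l_\infty}^{\oplus r}$ an isomorphism, $l_\infty$ being the line at infinity. It is a smooth irreducible quasi-projective variety over $\mathbb{C}$ of dimension $2rn$, and it has the following quiver description, which may be taken as its definition: $$\mathcal{M}(r,n)\cong\{(B_1,B_2,i,j)\mid \text{1) and 2) below}\}/GL_n(\mathbb{C}),$$ with $B_1,B_2\in \mathrm{End}(\mathbb{C}^n)$, $i\in \mathrm{Hom}(\mathbb{C}^r,\mathbb{C}^n)$, $j\in \mathrm{Hom}(\mathbb{C}^n,\mathbb{C}^r)$, where 1) $[B_1,B_2]+ij=0$; 2) (stability) there is no proper subspace $S\subsetneq\mathbb{C}^n$ such that $B_1(S)\subset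 S$, $B_2(S)\subset S$ and $\mathrm{Im}(i)\subset S$; and $g\in GL_n(\mathbb{C})$ acts by $g\cdot(B_1,B_2,i,j)=(gB_1g^{-1},gB_2g^{-1},gi,jg^{-1})$. The torus $T=(\mathbb{C}^* )^{r+2}$ acts on $\mathcal{M}(r,n)$ by $$(t_1,t_2,e_1,\ldots,e_r)\cdot[(B_1,B_2,i,j)]=[(t_1B_1,t_2B_2,ie^{-1},t_1t_2ej)],\qquad e=\mathrm{diag}(e_1,\ldots,e_r).$$ For $\vec w=(w_1,\ldots,w_r)\in\mathbb{Z}^r$ and coprime integers $\alpha,\beta\ge1$, $T_{\alpha,\beta}^{\vec w}=\{(t^\alpha,t^\beta,t^{w_1},\ldots,t^{w_r})\in T\mid t\in\mathbb{C}^*\}$. For $0\le m\le r$, $\vec w(m)=(1,\ldots,1,0,\ldots,0)\in\mathbb{Z}^r$ with exactly $m$ ones, in the first $m$ positions. $h_0(X)$ denotes the number of connected components of a manifold $X$. Notation: $(a;q)_\infty=\prod_{i\ge0}(1-aq^i)$ and $(a_1,\ldots,a_k;q)_\infty=(a_1;q)_\infty\cdots(a_k;q)_\infty$. *)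

(* Defs.v *)
From HB Require Import structures.
From mathcomp Require Import all_boot all_order all_algebra finmap.
From mathcomp Require Import all_classical all_reals all_analysis.
From mathcomp Require Export complex.

Set Implicit Arguments.
Unset Strict Implicit.
Unset Printing Implicit Defensive.

Import Order.TTheory GRing.Theory Num.Theory.
Import numFieldTopology.Exports numFieldNormedType.Exports.

Local Open Scope classical_set_scope.
Local Open Scope ring_scope.
Local Open Scope quotient_scope.

Section Components.
Variable T : topologicalType.
Implicit Types A : set T.

Definition components A : set (set T) := connected_component A @` A.

(* fset_set sends infinite sets to fset0, hence h0 A is only meaningful when
   components A is finite. *)
Definition h0 A : nat := #|` fset_set (components A)|%fset.

End Components.

(* K stands for the field of complex numbers R[i]. As a numFieldType it carries
   the topology of its norm, so the spaces below have the analytic topology. *)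
Section ModuliSpace.
Variables (K : numClosedFieldType) (r n : nat).

(* Quadruples (B1, B2, i, j); matrices act on column vectors. *)
Definition quiver_data : Type :=
  ('M[K]_n * 'M[K]_n * 'M[K]_(n, r) * 'M[K]_(r, n))%type.

Implicit Types x y : quiver_data.

Definition qB1 x : 'M[K]_n := x.1.1.1.
Definition qB2 x : 'M[K]_n := x.1.1.2.
Definition qi x : 'M[K]_(n, r) := x.1.2.
Definition qj x : 'M[K]_(r, n) := x.2.

Definition adhm_eq x : Prop :=
  qB1 x *m qB2 x - qB2 x *m qB1 x + qi x *m qj x = 0.

Definition stable x : Prop :=
  ~ exists S : {vspace 'cV[K]_n},
      [/\ S != fullv,
          forall v, v \in S -> qB1 x *m v \in S,
          forall v, v \in S -> qB2 x *m v \in S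
        & forall u : 'cV[K]_r, qi x *m u \in S].

Definition stable_locus : set quiver_data :=
  [set x | adhm_eq x /\ stable x].

Definition gl_act (g : 'M[K]_n) x : quiver_data :=
  (g *m qB1 x *m invmx g, g *m qB2 x *m invmx g, g *m qi x, qj x *m invmx g).

Lemma gl_act1 x : gl_act 1%:M x = x.
Proof.
case: x => [[[B1 B2] i] j].
by rewrite /gl_act /qB1 /qB2 /qi /qj /= invmx1 !mulmx1 !mul1mx.
Qed.

Lemma invmxM (g h : 'M[K]_n) : g \in unitmx -> h \in unitmx ->
  invmx (g *m h) = invmx h *m invmx g.
Proof.
move=> gU hU; have ghU : g *m h \in unitmx by rewrite unitmx_mul gU.
by rewrite -[RHS](mulmxK ghU) mulmxA mulmxKV // mulVmx // mul1mx.
Qed.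

Lemma gl_actM g h x : g \in unitmx -> h \in unitmx ->
  gl_act (g *m h) x = gl_act g (gl_act h x).
Proof.
by move=> gU hU; rewrite /gl_act /qB1 /qB2 /qi /qj /= invmxM // !mulmxA.
Qed.

Definition gl_equiv (u v : stable_locus) : bool :=
  `[< exists2 g, g \in unitmx & set_val v = gl_act g (set_val u) >].

Lemma gl_equiv_refl : reflexive gl_equiv.
Proof.
by move=> u; apply/asboolP; exists 1%:M; rewrite ?unitmx1// gl_act1.
Qed.

Lemma gl_equiv_sym : symmetric gl_equiv.
Proof.
suff H u v : gl_equiv u v -> gl_equiv v u by move=> u v; apply/idP/idP; exact: H.
move=> /asboolP[g gU uv]; apply/asboolP; exists (invmx g).
  by rewrite unitmx_inv.
by rewrite uv -gl_actM ?unitmx_inv// mulVmx// gl_act1.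
Qed.

Lemma gl_equiv_trans : transitive gl_equiv.
Proof.
move=> y x z /asboolP[g gU xy] /asboolP[h hU yz]; apply/asboolP.
by exists (h *m g); rewrite ?unitmx_mul ?gU ?hU// gl_actM// -xy.
Qed.

Canonical gl_equiv_rel :=
  EquivRel gl_equiv gl_equiv_refl gl_equiv_sym gl_equiv_trans.

Definition moduli : topologicalType :=
  quotient_topology {eq_quot gl_equiv_rel}.

End ModuliSpace.

Arguments stable_locus : clear implicits.
Arguments gl_equiv_rel : clear implicits.

Section TorusAction.
Variables (K : numClosedFieldType) (r n : nat).

Record torus := Torus {
  tor1 : K;
  tor2 : K;
  tore : 'rV[K]_r;
  torus_neq0 : [&& tor1 != 0, tor2 != 0 & [forall k, tore 0 k != 0]] }.

Implicit Types (t : torus) (x : quiver_data K r n).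

Lemma tor1_neq0 t : tor1 t != 0. Proof. by case/and3P: (torus_neq0 t). Qed.

Lemma tor2_neq0 t : tor2 t != 0. Proof. by case/and3P: (torus_neq0 t). Qed.

Lemma tore_unit t : diag_mx (tore t) \in unitmx.
Proof.
case/and3P: (torus_neq0 t) => _ _ /forallP e0.
by rewrite unitmxE det_diag unitfE; apply/prodf_neq0 => k _.
Qed.

Definition quiver_torus_act t x : quiver_data K r n :=
  (tor1 t *: qB1 x, tor2 t *: qB2 x, qi x *m invmx (diag_mx (tore t)),
   (tor1 t * tor2 t) *: (diag_mx (tore t) *m qj x)).

Lemma quiver_torus_act_gl t g x :
  quiver_torus_act t (gl_act g x) = gl_act g (quiver_torus_act t x).
Proof.
rewrite /quiver_torus_act /gl_act /qB1 /qB2 /qi /qj /=.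
by rewrite -!scalemxAr -!scalemxAl !mulmxA.
Qed.

Lemma quiver_torus_act_stable t x :
  x \in stable_locus K r n -> quiver_torus_act t x \in stable_locus K r n.
Proof.
move=> /set_mem[xeq xst]; apply/mem_set; split.
  rewrite /adhm_eq /quiver_torus_act /qB1 /qB2 /qi /qj /=.
  rewrite -!scalemxAr -!scalemxAl !scalerA (mulrC (tor2 t)).
  by rewrite mulmxA mulmxKV ?tore_unit// -scalerBr -scalerDr xeq scaler0.
move=> [S [SnT S1 S2 Si]]; apply: xst; exists S; split => // [v vS|v vS|u].
- have := memvZ (tor1 t)^-1 (S1 v vS); rewrite /quiver_torus_act /qB1 /=.
  by rewrite -scalemxAl scalerK// tor1_neq0.
- have := memvZ (tor2 t)^-1 (S2 v vS); rewrite /quiver_torus_act /qB2 /=.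
  by rewrite -scalemxAl scalerK// tor2_neq0.
- have := Si (diag_mx (tore t) *m u); rewrite /quiver_torus_act /qi /=.
  by rewrite mulmxA mulmxKV// tore_unit.
Qed.

Definition stable_torus_act t (x : stable_locus K r n) : stable_locus K r n :=
  SigSub (quiver_torus_act_stable t (valP x)).

Definition torus_act t (x : moduli K r n) : moduli K r n :=
  \pi_(moduli K r n) (stable_torus_act t (repr x)).

Lemma torus_act_pi t (x : stable_locus K r n) :
  torus_act t (\pi_(moduli K r n) x) =
  \pi_(moduli K r n) (stable_torus_act t x).
Proof.
have /eqmodP/asboolP[g gU xE] : repr (\pi_(moduli K r n) x) = x
    %[mod {eq_quot gl_equiv_rel K r n}] by rewrite reprK.
apply/eqmodP/asboolP; exists g => //=.
by rewrite -quiver_torus_act_gl -xE.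
Qed.

(* The image of t |-> (t^alpha, t^beta, t^w_1, ..., t^w_r). *)
Definition subtorus (alpha beta : nat) (w : 'I_r -> int) : set torus :=
  [set tau | exists2 t : K, t != 0 &
     [/\ tor1 tau = t ^+ alpha, tor2 tau = t ^+ beta
       & forall k, tore tau 0 k = t ^ w k]].

Definition fixed_locus (H : set torus) : set (moduli K r n) :=
  [set x | forall t, H t -> torus_act t x = x].

End TorusAction.

Definition weight (r m : nat) (k : 'I_r) : int := if (k < m)%N then 1 else 0.

(* A formal power series in q is its sequence of coefficients. *)
Definition fps := nat -> int.

Definition fps1 : fps := fun n => if n is 0 then 1 else 0.

Definition fps_mul (f g : fps) : fps :=
  fun n => \sum_(k < n.+1) f k * g (n - k)%N.

Fixpoint fps_inv_seq (f : fps) (n : nat) : seq int :=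
  if n is n'.+1 then
    let s := fps_inv_seq f n' in
    rcons s (- (f 0%N)^-1 * \sum_(k < n) s`_k * f (n - k)%N)
  else [:: (f 0%N)^-1].

Definition fps_inv (f : fps) : fps := fun n => (fps_inv_seq f n)`_n.

Lemma size_fps_inv_seq f n : size (fps_inv_seq f n) = n.+1.
Proof. by elim: n => //= n IH; rewrite size_rcons IH. Qed.

Lemma nth_fps_inv_seq f n k : (k <= n)%N -> (fps_inv_seq f n)`_k = fps_inv f k.
Proof.
elim: n => [|n IH]; first by rewrite leqn0 => /eqP ->.
rewrite leq_eqVlt => /orP[/eqP -> //|kn].
by rewrite /= nth_rcons size_fps_inv_seq kn IH.
Qed.

Lemma fps_mulV f : f 0%N \is a GRing.unit -> fps_mul (fps_inv f) f = fps1.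
Proof.
move=> f0; apply/funext => -[|n].
  by rewrite /fps_mul big_ord1 /fps_inv /= mulVr.
rewrite /fps_mul big_ord_recr /= subnn /fps_inv /= nth_rcons.
rewrite size_fps_inv_seq ltnn eqxx mulrAC mulNr mulVr// mulN1r.
apply/eqP; rewrite subr_eq0; apply/eqP/eq_bigr => k _.
by rewrite [in RHS]nth_fps_inv_seq // -ltnS.
Qed.

Definition qpoch_part (a b : {poly int}) (N : nat) : {poly int} :=
  \prod_(i < N) (1 - a * b ^+ i).

(* The infinite product (a; b)_oo, for b without constant term: by qpoch_stable,
   its n-th coefficient is that of every partial product with more than n
   factors. *)
Definition qpoch (a b : {poly int}) : fps := fun n => (qpoch_part a b n.+1)`_n.

Lemma qpoch_stable (a b : {poly int}) (n N : nat) : b`_0 = 0 -> (n < N)%N ->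
  (qpoch_part a b N)`_n = qpoch a b n.
Proof.
move=> b0; have [c ->] : exists c, b = c * 'X.
  have /factor_theorem[c ->] : root b 0 by rewrite /root horner_coef0 b0.
  by exists c; rewrite subr0.
elim: N => // N IH; rewrite ltnS leq_eqVlt => /predU1P[->//|nN].
rewrite -(IH nN) /qpoch_part big_ord_recr /= mulrBr mulr1 coefB.
by rewrite exprMn !mulrA coefMXn nN subr0.
Qed.

(* (a_1, ..., a_k; b)_oo *)
Definition qpochs (s : seq {poly int}) (b : {poly int}) : fps :=
  foldr (fun a f => fps_mul (qpoch a b) f) fps1 s.

(* Main.v *)
(* Let w_l be the weight of the l-th basis vector of the framing. A lift g of
   the action of t = 2 acts on a fixed point; if j were nonzero, g would have an
   infinite chain of eigenvalues 2^k. So j = 0, B1 and B2 commute, and a fixed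
   point is a quotient of C[x, y]^r of dimension n, graded by
   deg (x^a y^b e_l) = a + b - w_l.

   A one-parameter family weighted by a Groebner basis connects such a quotient,
   inside the fixed locus, to a monomial one. Degenerating lexicographically after
   the shear y -> y + x, the monomials x^a y^b e_l become the diagram of a strict
   partition lam_l for each l; degenerating after e_l' -> e_l' + y^d e_l, with
   d = w_l - w_l', moves monomials from label l to a label l' > l. As the sum of
   the labels increases, this ends, with a tuple such that the largest part of
   lam_l is at most the length of lam_(l+1), plus one if l + 1 = m. The
   dimensions of the graded pieces are locally constant on the fixed locus and
   determine such a tuple, so the components are counted by these tuples.

   Their generating function is a multiple sum of Rogers-Ramanujan type. A
   bounded version of it is evaluated by iterating the Bailey lemma from the unit
   Bailey pair; in the limit the result is a theta series, and the Jacobi triple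
   product turns it into the product of the theorem. *)

Require Import Defs.
From HB Require Import structures.
From mathcomp Require Import all_boot all_order all_algebra finmap.
From mathcomp Require Import all_classical all_reals all_analysis complex.
From mathcomp Require Import ring zify.

Set Implicit Arguments.
Unset Strict Implicit.
Unset Printing Implicit Defensive.

Import Order.TTheory GRing.Theory Num.Theory.
Import numFieldTopology.Exports numFieldNormedType.Exports.

(** * Gaussian binomials and the Bailey chain *)

Local Open Scope ring_scope.

(** In the tuples the length s of one partition caps the parts of the next, so the generating
    function is a nested sum of q^(s(s+1)/2) [N, s], and each level is the Bailey lemma relative to
    a = q with one parameter sent to infinity and the other equal to - q. The single irregular cap,
    where l + 1 = m, breaks this chain; there a kernel of size s + 1 is rewritten by two kernels of
    size s with neighbouring indices. The steps before and after the break act differently on the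
    exponents, which produces the two bases q^(m+1) and q^(r-m+1).

    On the geometric side the lift of t = 2 suffices: its eigenvalues separate degrees, and a
    grading provides lifts of every t. The weights w_l do not increase with l, so for l < l' the
    monomial y^(w_l - w_l') e_l exists and has the degree of e_l'; this explains both the direction
    in which monomials move and the extra one in the cap. When no move is left, each graded piece is
    filled from the highest label downwards, hence its dimension determines the share of every
    label. *)

Section QBinomial.
Variables (R : comNzRingType) (q : R).

Definition qpp (a b : R) (n : nat) : R := \prod_(i < n) (1 - a * b ^+ i).

(** The Gaussian binomial, by the q-Pascal rule rather than as a quotient, so that it is a
    polynomial in q. *)
Fixpoint qbin (n s : nat) : R :=
  match n, s with
  | _, 0 => 1
  | 0, _.+1 => 0
  | n.+1, s.+1 => q ^+ s.+1 * qbin n s.+1 + qbin n s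
  end.

Lemma qpp0 a b : qpp a b 0 = 1. Proof. by rewrite /qpp big_ord0. Qed.

Lemma qppS a b n : qpp a b n.+1 = qpp a b n * (1 - a * b ^+ n).
Proof. by rewrite /qpp big_ord_recr. Qed.

Lemma qppSl a b n : qpp a b n.+1 = (1 - a) * qpp (a * b) b n.
Proof.
rewrite /qpp big_ord_recl expr0 mulr1; congr (_ * _).
by apply: eq_bigr => i _; rewrite -mulrA -exprS.
Qed.

Lemma qppD a b n k : qpp a b (n + k) = qpp a b n * qpp (a * b ^+ n) b k.
Proof.
elim: k => [|k IH]; first by rewrite addn0 qpp0 mulr1.
by rewrite addnS !qppS IH exprD !mulrA.
Qed.

Lemma qbinn0 n : qbin n 0 = 1. Proof. by case: n. Qed.

Lemma qbin_small n s : (n < s)%N -> qbin n s = 0.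
Proof.
elim: n s => [|n IH] [|s] //= ns; rewrite !IH ?mulr0 ?addr0 //; lia.
Qed.

Lemma qbinnn n : qbin n n = 1.
Proof. by elim: n => //= n ->; rewrite qbin_small // mulr0 add0r. Qed.

Lemma qbinS n s : qbin n.+1 s.+1 = qbin n s.+1 + q ^+ (n - s) * qbin n s.
Proof.
elim: n s => [|n IH] s; first by case: s => [|s]; rewrite sub0n /= ?mulr0 ?addr0 ?mulr1 ?add0r ?expr0.
rewrite -[LHS]/(q ^+ s.+1 * qbin n.+1 s.+1 + qbin n.+1 s).
case: s => [|s]; first by rewrite [in LHS]IH /= !qbinn0 !subn0 !exprS expr0; ring.
rewrite [in LHS]IH [in LHS]IH subSS -[qbin n.+1 s.+1]/(q ^+ s.+1 * qbin n s.+1 + qbin n s).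
rewrite -[qbin n.+1 s.+2]/(q ^+ s.+2 * qbin n s.+2 + qbin n s.+1).
have [ns|sn] := ltnP n s.+1; first by rewrite (@qbin_small n s.+1) //; ring.
have E : q ^+ s.+2 * q ^+ (n - s.+1) = q ^+ (n - s) * q ^+ s.+1.
  by rewrite -!exprD; congr (_ ^+ _); lia.
by rewrite mulrDr [q ^+ s.+2 * (_ * _)]mulrA E; ring.
Qed.

Lemma qbin_sym n s : (s <= n)%N -> qbin n (n - s) = qbin n s.
Proof.
elim: n s => [|n IH] [|s] sn //; rewrite ?subn0 ?qbinnn //.
have [->|sn'] := eqVneq s n; first by rewrite subnn qbinnn.
rewrite subSS; have -> : (n - s = (n - s.+1).+1)%N by lia.
rewrite qbinS -[in RHS]/(q ^+ s.+1 * qbin n s.+1 + qbin n s).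
have -> : ((n - s.+1).+1 = n - s)%N by lia.
rewrite !IH; [|lia|lia].
by have -> : (n - (n - s.+1) = s.+1)%N; [lia|rewrite addrC].
Qed.

Lemma qbin_fact n s : (s <= n)%N ->
  qbin n s * (qpp q q s * qpp q q (n - s)) = qpp q q n.
Proof.
elim: n s => [|n IH] [|s] sn; rewrite ?qpp0 ?mul1r ?qbinn0 ?mul1r //.
rewrite -[qbin _ _]/(q ^+ s.+1 * qbin n s.+1 + qbin n s) subSS.
have [->|sn'] := eqVneq s n.
  by rewrite subnn qpp0 qbin_small // qbinnn; ring.
have E1 := IH s.+1 ltac:(lia); have E2 := IH s sn.
have nsE : (n - s = (n - s.+1).+1)%N by lia.
rewrite [qpp q q n.+1]qppS -E2 mulrDl.
have -> : q ^+ n = q ^+ s * q ^+ (n - s) by rewrite -exprD; congr (_ ^+ _); lia.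
rewrite -E2 in E1; move: E1; rewrite nsE !qppS.
rewrite [q ^+ (n - s.+1).+1]exprS exprS.
set u := qbin n s.+1; set v := qbin n s.
set x := qpp q q s; set y := qpp q q (n - s.+1).
set X := q ^+ s; set Y := q ^+ (n - s.+1) => E1.
have -> : q * X * u * (x * (1 - q * X) * (y * (1 - q * Y))) =
  (q * X) * (1 - q * Y) * (u * (x * (1 - q * X) * y)) by ring.
by rewrite E1; ring.
Qed.

Lemma qbinomial_theorem x n :
  \sum_(s < n.+1) (- x) ^+ s * q ^+ 'C(s, 2) * qbin n s = qpp x q n.
Proof.
elim: n x => [|n IH] x; first by rewrite big_ord_recl big_ord0 qpp0 /=; ring.
rewrite qppSl -IH big_ord_recl /= mulr_sumr.
under eq_bigr => i _.
  rewrite /bump leq0n !add1n /= binS bin1 exprD mulrDr.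
  over.
rewrite big_split /= big_ord_recr /= qbin_small // !mulr0 addr0.
rewrite -[X in _ = X](@eq_bigr _ _ _ _ _ _ (fun i : 'I_n.+1 =>
  (- x) ^+ i * q ^+ 'C(i, 2) * q ^+ i * qbin n i -
  x * ((- x) ^+ i * q ^+ 'C(i, 2) * q ^+ i * qbin n i))); last first.
  by move=> i _; rewrite -[- (x * q)]mulNr exprMn; ring.
rewrite big_split /= addrA; congr (_ + _); last first.
  by apply: eq_bigr => i _; rewrite exprS; ring.
rewrite [RHS]big_ord_recl /= qbinn0 !expr0 !mulr1; congr (_ + _).
by apply: eq_bigr => i _; rewrite /bump leq0n !add1n /= binS bin1 exprD; ring.
Qed.

(* In the induction d is replaced by d q. *)
Lemma q_chu_vandermonde b d n :
  \sum_(t < n.+1) qbin n t * qpp b q t * (- d) ^+ t * q ^+ 'C(t, 2)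
     * qpp (b * d * q ^+ t) q (n - t) = qpp d q n.
Proof.
elim: n d => [|n IH] d.
  by rewrite big_ord_recl big_ord0 !qpp0 qbinn0 /=; ring.
rewrite qppSl -IH big_ord_recl mulr_sumr /= subn0.
under eq_bigr => i _.
  rewrite /bump leq0n !add1n /= subSS binS bin1 mulrDl !mulrDl exprD.
  over.
rewrite big_split /= addrA.
rewrite [X in _ + X + _]big_ord_recr /= qbin_small // mulr0 !mul0r addr0.
have -> : 1 * qpp b q 0 * (- d) ^+ 0 * q ^+ 'C(0, 2) * qpp (b * d * q ^+ 0) q n.+1
    + \sum_(i < n) q ^+ i.+1 * qbin n i.+1 * qpp b q i.+1 * (- d) ^+ i.+1
       * (q ^+ 'C(i, 2) * q ^+ i) * qpp (b * d * q ^+ i.+1) q (n - i) =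
  \sum_(i < n.+1) q ^+ i * qbin n i * qpp b q i * (- d) ^+ i *
       q ^+ 'C(i, 2) * qpp (b * d * q ^+ i) q (n.+1 - i).
  rewrite [RHS]big_ord_recl /= !expr0 qbinn0 subn0; congr (_ + _); first by ring.
  apply: eq_bigr => i _.
  by rewrite /bump leq0n !add1n /= subSS binS bin1 exprD; ring.
rewrite -big_split /=; apply: eq_bigr => i _.
rewrite subSn; last by have := ltn_ord i; lia.
rewrite qppSl qppS exprS.
have -> : b * d * q ^+ i * q = b * (d * q) * q ^+ i by ring.
have -> : b * d * q ^+ i.+1 = b * (d * q) * q ^+ i by rewrite exprS; ring.
have -> : (- (d * q)) ^+ i = (- d) ^+ i * q ^+ i by rewrite -mulNr exprMn.
by ring.
Qed.

End QBinomial.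

(* By strict_tuples_gf, the generating function of the tuples counted below, with
   largest part at most N. *)
Fixpoint tuples_gf (R : comNzRingType) (q : R) (m k N : nat) : R :=
  if k is k'.+1 then
    \sum_(s < N.+1) q ^+ 'C(s.+1, 2) * qbin q N s * tuples_gf q m k' (s + (k' == m))
  else 1.

Section BaileyChain.
Variables (F : fieldType) (q : F).
Hypothesis q_neq1 : forall n, q ^+ n.+1 != 1.

Local Notation "n `!q" := (qpp q q n) (at level 2, format "n `!q").
Local Notation "n `+q" := (qpp (- q) q n) (at level 2, format "n `+q").

Lemma qfact_neq0 n : n`!q != 0.
Proof.
apply/prodf_neq0 => i _.
by rewrite subr_eq0 eq_sym -exprS q_neq1.
Qed.

Lemma qbin_quot n s : (s <= n)%N -> qbin q n s = n`!q / (s`!q * (n - s)`!q).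
Proof. by move=> sn; rewrite -(qbin_fact q sn) mulfK // mulf_neq0 ?qfact_neq0. Qed.

(** The kernel 1 / ((q)_(N-j) (q)_(N+j+1)) of Bailey pairs relative to a = q, up to the factor 1 -
    q. The normalisation by (q)_N (-q)_N makes a step of the chain exactly the weighted sum of
    [tuples_gf]. *)
Definition bailey (N j : nat) : F :=
  if (j <= N)%N then N`!q * N`+q / ((N - j)`!q * (N + j).+1`!q) else 0.

(** The Bailey lemma with parameters infinity and - q. With s = j + t and N = j + n it is a
    q-Chu-Vandermonde sum whose two parameters both equal - q^(j+1). *)
Lemma bailey_step N j :
  \sum_(s < N.+1) q ^+ 'C(s.+1, 2) * qbin q N s * bailey s j =
  q ^+ 'C(j.+1, 2) * bailey N j.
Proof.
rewrite /bailey; case: leqP => [jN|Nj]; last first.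
  rewrite mulr0 big1 // => s _; case: leqP => //; last by rewrite mulr0.
  by have := ltn_ord s; lia.
have [n ->] : exists n, N = (j + n)%N by exists (N - j)%N; lia.
rewrite -addnS big_split_ord /= big1 ?add0r; last first.
  by move=> s _; rewrite leqNgt ltn_ord mulr0.
pose b := - q ^+ j.+1.
have E t : (t <= n)%N -> q ^+ 'C((j + t).+1, 2) * qbin q (j + n) (j + t) *
    (if (j <= j + t)%N then
       (j + t)`!q * (j + t)`+q / ((j + t - j)`!q * (j + t + j).+1`!q) else 0) =
  q ^+ 'C(j.+1, 2) * ((j + n)`!q * j`+q / (n`!q * (j + n + j).+1`!q)) *
   (qbin q n t * qpp b q t * (- b) ^+ t * q ^+ 'C(t, 2)
     * qpp (b * b * q ^+ t) q (n - t)).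
  move=> tn; rewrite leq_addr !qbin_quot ?leq_add2l // subnDl addKn.
  have -> : 'C((j + t).+1, 2) = ('C(j.+1, 2) + ('C(t, 2) + j.+1 * t))%N.
    elim: t {tn} => [|t IH]; first by rewrite muln0 !addn0.
    by rewrite addnS binS IH bin1 (binS t) bin1 mulnS; lia.
  have -> : (j + n + j).+1 = ((j + t + j).+1 + (n - t))%N by lia.
  rewrite [qpp q q (_ + (n - t))]qppD.
  have -> : q * q ^+ (j + t + j).+1 = b * b * q ^+ t.
    by rewrite /b mulrNN -!exprD -exprS; congr (_ ^+ _); lia.
  have -> : (j + t)`+q = j`+q * qpp b q t.
    by rewrite qppD; congr (_ * qpp _ _ _); rewrite /b exprS mulNr.
  have -> : (- b) ^+ t = q ^+ (j.+1 * t) by rewrite opprK exprM.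
  rewrite !exprD.
  have H1 := qfact_neq0 (j + t); have H2 := qfact_neq0 (n - t).
  have H3 := qfact_neq0 t; have H4 := qfact_neq0 n.
  have H5 := qfact_neq0 (j + t + j).+1.
  have H6 : qpp (b * b * q ^+ t) q (n - t) != 0.
    apply/prodf_neq0 => i _; rewrite subr_eq0 eq_sym /b mulrNN -!exprD.
    exact: q_neq1.
  by field; rewrite ?H1 ?H2 ?H3 ?H4 ?H5 ?H6.
rewrite (eq_bigr _ (fun (t : 'I_n.+1) _ => E t (leq_ord t))) -mulr_sumr q_chu_vandermonde addKn -!mulrA; congr (_ * _).
have -> : (j + n)`+q = j`+q * qpp b q n.
  by rewrite qppD; congr (_ * qpp _ _ _); rewrite /b exprS mulNr.
by field; rewrite !qfact_neq0.
Qed.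

Lemma bailey_small N j : (N < j)%N -> bailey N j = 0.
Proof. by rewrite /bailey; case: leqP => //; lia. Qed.

(* Partial sums of the unit Bailey pair telescope. *)
Lemma bailey_unit N M : (N < M)%N ->
  \sum_(j < M) (-1) ^+ j * q ^+ 'C(j, 2) * (1 - q ^+ j.*2.+1) * bailey N j
  = (N == 0%N)%:R.
Proof.
move=> NM; have -> : \sum_(j < M) (-1) ^+ j * q ^+ 'C(j, 2) * (1 - q ^+ j.*2.+1) * bailey N j =
   \sum_(j < N.+1) (-1) ^+ j * q ^+ 'C(j, 2) * (1 - q ^+ j.*2.+1) * bailey N j.
  rewrite -(subnKC NM) big_split_ord /= [X in _ + X]big1 ?addr0 // => i _.
  by rewrite bailey_small ?mulr0 //; lia.
case: N {NM} => [|N].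
  rewrite big_ord1 /bailey /= double0 expr0 !mul1r expr1 !qpp0 qppS qpp0 !mul1r.
  rewrite expr0 mulr1 mulfV // subr_eq0 eq_sym; exact: (q_neq1 0).
have S J : (J < N.+1)%N ->
   \sum_(j < J.+1) (-1) ^+ j * q ^+ 'C(j, 2) * (1 - q ^+ j.*2.+1) * bailey N.+1 j
   = (-1) ^+ J * q ^+ 'C(J.+1, 2) * (1 - q ^+ J.+1) *
     (N`!q * N.+1`+q / ((N - J)`!q * (N + J).+2`!q)).
  have H x : 1 - q * q ^+ x != 0 by rewrite subr_eq0 eq_sym -exprS.
  elim: J => [|J IH] JN.
    rewrite big_ord1 /bailey /= addn0 subn0 qppS.
    by rewrite expr0 !subn0 addn0; field; rewrite !qfact_neq0 H.
  rewrite big_ord_recr /= IH /bailey; last by lia.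
  rewrite (ltnW JN) subSS.
  have [d dE] : exists d, (N - J = d.+1)%N by exists (N - J).-1; lia.
  have -> : (N - J.+1 = d)%N by lia.
  have NE : N = (J + d).+1 by lia.
  have -> : (N.+1 + J.+1).+1 = (N + J).+3 by lia.
  have -> : 'C(J.+2, 2) = ('C(J.+1, 2) + J.+1)%N by rewrite binS bin1.
  have -> : J.+1.*2.+1 = (J + J).+3 by lia.
  rewrite dE (qppS _ _ (N + J).+2) (qppS _ _ d) (qppS q q N).
  have H1 := H d; have H2 := H (N + J).+2; move: H2.
  have -> : q ^+ (N + J).+2 = q ^+ 3 * (q ^+ J * q ^+ J * q ^+ d).
    by rewrite -!exprD; congr (_ ^+ _); lia.
  have -> : q ^+ N = q * (q ^+ J * q ^+ d).
    by rewrite -!exprD -exprS; congr (_ ^+ _); lia.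
  have -> : q ^+ (J + J).+3 = q ^+ 3 * (q ^+ J * q ^+ J).
    by rewrite -!exprD; congr (_ ^+ _); lia.
  rewrite !exprD !exprS !expr0 !mulr1 => H2.
  by field; rewrite !qfact_neq0 H1 H2.
rewrite big_ord_recr /= S // /bailey leqnn subnn qpp0 mul1r.
have -> : (N.+1 + N.+1).+1 = (N + N).+3 by lia.
rewrite (qppS _ _ (N + N).+2) (qppS q q N).
have -> : N.+1.*2.+1 = (N + N).+3 by lia.
have H2 : 1 - q * q ^+ (N + N).+2 != 0 by rewrite subr_eq0 eq_sym -exprS.
rewrite (exprS q (N + N).+2) (exprS (-1) N) (exprS q N).
by rewrite subnn qpp0; field; rewrite !qfact_neq0 H2.
Qed.

(** Bridges the irregular cap s + 1. At j = 0 the truncated predecessor is the right value: the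
    kernel is invariant under j -> - 1 - j, so its value at - 1 is the one at 0. *)
Lemma bailey_shift s j :
  (1 - q ^+ j.*2.+1) * bailey s.+1 j =
  bailey s j.-1 - q ^+ j.*2.+1 * bailey s j.+1.
Proof.
have H x : 1 - q * q ^+ x != 0 by rewrite subr_eq0 eq_sym -exprS.
have H0 : 1 - q != 0 by have := H 0%N; rewrite expr0 mulr1.
have E : (s.+1)`!q * s.+1`+q = s`!q * s`+q * (1 - q ^+ s.+1 * q ^+ s.+1).
  by rewrite !qppS !exprS; ring.
case: j => [|j].
  rewrite /bailey /= !subn0 !addn0 addn1 E double0 !expr1.
   case: s {E} => [|s].
    by have := H 1%N; rewrite ltnn !qppS !qpp0 !exprS !expr0 !mulr1 => H1; field; rewrite ?H1 ?H0.
  rewrite /= subSS subn0 (qppS _ _ s.+2) (qppS _ _ s.+1) (qppS q q s).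
  have := H s.+2; have := H s.+1; rewrite !exprS => H1 H2.
  by field; rewrite !qfact_neq0 H H1 H2.
have [sj|js] := ltnP s j.
  by rewrite !bailey_small ?mulr0 ?subr0 //; lia.
have [d sE] : exists d, s = (j + d)%N by exists (s - j)%N; lia.
rewrite sE {js sE} in E *; rewrite /bailey.
have w1 := H (j + j + d).+1; have w2 := H (j + j + d).+2.
have -> : (j < (j + d).+1)%N by lia.
have -> : (j.+1.-1 <= j + d)%N by rewrite /=; lia.
rewrite E {E} subSS /= !addKn.
have -> : ((j + d).+1 + j.+1 = (j + j + d).+2)%N by lia.
have -> : (j + d + j = j + j + d)%N by lia.
have -> : ((j + d + j.+2).+1 = (j + j + d).+3)%N by lia.
have -> : j.+1.*2.+1 = (j + j).+3 by lia.
rewrite !(qppS q q (j + j + d).+2) (qppS q q (j + j + d).+1).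
case: d w1 w2 => [|[|d]] w1 w2.
- rewrite !addn0 in w1 w2 *; have -> : (j.+1 < j)%N = false by lia.
  rewrite qpp0; move: w1 w2; rewrite !exprS !exprD => w1 w2.
  by field; rewrite !qfact_neq0 w1 w2.
- have -> : (j.+1 < j + 1)%N = false by lia.
  rewrite qppS qpp0; move: w1 w2; rewrite !addn1 !exprS expr0 !exprD => w1 w2.
  by field; rewrite !qfact_neq0 w1 w2 H0.
have -> : (j.+1 < j + d.+2)%N by lia.
have -> : (j + d.+2 - j.+2 = d)%N by lia.
rewrite !(qppS q q d.+1) (qppS q q d).
have := H d.+1; have := H d; move: w1 w2.
rewrite !addnS !exprS !exprD => w1 w2 d1 d2.
by field; rewrite !qfact_neq0 w1 w2 d1 d2.
Qed.

(** The exponents collect the m + 1 steps before the shift, common to both kernels, and the k steps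
    after it, each of which contributes binomial(j, 2) to the kernel of index j - 1 and binomial(j +
    2, 2) to that of index j + 1. *)
Definition chain_term (m k N j : nat) : F :=
  (-1) ^+ j * q ^+ ('C(j, 2) + m.+1 * 'C(j.+1, 2)) *
  (q ^+ (k * 'C(j, 2)) * bailey N j.-1
   - q ^+ (j.*2.+1 + k * 'C(j.+2, 2)) * bailey N j.+1).

Lemma tuples_gf_low m k N M : (k <= m)%N -> (N < M)%N ->
  tuples_gf q m k N = \sum_(j < M) (-1) ^+ j * q ^+ ('C(j, 2) + k.+1 * 'C(j.+1, 2))
     * (1 - q ^+ j.*2.+1) * bailey N j.
Proof.
have step (f : nat -> F) (c : nat -> F) : (forall s M, (s < M)%N ->
     f s = \sum_(j < M) c j * bailey s j) -> forall N M, (N < M)%N ->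
   \sum_(s < N.+1) q ^+ 'C(s.+1, 2) * qbin q N s * f s =
   \sum_(j < M) c j * q ^+ 'C(j.+1, 2) * bailey N j.
  move=> fE {}N {}M NM.
  rewrite (eq_bigr (fun s : 'I_N.+1 => \sum_(j < M)
      c j * (q ^+ 'C(s.+1, 2) * qbin q N s * bailey s j))).
    rewrite exchange_big; apply: eq_bigr => j _.
    by rewrite -mulr_sumr bailey_step mulrA.
  move=> s _; rewrite (fE s M) ?mulr_sumr; last by have := ltn_ord s; lia.
  by apply: eq_bigr => j _; ring.
move=> km; elim: k km N M => [|k IH] km N M NM.
  (* The constant 1 is itself one chain step, applied to the delta at 0 that the unit pair
     represents; hence k + 1 in the exponent after k levels. *)
  pose d (s : nat) : F := (s == 0%N)%:R.
  have -> : tuples_gf q m 0 N = \sum_(s < N.+1) q ^+ 'C(s.+1, 2) * qbin q N s * d s.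
    rewrite big_ord_recl big1 ?addr0; first by rewrite qbinn0 /= !mulr1.
    by move=> s _; rewrite mulr0.
  apply: etrans (step d
    (fun j => (-1) ^+ j * q ^+ 'C(j, 2) * (1 - q ^+ j.*2.+1)) (fun s M sM => esym (bailey_unit sM)) N M NM) _; apply: eq_bigr => j _.
  by rewrite mul1n exprD; ring.
rewrite [LHS]/= ; have -> : (k == m) = false by apply/eqP; lia.
have IH' := IH (ltnW km); under eq_bigr do rewrite addn0.
apply: etrans (step _ (fun j => (-1) ^+ j *
  q ^+ ('C(j, 2) + k.+1 * 'C(j.+1, 2)) * (1 - q ^+ j.*2.+1)) IH' N M NM) _; apply: eq_bigr => j _.
by rewrite mulSn !exprD; ring.
Qed.

(** The offset at k = 0 is that of the recursion, where the value at level m is taken at s + 1.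
    There [bailey_shift] lowers the size again at the price of two kernels, on which the later steps
    act separately. *)
Lemma tuples_gf_high m k N M : (N.+1 < M)%N ->
  tuples_gf q m (m + k) (N + (k == 0%N)) = \sum_(j < M) chain_term m k N j.
Proof.
elim: k N M => [|k IH] N M NM.
  rewrite addn0 addn1 (@tuples_gf_low _ _ _ M) //; apply: eq_bigr => j _.
  by rewrite /chain_term !mul0n addn0 expr0 mul1r -mulrA bailey_shift.
rewrite addnS addn0 [LHS]/=.
rewrite (eq_bigr (fun s : 'I_N.+1 => \sum_(j < M)
      q ^+ 'C(s.+1, 2) * qbin q N s * chain_term m k s j)).
  rewrite exchange_big; apply: eq_bigr => j _ /=.
  rewrite /chain_term.
  rewrite (eq_bigr (fun s : 'I_N.+1 =>
    (-1) ^+ j * q ^+ ('C(j, 2) + m.+1 * 'C(j.+1, 2)) * q ^+ (k * 'C(j, 2)) *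
      (q ^+ 'C(s.+1, 2) * qbin q N s * bailey s j.-1)
    - (-1) ^+ j * q ^+ ('C(j, 2) + m.+1 * 'C(j.+1, 2)) *
      q ^+ (j.*2.+1 + k * 'C(j.+2, 2)) *
      (q ^+ 'C(s.+1, 2) * qbin q N s * bailey s j.+1))); last by move=> s _; ring.
  rewrite big_split /= sumrN -!mulr_sumr !bailey_step.
  have -> : 'C(j.-1.+1, 2) = 'C(j, 2) by case: (val j).
  by rewrite !mulSn !exprD; ring.
move=> s _; rewrite -mulr_sumr -(IH s M) ?eqn_addl; last by have := ltn_ord s; lia.
by rewrite -[X in _ == X]addn0 eqn_add2l.
Qed.

End BaileyChain.

Section Morphism.
Variables (R S : comNzRingType) (f : {rmorphism R -> S}).

Lemma rmorph_qpp a b n : f (qpp a b n) = qpp (f a) (f b) n.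
Proof.
rewrite rmorph_prod; apply: eq_bigr => i _.
by rewrite rmorphB rmorph1 rmorphM rmorphXn.
Qed.

Lemma rmorph_qbin q n s : f (qbin q n s) = qbin (f q) n s.
Proof.
elim: n s => [|n IH] [|s]; rewrite /= ?rmorph1 ?rmorph0 //.
by rewrite rmorphD rmorphM rmorphXn !IH.
Qed.

Lemma rmorph_tuples_gf q m k N : f (tuples_gf q m k N) = tuples_gf (f q) m k N.
Proof.
elim: k N => [|k IH] N /=; first by rewrite rmorph1.
rewrite rmorph_sum; apply: eq_bigr => s _.
by rewrite !rmorphM rmorphXn rmorph_qbin IH.
Qed.

End Morphism.

(** * The finite identity over Z[X] *)

Section FiniteIdentity.
Import FracField.
Local Notation x := ('X : {poly int}).
Local Notation "n `!q" := (qpp x x n) (at level 2, format "n `!q").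

(** The kernel [bailey] times (q)_(2N+1) / ((q)_N (-q)_N), which has no denominator. *)
Definition central_qbin (R : comNzRingType) (q : R) (N j : nat) : R :=
  if (j <= N)%N then qbin q (N + N).+1 (N - j) else 0.

Definition chain_poly (m k N j : nat) : {poly int} :=
  (-1) ^+ j * x ^+ ('C(j, 2) + m.+1 * 'C(j.+1, 2)) *
  (x ^+ (k * 'C(j, 2)) * central_qbin x N j.-1
   - x ^+ (j.*2.+1 + k * 'C(j.+2, 2)) * central_qbin x N j.+1).

(** The chain is run in the fraction field of Z[X] at q = X, where no positive power of q is 1.
    Multiplied by (q)_(2N+1), both sides come from Z[X], which embeds. *)
Lemma tuples_gf_finite m k N :
  (N + N).+1`!q * tuples_gf x m (m + k) (N + (k == 0%N)) =
  N`!q * qpp (- x) x N * \sum_(j < N.+2) chain_poly m k N j.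
Proof.
pose f : {rmorphism {poly int} -> {fraction {poly int}}} :=
  GRing.RMorphism.clone _ _ (@tofrac {poly int}) _; pose q := f x.
have q1 n : q ^+ n.+1 != 1.
  rewrite -rmorphXn -(rmorph1 f) [_ == _]tofrac_eq; apply/eqP => /(congr1 (fun p : {poly int} => p`_0)).
  by rewrite coefXn coef1.
have f_inj : injective f by move=> u v /eqP; rewrite [_ == _]tofrac_eq => /eqP.
apply: f_inj.
rewrite !rmorphM !rmorph_qpp rmorph_tuples_gf rmorphN rmorph_sum /= -/q.
rewrite (@tuples_gf_high _ _ q1 _ _ _ N.+2) //.
have E j : qpp q q (N + N).+1 * bailey q N j =
   qpp q q N * qpp (- q) q N * central_qbin q N j.
  rewrite /bailey /central_qbin; case: leqP => jN; last by rewrite !mulr0.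
  rewrite qbin_quot //; last by lia.
  have -> : ((N + N).+1 - (N - j) = (N + j).+1)%N by lia.
  by ring.
rewrite !mulr_sumr; apply: eq_bigr => j _.
rewrite /chain_poly /chain_term !(rmorphM, rmorphB, rmorphXn, rmorphN, rmorph1) /= -/q.
have C i : f (central_qbin x N i) = central_qbin q N i.
  by rewrite /central_qbin; case: ifP => _; rewrite ?rmorph0 // rmorph_qbin.
rewrite !C; have E1 := E j.-1; have E2 := E j.+1.
set a := (-1) ^+ j; set b := q ^+ _; set c := q ^+ _; set d := q ^+ (j.*2.+1 + _).
transitivity (a * b * (c * (qpp q q (N + N).+1 * bailey q N j.-1)
   - d * (qpp q q (N + N).+1 * bailey q N j.+1))); first by ring.
by rewrite E1 E2; ring.
Qed.

End FiniteIdentity.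

(** * The limit and the Jacobi triple product *)

Section ModX.
Local Notation x := ('X : {poly int}).
Implicit Types p : {poly int}.

(** Congruence modulo X^n; with the cofactor explicit, its closure properties are ring
    identities. *)
Definition eqX n p p' := exists c, p = p' + c * x ^+ n.

Lemma eqX_refl n p : eqX n p p.
Proof. by exists 0; rewrite mul0r addr0. Qed.

Lemma eqX_sym n p p' : eqX n p p' -> eqX n p' p.
Proof. by case=> c ->; exists (- c); ring. Qed.

Lemma eqX_trans n p1 p2 p3 : eqX n p1 p2 -> eqX n p2 p3 -> eqX n p1 p3.
Proof. by case=> c -> [d ->]; exists (c + d); ring. Qed.

Lemma eqXD n p1 p2 p3 p4 : eqX n p1 p2 -> eqX n p3 p4 -> eqX n (p1 + p3) (p2 + p4).
Proof. by case=> c -> [d ->]; exists (c + d); ring. Qed.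

Lemma eqXM n p1 p2 p3 p4 : eqX n p1 p2 -> eqX n p3 p4 -> eqX n (p1 * p3) (p2 * p4).
Proof.
by case=> c -> [d ->]; exists (p2 * d + c * p4 + c * d * x ^+ n); ring.
Qed.

Lemma eqXMl n p p1 p2 : eqX n p1 p2 -> eqX n (p * p1) (p * p2).
Proof. by apply: eqXM; apply: eqX_refl. Qed.

Lemma eqX_sum n (I : Type) (s : seq I) (P : pred I) (f g : I -> {poly int}) :
  (forall i, P i -> eqX n (f i) (g i)) ->
  eqX n (\sum_(i <- s | P i) f i) (\sum_(i <- s | P i) g i).
Proof.
move=> fg; apply: (big_ind2 (eqX n)); [exact: eqX_refl | | exact: fg].
by move=> ? ? ? ?; apply: eqXD.
Qed.

Lemma eqX_0 n k p : (n <= k)%N -> eqX n (p * x ^+ k) 0.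
Proof.
by move=> nk; exists (p * x ^+ (k - n)); rewrite add0r -mulrA -exprD subnK.
Qed.

Lemma eqX_coef n p p' i : eqX n p p' -> (i < n)%N -> p`_i = p'`_i.
Proof. by case=> c -> ni; rewrite coefD coefMXn ni addr0. Qed.

Lemma eqX_coefP n p p' : (forall i, (i < n)%N -> p`_i = p'`_i) -> eqX n p p'.
Proof.
move=> pp'; exists (drop_poly n (p - p')).
rewrite -[p in LHS](subrK p') addrC -[p - p' in LHS](poly_take_drop n).
have -> : take_poly n (p - p') = 0.
  by apply/polyP => i; rewrite coef_take_poly coefB coef0; case: ifP => // /pp' ->; rewrite subrr.
by rewrite add0r.
Qed.

(** A polynomial 1 - v X is invertible modulo X^n, an inverse being the truncated geometric sum of
    the (v X)^i. *)
Lemma eqX_cancel n (u : {poly int}) p p' : u`_0 = 1 -> eqX n (u * p) (u * p') -> eqX n p p'.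
Proof.
move=> u0 e.
have [v vE] : exists v, u = 1 - v * x.
  have /factor_theorem[v vE] : root (1 - u) 0.
    by rewrite /root hornerD hornerN hornerC horner_coef0 u0 subrr.
  by exists v; rewrite subr0 in vE; rewrite -vE opprB addrC subrK.
pose w := \sum_(i < n) (v * x) ^+ i.
have wu : w * u = 1 - v ^+ n * x ^+ n.
  rewrite vE mulrC -opprB mulNr -subrX1 opprB -exprMn; ring.
have W q : eqX n (w * (u * q)) q by exists (- (v ^+ n * q)); rewrite mulrA wu; ring.
exact: eqX_trans (eqX_sym (W p)) (eqX_trans (eqXMl _ e) (W p')).
Qed.

Lemma qpp_coef0 (a b : {poly int}) n : a`_0 = 0 -> (qpp a b n)`_0 = 1.
Proof.
move=> a0; elim: n => [|n IH]; first by rewrite qpp0 coef1.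
by rewrite qppS coef0M IH coefB coef1 coef0M a0 mul0r subr0 mulr1.
Qed.

(** As b is a positive power of X, every factor of index at least n is 1 modulo X^n. *)
Lemma qpp_stab n e (a b : {poly int}) L : b = x ^+ e.+1 -> (n <= L)%N ->
  eqX n (qpp a b L) (qpp a b n).
Proof.
move=> ->; elim: L => [|L IH]; first by rewrite leqn0 => /eqP ->; apply: eqX_refl.
rewrite leq_eqVlt => /predU1P[->|nL]; first exact: eqX_refl.
rewrite qppS; apply: eqX_trans (IH nL); rewrite mulrBr mulr1 -exprM mulrA.
rewrite -[X in eqX _ _ X]subr0 -[X in X - _]addr0 -addrA.
apply: eqXD; first exact: eqX_refl.
rewrite -mulNr add0r oppr0; apply: eqX_0; nia.
Qed.

(** In the quotient formula (b)_K, (b)_s and (b)_(K-s) all agree with (b)_n modulo X^n, as both s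
    and K - s are at least n; the binomial is thus already its limit 1 / (b)_n. *)
Lemma qbin_stab n e b K s : b = x ^+ e.+1 -> (n <= s)%N -> (n + s <= K)%N ->
  eqX n (qpp b b n * qbin b K s) 1.
Proof.
move=> be ns nsK; have b0 : b`_0 = 0 by rewrite be coefXn.
have := qbin_fact b (_ : s <= K)%N; move=> /(_ ltac:(lia)) E.
apply: (@eqX_cancel n (qpp b b n)); first exact: qpp_coef0.
rewrite mulr1.
have St L : (n <= L)%N -> eqX n (qpp b b L) (qpp b b n) by apply: (qpp_stab _ be).
apply: eqX_trans _ (St K _); last by lia.
rewrite -E [X in eqX _ X](_ : _ = qbin b K s * (qpp b b n * qpp b b n));
  last by ring.
 apply: eqXMl; apply: eqX_sym.
by apply: eqXM; apply: St; lia.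
Qed.

End ModX.

(** * A finite form of the Jacobi triple product *)

Section FiniteJTP.
Variables (R : comNzRingType) (Q z w : R).
Hypothesis zw : z * w = Q.

(** The term (- z)^k Q^(k(k-1)/2) of the theta series at k = s - a. For negative k the powers of 1 /
    z are written with w = Q / z, which avoids division. *)
Let theta (a s : nat) : R :=
  if (a <= s)%N then (- z) ^+ (s - a) * Q ^+ 'C(s - a, 2)
  else (- w) ^+ (a - s) * Q ^+ 'C(a - s, 2).

Let jtp_sum a b : R := \sum_(s < (a + b).+1) theta a s * qbin Q (a + b) s.

Lemma thetaS a b s : (s <= a + b)%N ->
  theta a s.+1 * Q ^+ (a + b - s) = - z * Q ^+ b * theta a s.
Proof.
move=> sab; rewrite /theta; have [as_|sa] := leqP a s.
  rewrite (leqW as_) subSn // binS bin1 exprS exprD.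
  have -> : Q ^+ b = Q ^+ (s - a) * Q ^+ (a + b - s) by rewrite -exprD; congr (_ ^+ _); lia.
  by ring.
have [i aE] : exists i, a = (s + i).+1 by exists (a - s).-1; lia.
have -> : Q ^+ (a + b - s) = Q ^+ b * Q ^+ i * Q.
  by rewrite -mulrA -exprSr -exprD; congr (_ ^+ _); lia.
have -> : (a - s = i.+1)%N by lia.
have T : (if (a <= s.+1)%N then (- z) ^+ (s.+1 - a) * Q ^+ 'C(s.+1 - a, 2)
  else (- w) ^+ (a - s.+1) * Q ^+ 'C(a - s.+1, 2)) = (- w) ^+ i * Q ^+ 'C(i, 2).
  case: i aE => [|i] aE.
    by have -> : (a <= s.+1)%N; [lia|have -> : (s.+1 - a = 0)%N by lia].
  by have -> : (a <= s.+1)%N = false; [lia|have -> : (a - s.+1 = i.+1)%N by lia].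
by rewrite T binS bin1 exprS exprD -zw; ring.
Qed.

(** The q-Pascal rule [qbinS] splits the sum in two, and by [thetaS] the half with shifted index is
    - z Q^b times the original sum. At b = 0 the q-binomial theorem, read backwards, gives (w;
    Q)_a. *)
Lemma jtp_sumSr a b : jtp_sum a b.+1 = (1 - z * Q ^+ b) * jtp_sum a b.
Proof.
rewrite /jtp_sum addnS big_ord_recl.
under eq_bigr => s _.
  rewrite lift0 qbinS mulrDr mulrA thetaS; last by rewrite -ltnS.
  over.
rewrite big_split /= addrA mulrBl mul1r; congr (_ + _).
  rewrite big_ord_recr /= qbin_small // mulr0 addr0 [in RHS]big_ord_recl.
  by rewrite !qbinn0.
rewrite mulr_sumr -sumrN; apply: eq_bigr => s _; ring.
Qed.

Lemma jtp_sum0 a : jtp_sum a 0 = qpp w Q a.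
Proof.
rewrite /jtp_sum addn0 -qbinomial_theorem (reindex_inj rev_ord_inj) /=.
apply: eq_bigr => s _; have sa := leq_ord s.
rewrite subSS qbin_sym // /theta; case: leqP => h; last first.
  by have -> : (a - (a - s) = s)%N by lia.
by have -> : (s = 0 :> nat)%N; [lia|rewrite subn0 subnn].
Qed.

Lemma jtp_finite M :
  \sum_(j < M.+1) (- z) ^+ j * Q ^+ 'C(j, 2) * qbin Q (M + M) (M + j) +
  \sum_(j < M) (- w) ^+ j.+1 * Q ^+ 'C(j.+1, 2) * qbin Q (M + M) (M - j.+1)
  = qpp z Q M * qpp w Q M.
Proof.
have <- : jtp_sum M M = qpp z Q M * qpp w Q M.
  have H b : jtp_sum M b = qpp z Q b * qpp w Q M.
    elim: b => [|b IH]; first by rewrite jtp_sum0 qpp0 mul1r.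
    by rewrite jtp_sumSr IH qppS; ring.
  exact: H.
rewrite /jtp_sum -addnS big_split_ord /= [RHS]addrC; congr (_ + _).
  by apply: eq_bigr => s _; rewrite /theta leq_addr addKn.
rewrite [RHS](reindex_inj rev_ord_inj) /=; apply: eq_bigr => s _.
have sM := ltn_ord s; rewrite /theta.
have -> : (M <= M - s.+1)%N = false by lia.
by have -> : (M - (M - s.+1) = s.+1)%N by lia.
Qed.

End FiniteJTP.

Lemma eqX_sum_ord n L (f g : nat -> {poly int}) : (n <= L)%N ->
  (forall j, (j < n)%N -> eqX n (f j) (g j)) ->
  (forall j, (n <= j)%N -> eqX n (f j) 0) ->
  eqX n (\sum_(j < L) f j) (\sum_(j < n) g j).
Proof.
move=> nL fg f0; rewrite -(subnKC nL) big_split_ord /= -[X in eqX _ _ X]addr0.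
apply: eqXD; first by apply: eqX_sum => j _; apply: fg.
rewrite [X in eqX _ _ X](_ : 0 = \sum_(j < L - n) 0); last by rewrite big1.
by apply: eqX_sum => j _; apply: f0; rewrite leq_addr.
Qed.

(** * The limit modulo X^n *)

Section Limit.
Local Notation x := ('X : {poly int}).

Lemma signed_eqX_0 n e (p p' : {poly int}) : (n <= e)%N -> eqX n (p * x ^+ e * p') 0.
Proof. by move=> ne; rewrite mulrAC; apply: eqX_0. Qed.

Lemma central_qbin_stab n N j : (j < n)%N -> (n + n <= N)%N ->
  eqX n (qpp x x n * central_qbin x N j) 1.
Proof.
move=> jn nN; rewrite /central_qbin ifT; last by lia.
by apply: (@qbin_stab _ 0); rewrite ?expr1 //; lia.
Qed.

(** The first halves of the terms are those of index j in the theta series of base Q, the second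
    halves those of index - (j + 1), written with w. *)
Lemma theta_limit m k n (Q := x ^+ (m + k + 2)) (z := x ^+ m.+1) (w := x ^+ k.+1) :
  eqX n (\sum_(j < n) (-1) ^+ j * x ^+ ('C(j, 2) + m.+1 * 'C(j.+1, 2)) *
      (x ^+ (k * 'C(j, 2)) - x ^+ (j.*2.+1 + k * 'C(j.+2, 2))))
    (qpp z Q n * qpp w Q n * qpp Q Q n).
Proof.
have zw : z * w = Q by rewrite /z /w /Q -exprD; congr (_ ^+ _); lia.
have QE : Q = x ^+ (m + k + 1).+1 by rewrite /Q addnS addn1.
(* With 2n terms on either side, all binomials of index j < n stay at distance at least n from the
   ends, as [qbin_stab] requires. *)
have J := jtp_finite zw (n + n); set S1 := (X in X + _) in J.
set S2 := (X in _ + X) in J.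
have bin2 j : 'C(j.+2, 2) = ('C(j, 2) + j.*2.+1)%N.
  by rewrite !binS !bin1 bin0; lia.
have bin1' j : 'C(j.+1, 2) = ('C(j, 2) + j)%N by rewrite !binS !bin1.
have T1 : eqX n (qpp Q Q n * S1) (\sum_(j < n) (-1) ^+ j * x ^+ ('C(j, 2)
     + m.+1 * 'C(j.+1, 2)) * x ^+ (k * 'C(j, 2))).
  rewrite mulr_sumr; apply: (@eqX_sum_ord n _ (fun j => qpp Q Q n *
    ((- z) ^+ j * Q ^+ 'C(j, 2) * qbin Q (n + n + (n + n)) (n + n + j)))
    (fun j => (-1) ^+ j * x ^+ ('C(j, 2) + m.+1 * 'C(j.+1, 2)) * x ^+ (k * 'C(j, 2)))); first by lia.
    move=> j jn; rewrite mulrCA -[X in eqX _ _ X]mulr1; apply: eqXM.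
      have -> : (- z) ^+ j * Q ^+ 'C(j, 2) =
        (-1) ^+ j * x ^+ ('C(j, 2) + m.+1 * 'C(j.+1, 2)) * x ^+ (k * 'C(j, 2)); last exact: eqX_refl.
      match goal with |- (- ?u) ^+ _ * _ = _ => rewrite -[- u]mulN1r end; rewrite exprMn -!mulrA; congr (_ * _).
      by rewrite /z /Q -!exprM -!exprD; congr (_ ^+ _); rewrite bin1'; nia.
    by apply: (@qbin_stab _ (m + k + 1)) => //; lia.
  move=> j nj; rewrite mulrCA -mulN1r exprMn /z -exprM -!mulrA mulrCA.
  rewrite [X in eqX _ X](_ : _ = (-1) ^+ j * x ^+ (m.+1 * j) *
     (Q ^+ 'C(j, 2) * (qpp Q Q n * qbin Q (n + n + (n + n)) (n + n + j)))); last by ring.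
  by apply: signed_eqX_0; nia.
have T2 : eqX n (qpp Q Q n * S2) (\sum_(j < n) (-1) ^+ j.+1 * x ^+ ('C(j, 2)
     + m.+1 * 'C(j.+1, 2)) * x ^+ (j.*2.+1 + k * 'C(j.+2, 2))).
  rewrite mulr_sumr; apply: (@eqX_sum_ord n _ (fun j => qpp Q Q n *
    ((- w) ^+ j.+1 * Q ^+ 'C(j.+1, 2) * qbin Q (n + n + (n + n)) (n + n - j.+1)))
    (fun j => (-1) ^+ j.+1 * x ^+ ('C(j, 2) + m.+1 * 'C(j.+1, 2)) *
       x ^+ (j.*2.+1 + k * 'C(j.+2, 2)))); first by lia.
    move=> j jn; rewrite mulrCA -[X in eqX _ _ X]mulr1; apply: eqXM.
      have -> : (- w) ^+ j.+1 * Q ^+ 'C(j.+1, 2) =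
        (-1) ^+ j.+1 * x ^+ ('C(j, 2) + m.+1 * 'C(j.+1, 2)) *
         x ^+ (j.*2.+1 + k * 'C(j.+2, 2)); last exact: eqX_refl.
      match goal with |- (- ?u) ^+ _ * _ = _ => rewrite -[- u]mulN1r end; rewrite exprMn -!mulrA; congr (_ * _).
      by rewrite /w /Q -!exprM -!exprD; congr (_ ^+ _); rewrite bin2 bin1'; nia.
    by apply: (@qbin_stab _ (m + k + 1)) => //; lia.
  move=> j nj; rewrite mulrCA -mulN1r exprMn /w -exprM.
  rewrite [X in eqX _ X](_ : _ = (-1) ^+ j.+1 * x ^+ (k.+1 * j.+1) *
     (Q ^+ 'C(j.+1, 2) * (qpp Q Q n * qbin Q (n + n + (n + n)) (n + n - j.+1)))); last by ring.
  by apply: signed_eqX_0; nia.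
apply: eqX_sym; apply: (@eqX_trans _ _ (qpp Q Q n * (S1 + S2))).
  rewrite J mulrC; apply: eqXMl; apply: eqXM; apply: eqX_sym;
  by apply: (@qpp_stab _ (m + k + 1)); rewrite // leq_addr.
rewrite mulrDr; apply: eqX_trans (eqXD T1 T2) _.
rewrite -big_split /=.
rewrite [X in eqX _ X](eq_bigr (fun j : 'I_n => (-1) ^+ j * x ^+ ('C(j, 2) + m.+1 * 'C(j.+1, 2)) *
      (x ^+ (k * 'C(j, 2)) - x ^+ (j.*2.+1 + k * 'C(j.+2, 2))))); first exact: eqX_refl.
by move=> j _; rewrite exprS; ring.
Qed.

Lemma tuples_gf_limit m k n (N := (n + n).+2)
    (Q := x ^+ (m + k + 2)) (z := x ^+ m.+1) (w := x ^+ k.+1) :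
  eqX n (qpp x x n * tuples_gf x m (m + k) (N + (k == 0%N)))
    (qpp (- x) x n * (qpp z Q n * qpp w Q n * qpp Q Q n)).
Proof.
set G := tuples_gf _ _ _ _; set a := qpp x x n.
have a0 : a`_0 = 1 by apply: qpp_coef0; rewrite coefX.
have St u L : (n <= L)%N -> eqX n (qpp u x L) (qpp u x n).
  by apply: (@qpp_stab _ 0); rewrite expr1.
apply: (eqX_cancel a0).
apply: (@eqX_trans _ _ (a * (qpp x x (N + N).+1 * G))).
  by apply: eqXMl; apply: eqXM (eqX_refl _ _); apply: eqX_sym; apply: St; lia.
rewrite tuples_gf_finite.
apply: (@eqX_trans _ _ (a * qpp (- x) x n * (a * \sum_(j < N.+2) chain_poly m k N j))).
  rewrite [X in eqX _ _ X](_ : _ = a * (a * qpp (- x) x n * \sum_(j < N.+2) chain_poly m k N j));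
   last by ring.
  apply: eqXMl; apply: eqXM (eqX_refl _ _); apply: eqXM; apply: St; lia.
(* The factor (q)_n kept next to the sum turns every central binomial into 1, which leaves the theta
   series. *)
rewrite -mulrA; do 2!apply: eqXMl; apply: eqX_trans (theta_limit m k n).
rewrite mulr_sumr.
apply: (@eqX_sum_ord n _ (fun j => a * chain_poly m k N j) (fun j => (-1) ^+ j * x ^+ ('C(j, 2) + m.+1 * 'C(j.+1, 2)) *
      (x ^+ (k * 'C(j, 2)) - x ^+ (j.*2.+1 + k * 'C(j.+2, 2))))); first by lia.
  move=> j jn; rewrite mulrCA; apply: eqXMl.
  rewrite mulrBr; apply: eqXD.
    rewrite mulrCA -[X in eqX _ _ X]mulr1; apply: eqXMl.
    by apply: central_qbin_stab; lia.
  rewrite -mulN1r -[X in eqX _ _ X]mulN1r; apply: eqXMl.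
  rewrite mulrCA -[X in eqX _ _ X]mulr1; apply: eqXMl.
  rewrite /central_qbin ifT; last by lia.
  by apply: (@qbin_stab _ 0); rewrite ?expr1 //; lia.
move=> j nj; rewrite mulrCA; apply: signed_eqX_0.
by rewrite (binS j) bin1; nia.
Qed.

End Limit.

(** * Tuples of strict partitions *)

Local Open Scope nat_scope.

Fixpoint strict_seqs (N : nat) : seq (seq nat) :=
  if N is N'.+1 then strict_seqs N' ++ [seq N :: s | s <- strict_seqs N'] else [:: [::]].

Definition strictp (s : seq nat) := sorted gtn s && (0 \notin s).

Lemma mem_strict_seqs N s : (s \in strict_seqs N) = strictp s && (head 0 s <= N).
Proof.
rewrite /strictp; elim: N s => [|N IH] s /=.
  by case: s => [|[|a] s] //=; rewrite ?inE ?andbF.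
rewrite mem_cat IH; case: s => [|a s] //=.
have -> : (a :: s \in [seq N.+1 :: s0 | s0 <- strict_seqs N]) = (a == N.+1) && (s \in strict_seqs N).
  apply/mapP/andP => [[s' s'N [-> ->]]|[/eqP -> sN]] //; by exists s.
rewrite IH !inE.
have E : (a == N.+1) -> path gtn a s = sorted gtn s && (head 0 s <= N).
  by move=> /eqP ->; case: s {IH} => //= b s; rewrite /gtn /= ltnS andbC.
case: eqVneq E => [->|aN] E; last by rewrite orbF; congr (_ && _); lia.
rewrite (E isT) leqnn; case: (0 \in s) => /=; rewrite ?orbT ?orbF ?andbT ?andbF //=.
by rewrite ltnn andbF.
Qed.

Lemma strict_seqs_uniq N : uniq (strict_seqs N).
Proof.
elim: N => //= N IH; rewrite cat_uniq IH map_inj_uniq => [|? ? []//].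
rewrite IH andbT; apply/hasPn => _ /mapP[s sN ->].
by rewrite mem_strict_seqs /= ltnn andbF.
Qed.

(** Removing the staircase s, ..., 1 from a strict partition with s parts leaves a partition in an s
    by N - s box, whence q^(s(s+1)/2) [N, s]. The induction separates the partitions by whether the
    largest allowed part occurs, which is the rule [qbinS]. *)
Lemma strict_seqs_sum (R : comNzRingType) (q : R) N (f : nat -> R) :
  (\sum_(s <- strict_seqs N) q ^+ sumn s * f (size s) =
   \sum_(s < N.+1) q ^+ 'C(s.+1, 2) * qbin q N s * f s)%R.
Proof.
elim: N f => [|N IH] f; first by rewrite big_ord1 big_seq1 qbinn0 !expr0 !mul1r.
rewrite [strict_seqs _]/= big_cat big_map [X in X = _]/= IH.
rewrite [X in (_ + X)%R](eq_bigr (fun s => q ^+ N.+1 * (q ^+ sumn s * f (size s).+1))%R); last first.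
  by move=> s _; rewrite /= exprD mulrA.
rewrite -mulr_sumr (IH (fun s => f s.+1)) mulr_sumr [in RHS]big_ord_recl.
rewrite [X in (_ = _ + X)%R](eq_bigr (fun s : 'I_N.+1 =>
  q ^+ 'C(s.+2, 2) * qbin q N s.+1 * f s.+1 +
  q ^+ N.+1 * (q ^+ 'C(s.+1, 2) * qbin q N s * f s.+1))%R); last first.
  move=> s _; rewrite lift0 qbinS (binS s.+1) bin1 exprD.
  have -> : (q ^+ N.+1 = q ^+ s.+1 * q ^+ (N - s))%R.
    by rewrite -exprD; congr (_ ^+ _)%R; have := ltn_ord s; lia.
  by ring.
rewrite big_split /= addrA; congr (_ + _)%R.
rewrite [in LHS]big_ord_recl [in RHS]big_ord_recr /=.
by rewrite (@qbin_small _ q N N.+1) // mulr0 mul0r addr0 !qbinn0.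
Qed.

(* The partitions are listed from label k - 1 down to label 0. *)
Fixpoint strict_tuples (m k N : nat) : seq (seq (seq nat)) :=
  if k is k'.+1 then
    [seq s :: L | s <- strict_seqs N, L <- strict_tuples m k' (size s + (k' == m))]
  else [:: [::]].

Definition total_size (L : seq (seq nat)) := sumn (map sumn L).

Lemma strict_tuples_gf (R : comNzRingType) (q : R) m k N :
  (\sum_(L <- strict_tuples m k N) q ^+ total_size L = tuples_gf q m k N)%R.
Proof.
elim: k N => [|k IH] N; first by rewrite big_seq1.
rewrite [tuples_gf _ _ _ _]/= -(strict_seqs_sum q N (fun s => tuples_gf q m k (s + (k == m)))) [strict_tuples _ _ _]/=.
rewrite big_allpairs_dep; apply: eq_bigr => s _; rewrite -IH mulr_sumr.
by apply: eq_bigr => L _; rewrite -exprD.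
Qed.

Lemma strict_tuples_uniq m k N : uniq (strict_tuples m k N).
Proof.
elim: k N => //= k IH N; apply: allpairs_uniq_dep => [||[s L] [s' L']].
- exact: strict_seqs_uniq.
- by move=> s _; apply: IH.
by move=> _ _ [-> ->].
Qed.

Fixpoint lamlist (lam : nat -> seq nat) k :=
  if k is k'.+1 then lam k' :: lamlist lam k' else [::].

Lemma mem_strict_tuples m k N lam : reflect
  [/\ forall l, l < k -> strictp (lam l),
      (0 < k -> head 0 (lam k.-1) <= N)
    & forall l, l.+1 < k -> head 0 (lam l) <= size (lam l.+1) + (l.+1 == m)]
  (lamlist lam k \in strict_tuples m k N).
Proof.
elim: k N => [|k IH] N; first by rewrite mem_seq1; apply: ReflectT.
apply: (iffP allpairsPdep) => [[s [L [sN LN [Es EL]]]]|[H1 H2 H3]].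
  move: sN LN; rewrite -{}Es -{}EL; rewrite mem_strict_seqs => /andP[sp sN] /IH[H1 H2 H3].
  split=> //= [l|l]; first by rewrite ltnS leq_eqVlt => /predU1P[->|/H1].
  rewrite ltnS leq_eqVlt => /predU1P[lk|/H3//]; subst k.
  exact: H2.
exists (lam k), (lamlist lam k); split=> //.
  by rewrite mem_strict_seqs H1 //=; apply: (H2 isT).
apply/IH; split=> [l lk|k0|l lk]; [exact/H1/ltnW| |exact/H3/ltnW].
by have := H3 k.-1; rewrite prednK //; apply.
Qed.

(** The lists start at the highest label, so [rev] makes the position equal to the label. *)
Lemma strict_tuplesE m k N L : L \in strict_tuples m k N -> lamlist (nth [::] (rev L)) k = L.
Proof.
elim: k N L => [|k IH] N L; first by rewrite mem_seq1 => /eqP ->.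
case/allpairsPdep => s [L' [_ L'N ->]].
have E := IH _ _ L'N.
have sz : size L' = k by rewrite -{1}E; elim: (k) => //= ? ->.
rewrite rev_cons /= nth_rcons size_rev sz ltnn eqxx; congr (_ :: _).
rewrite -[RHS]E; have: (k <= size L')%N by rewrite sz.
elim: (k) => //= i IHi iL.
by rewrite IHi 1?ltnW // nth_rcons size_rev iL.
Qed.

Lemma total_size_lamlist lam k : total_size (lamlist lam k) = \sum_(l < k) sumn (lam l).
Proof.
elim: k => [|k IH]; first by rewrite big_ord0.
by rewrite big_ord_recr /= /total_size /= -/(total_size _) IH addnC.
Qed.

Lemma lamlist_inj lam lam' k : lamlist lam k = lamlist lam' k ->
  forall l, l < k -> lam l = lam' l.
Proof.
elim: k => //= k IH [E1 E2] l; rewrite ltnS leq_eqVlt => /predU1P[->//|].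
exact: IH.
Qed.

Local Open Scope ring_scope.

Lemma coef_sum_Xn (I : Type) (s : seq I) (f : I -> nat) n :
  (\sum_(i <- s) 'X^(f i) : {poly int})`_n = (count (fun i => f i == n) s)%:Z.
Proof.
elim: s => [|i s IH]; first by rewrite big_nil coef0.
rewrite big_cons coefD IH coefXn /= PoszD eq_sym.
by case: eqP.
Qed.

(** * From the infinite product to the number of tuples *)

Section Fps.
Local Notation x := ('X : {poly int}).

Definition trunc n (f : fps) : {poly int} := \poly_(i < n) f i.

Lemma coef_trunc n f i : (i < n)%N -> (trunc n f)`_i = f i.
Proof. by move=> ni; rewrite coef_poly ni. Qed.

Lemma trunc_mul n f g : eqX n (trunc n (fps_mul f g)) (trunc n f * trunc n g).
Proof.
apply: eqX_coefP => i ni; rewrite coef_trunc // coefM; apply: eq_bigr => k _.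
have ki := leq_ord k; rewrite !coef_trunc //; lia.
Qed.

Lemma trunc_qpoch n e (a b : {poly int}) : b = x ^+ e.+1 ->
  eqX n (trunc n (qpoch a b)) (qpp a b n).
Proof.
move=> be; apply: eqX_coefP => i ni; rewrite coef_trunc //.
by rewrite -(@qpoch_stable a b i n) // be coefXn.
Qed.

Lemma trunc_fps1 n : eqX n (trunc n fps1) 1.
Proof. by apply: eqX_coefP => -[|i] ni; rewrite coef_trunc // coef1. Qed.

(** The cap is that of [tuples_gf_limit] at precision n + 1, with the offset of the chain when m =
    r; it exceeds every part of a tuple of total size n. *)
Lemma count_coef (r m n : nat) : (m <= r)%N ->
  fps_mul (fps_mul (qpoch (- 'X) 'X) (fps_inv (qpoch 'X 'X)))
      (qpochs [:: 'X^(m + 1); 'X^(r - m + 1); 'X^(r + 2)] 'X^(r + 2)) n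
  = (count (fun L => total_size L == n)
      (strict_tuples m r ((n.+1 + n.+1).+2 + (r - m == 0)%N)))%:Z.
Proof.
move=> mr; rewrite -coef_sum_Xn (strict_tuples_gf x).
pose n1 := n.+1; have := tuples_gf_limit m (r - m) n1; rewrite subnKC // -/n1.
set Q := x ^+ _; set z := x ^+ _; set w := x ^+ _; set G := tuples_gf _ _ _ _ => H.
set T := fps_mul _ _; rewrite -(@coef_trunc n1) //.
apply: (@eqX_coef n1) => //.
have a0 : (qpp x x n1)`_0 = 1 by apply: qpp_coef0; rewrite coefX.
apply: (eqX_cancel a0); apply: eqX_trans (eqX_sym H).
have xE : x = x ^+ 1 by rewrite expr1.
have QE : Q = x ^+ (r + 1).+1 by rewrite /Q addnS.
pose t := trunc n1; pose I := fps_inv (qpoch 'X 'X).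
have inv : eqX n1 (qpp x x n1 * t I) 1.
  apply: eqX_trans (trunc_fps1 n1).
  rewrite -(@fps_mulV (qpoch 'X 'X)); last first.
    by rewrite -(@qpoch_stable x x 0 1) ?coefX // /qpoch_part big_ord1 expr0 mulr1
      coefB coef1 coefX subr0 unitr1.
  rewrite mulrC; apply: eqX_trans (eqX_sym (trunc_mul _ _ _)); apply: eqXMl.
  exact/eqX_sym/(trunc_qpoch _ _ xE).
apply: eqX_trans (eqXMl _ (trunc_mul _ _ _)) _; rewrite -/t.
apply: (@eqX_trans _ _ (qpp x x n1 * (qpp (- x) x n1 * t I *
   (qpp z Q n1 * (qpp w Q n1 * (qpp Q Q n1 * 1)))))).
  apply: eqXMl; apply: eqXM.
    apply: eqX_trans (trunc_mul _ _ _) _; apply: eqXM; last exact: eqX_refl.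
    exact: trunc_qpoch xE.
  rewrite /= /z /w /Q !addn1.
  do 3! (apply: eqX_trans (trunc_mul _ _ _) _; apply: eqXM;
    first exact: (trunc_qpoch _ _ QE)).
  exact: trunc_fps1.
rewrite [X in eqX _ X](_ : _ = (qpp x x n1 * t I) * (qpp (- x) x n1 *
   (qpp z Q n1 * qpp w Q n1 * qpp Q Q n1))); last by ring.
by rewrite -[X in eqX _ _ X]mul1r; apply: eqXM inv (eqX_refl _ _).
Qed.

End Fps.

(** * Monomial points of the quiver variety *)

Local Open Scope classical_set_scope.
Local Open Scope quotient_scope.
Local Open Scope ring_scope.

Section Monomials.
Variable r : nat.

(* (l, a, b) stands for x^a y^b e_l. *)
Definition mono : Type := ('I_r * nat * nat)%type.
HB.instance Definition _ := Choice.on mono.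
Implicit Type m : mono.
Definition lab m : 'I_r := m.1.1.
Definition xdeg m : nat := m.1.2.
Definition ydeg m : nat := m.2.
Definition mulx m : mono := (lab m, (xdeg m).+1, ydeg m).
Definition muly m : mono := (lab m, xdeg m, (ydeg m).+1).
Definition gen l : mono := (l, 0%N, 0%N).

Definition div_closed (I : Type) (D : I -> mono) := forall p m,
  D p = mulx m \/ D p = muly m -> exists q, D q = m.

End Monomials.

Lemma mulmx_sum_col (K : comNzRingType) a b (A : 'M[K]_(a, b)) (v : 'cV_b) :
  A *m v = \sum_p v p 0 *: col p A.
Proof.
apply/colP => i; rewrite !mxE summxE; apply: eq_bigr => p _.
by rewrite !mxE mulrC.
Qed.

Section Quiver.
Variables (K : numClosedFieldType) (r n : nat).
Implicit Types (x : quiver_data K r n) (m : mono r) (D : 'I_n -> mono r).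

(** For commuting B1 and B2, the image of the monomial m under the module map from C[x, y]^r to C^n
    given by i. *)
Definition uvec x m : 'cV[K]_n :=
  iter (xdeg m) (mulmx (qB1 x)) (iter (ydeg m) (mulmx (qB2 x)) (col (lab m) (qi x))).

Lemma uvec_mulx x m : uvec x (mulx m) = qB1 x *m uvec x m.
Proof. by []. Qed.

Definition qcomm x := qB1 x *m qB2 x = qB2 x *m qB1 x.

Lemma uvec_muly x m : qcomm x -> uvec x (muly m) = qB2 x *m uvec x m.
Proof.
move=> xC; case: m => -[l a] b; rewrite /uvec /xdeg /ydeg /=.
by elim: a => //= a ->; rewrite !mulmxA xC.
Qed.

Lemma uvec_gl g x m : g \in unitmx -> uvec (gl_act g x) m = g *m uvec x m.
Proof.
move=> gU; have H B a v : iter a (mulmx (g *m B *m invmx g)) (g *m v) =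
    g *m iter a (mulmx B) v :> 'cV_n.
  by elim: a => //= a ->; rewrite !mulmxA mulmxKV.
by rewrite /uvec /gl_act /qB1 /qB2 /qi /= -(H _ (xdeg m)) -(H _ (ydeg m)) !colE mulmxA.
Qed.

Definition bmx x D : 'M[K]_n := \matrix_(i, p) uvec x (D p) i 0.

Lemma col_bmx x D p : col p (bmx x D) = uvec x (D p).
Proof. by apply/colP => i; rewrite !mxE. Qed.

Lemma bmx_gl g x D : g \in unitmx -> bmx (gl_act g x) D = g *m bmx x D.
Proof.
move=> gU; apply/matrixP => i p; rewrite mxE uvec_gl // !mxE.
by apply: eq_bigr => k _; rewrite !mxE.
Qed.

(** A subspace closed under B1 and B2 that contains the image of i contains every [uvec], and the
    columns of an invertible [bmx] span. *)
Lemma bmx_stable x D : qcomm x -> bmx x D \in unitmx -> stable x.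
Proof.
move=> xC U [S [SnT S1 S2 Si]]; move/negP: SnT; apply; rewrite eqEsubv subvf.
have uS m : uvec x m \in S.
  rewrite /uvec; elim: (xdeg m) => [|a IH] /=; last exact: S1.
  elim: (ydeg m) => [|b IH] /=; last exact: S2.
  by rewrite colE; apply: Si.
apply/subvP => v _; rewrite -[v](mulKVmx U) mulmx_sum_col.
by apply: rpred_sum => p _; apply: rpredZ; rewrite col_bmx.
Qed.

(* The quotient with basis the monomials D_p, in which all others vanish. *)
Definition pt D : quiver_data K r n :=
  (\matrix_(p, q) (D p == mulx (D q))%:R, \matrix_(p, q) (D p == muly (D q))%:R,
   \matrix_(p, l) (D p == gen l)%:R, 0).

Lemma pt_mul D (f : mono r -> mono r) m : injective D -> injective f ->
   (forall p, D p = f m -> exists q, D q = m) ->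
   \matrix_(p, q) (D p == f (D q))%:R *m \col_p (D p == m)%:R =
   \col_p (D p == f m)%:R :> 'cV[K]_n.
Proof.
move=> Dinj finj Dm; apply/colP => p; rewrite !mxE.
have [Dp|Dp] := eqVneq (D p) (f m).
  have [q Dq] := Dm p Dp; rewrite (bigD1 q) //= !mxE Dq Dp !eqxx mulr1.
  rewrite big1 ?addr0 // => k kq; rewrite !mxE -Dq (inj_eq Dinj).
  by rewrite (negPf kq) mulr0.
rewrite big1 // => q _; rewrite !mxE; case: (eqVneq (D q) m) => [->|].
  by rewrite (negPf Dp) mul0r.
by rewrite mulr0.
Qed.

Lemma mulx_inj : injective (@mulx r).
Proof.
move=> [[l a] b] [[l' a'] b']; rewrite /mulx /lab /xdeg /ydeg /=.
by case=> -> -> ->.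
Qed.

Lemma muly_inj : injective (@muly r).
Proof.
move=> [[l a] b] [[l' a'] b']; rewrite /muly /lab /xdeg /ydeg /=.
by case=> -> -> ->.
Qed.

Lemma pt_mulx D m : injective D -> div_closed D ->
  qB1 (pt D) *m \col_p (D p == m)%:R = \col_p (D p == mulx m)%:R :> 'cV[K]_n.
Proof.
move=> Dinj Dcl; apply: pt_mul (@mulx_inj) _ => // p Dp.
by apply: (Dcl p); left.
Qed.

Lemma pt_muly D m : injective D -> div_closed D ->
  qB2 (pt D) *m \col_p (D p == m)%:R = \col_p (D p == muly m)%:R :> 'cV[K]_n.
Proof.
move=> Dinj Dcl; apply: pt_mul (@muly_inj) _ => // p Dp.
by apply: (Dcl p); right.
Qed.

Lemma uvec_pt D m : injective D -> div_closed D ->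
  uvec (pt D) m = \col_p (D p == m)%:R.
Proof.
move=> Dinj Dcl; case: m => -[l a] b; rewrite /uvec /xdeg /ydeg /=.
elim: a => [|a /= ->]; last by rewrite pt_mulx.
elim: b => [|b /= ->]; last by rewrite pt_muly.
by apply/colP => p; rewrite !mxE.
Qed.

Lemma bmx_pt D : injective D -> div_closed D -> bmx (pt D) D = 1%:M.
Proof.
move=> Dinj Dcl; apply/matrixP => i p; rewrite !mxE uvec_pt // mxE.
by rewrite (inj_eq Dinj).
Qed.

Lemma pt_comm D : injective D -> div_closed D -> qcomm (pt D).
Proof.
move=> Dinj Dcl.
have E A : A = \matrix_(p, q) (A *m \col_p (D p == D q)%:R) p 0 :> 'M[K]_n.
  apply/matrixP => p q; rewrite !mxE (bigD1 q) //= mxE eqxx mulr1.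
  rewrite big1 ?addr0 // => k kq; rewrite mxE (inj_eq Dinj) (negPf kq) mulr0 //.
rewrite /qcomm [LHS]E [RHS]E; apply/matrixP => p q.
by rewrite mxE [RHS]mxE -!mulmxA !(pt_mulx, pt_muly).
Qed.

Lemma pt_stable D : injective D -> div_closed D -> stable_locus K r n (pt D).
Proof.
move=> Dinj Dcl; split.
  by rewrite /adhm_eq [qj _]/(0 : 'M[K]_(r, n)) mulmx0 addr0 pt_comm // subrr.
apply: (@bmx_stable _ D); first exact: pt_comm.
by rewrite bmx_pt // unitmx1.
Qed.

End Quiver.

(** * Points fixed by the torus *)

Section Fixed.
Variables (K : numClosedFieldType) (r n wm : nat).
Implicit Types (x : quiver_data K r n) (m : mono r) (D : 'I_n -> mono r).

Notation w := (@weight r wm).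

Definition wdiag (t : K) (s : int) : 'M[K]_r := diag_mx (\row_l t ^ (s * w l)).

(** The lift g of t to C^n: the equality of t.x and g.x, cleared of the inverses of g. *)
Definition torus_eigen (t : K) x (g : 'M[K]_n) : Prop :=
  [/\ g *m qB1 x = t *: (qB1 x *m g), g *m qB2 x = t *: (qB2 x *m g),
      g *m qi x = qi x *m wdiag t (-1)
    & qj x = t ^+ 2 *: (wdiag t 1 *m qj x *m g)].

Lemma wdiagV t : t != 0 -> invmx (wdiag t 1) = wdiag t (-1).
Proof.
move=> t0; have E : wdiag t 1 *m wdiag t (-1) = 1%:M.
  rewrite /wdiag mulmx_diag; apply/matrixP => i j; rewrite !mxE.
  by case: eqP => // _; rewrite -expfzDr // mul1r mulN1r subrr expr0z.
have /mulmx1_unit[U _] := E.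
by rewrite -[LHS]mulmx1 -E mulmxA mulVmx // mul1mx.
Qed.

Lemma subtorus_torus (t : K) : t != 0 ->
  exists2 tau : torus K r, subtorus 1 1 w tau
    & [/\ tor1 tau = t, tor2 tau = t & diag_mx (tore tau) = wdiag t 1].
Proof.
move=> t0; have H : [&& t != 0, t != 0 & [forall k, (\row_l t ^ w l : 'rV[K]_r) 0 k != 0]].
  by rewrite t0 /=; apply/forallP => k; rewrite mxE expfz_neq0.
exists (Torus H).
  exists t => //; split; rewrite ?expr1 //= => k; by rewrite mxE.
split=> //=; congr diag_mx; apply/rowP => k; by rewrite !mxE mul1r.
Qed.

Lemma subtorus_inv (tau : torus K r) : subtorus 1 1 w tau ->
  exists2 t, t != 0
    & [/\ tor1 tau = t, tor2 tau = t & diag_mx (tore tau) = wdiag t 1].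
Proof.
case=> t t0 [E1 E2 E3]; exists t => //; split; rewrite ?E1 ?E2 ?expr1 //.
by congr diag_mx; apply/rowP => k; rewrite E3 mxE mul1r.
Qed.

Lemma torus_eigenP t x g (tau : torus K r) : t != 0 -> g \in unitmx ->
  [/\ tor1 tau = t, tor2 tau = t & diag_mx (tore tau) = wdiag t 1] ->
  quiver_torus_act tau x = gl_act g x <-> torus_eigen t x g.
Proof.
move=> t0 gU [t1 t2 t3]; rewrite /quiver_torus_act /gl_act t1 t2 t3 wdiagV //.
have C (A : 'M[K]_n) : t *: A = g *m A *m invmx g <-> g *m A = t *: (A *m g).
  split=> [E|E]; first by rewrite scalemxAl E mulmxKV.
  by rewrite E -scalemxAl mulmxK.
split=> [[/C E1 /C E2 E3 E4]|[E1 E2 E3 E4]].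
  by split=> //; rewrite expr2 scalemxAl E4 mulmxKV.
congr (_, _, _, _); rewrite ?E3 //; [exact/C|exact/C|].
by rewrite [in RHS]E4 -scalemxAl mulmxK // expr2.
Qed.

Lemma fixedP (x : stable_locus K r n) :
  fixed_locus (subtorus 1 1 w) (\pi_(moduli K r n) x) <->
  forall t, t != 0 -> exists2 g, g \in unitmx & torus_eigen t (set_val x) g.
Proof.
split=> [fx t t0|H tau /subtorus_inv[t t0 tE]].
  have [tau Htau tE] := subtorus_torus t0.
  have := fx tau Htau; rewrite torus_act_pi => /esym/eqmodP/asboolP[g gU E].
  by exists g => //; apply/(torus_eigenP _ t0 gU tE).
have [g gU /(torus_eigenP _ t0 gU tE) E] := H t t0.
by rewrite torus_act_pi; apply/esym/eqmodP/asboolP; exists g.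
Qed.

(** The exponent of the eigenvalue of the lift on [uvec x m]; the weight enters negatively because
    the torus multiplies i by the inverse of e. *)
Definition dg m : int := (xdeg m + ydeg m)%:Z - w (lab m).

Lemma dg_mulx m : dg (mulx m) = dg m + 1.
Proof. by rewrite /dg /mulx /lab /xdeg /ydeg /= addSn -addn1 PoszD addrAC. Qed.

Lemma dg_muly m : dg (muly m) = dg m + 1.
Proof. by rewrite /dg /muly /lab /xdeg /ydeg /= addnS -addn1 PoszD addrAC. Qed.

Lemma torus_eigen_uvec t x g m : t != 0 -> torus_eigen t x g -> g *m uvec x m = t ^ dg m *: uvec x m.
Proof.
move=> t0 [h1 h2 h3 _]; case: m => -[l a] b; elim: a => [|a IH]; last first.
  rewrite -[(l, a.+1, b)]/(mulx (l, a, b)) uvec_mulx mulmxA h1 -scalemxAl.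
  by rewrite -mulmxA IH -scalemxAr scalerA dg_mulx (@expfzDr _ t (dg _) 1 t0) mulrC.
elim: b => [|b IH].
  have -> : uvec x (l, 0%N, 0%N) = col l (qi x) by [].
  have -> : dg (l, 0%N, 0%N) = -1 * w l by rewrite /dg /lab /xdeg /ydeg /= mulN1r add0r.
  rewrite !colE mulmxA h3 -mulmxA scalemxAr; congr (_ *m _).
  apply/colP => k; rewrite /wdiag mul_diag_mx !mxE eqxx andbT.
  by case: eqP => [->|_]; rewrite ?mulr0.

rewrite /uvec /= mulmxA h2 -scalemxAl -mulmxA.
rewrite -[iter b _ _]/(uvec x (l, 0%N, b)) IH -scalemxAr scalerA.
by rewrite -[(l, 0%N, b.+1)]/(muly (l, 0%N, b)) dg_muly (@expfzDr _ t (dg _) 1 t0) mulrC.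
Qed.

Lemma exp2z_inj : injective (exprz (2%:R : K)).
Proof.
have two0 : (2 : K) != 0 by rewrite pnatr_eq0.
have e1 (k : nat) : (2 : K) ^+ k.+1 != 1 by rewrite pexpr_eq1 // pnatr_eq1.
have H z : (2 : K) ^ z = 1 -> z = 0.
  case: z => [[|k]|k] //= /eqP; first by rewrite (negPf (e1 k)).
  by rewrite NegzE -invr_expz -exprnP invr_eq1 (negPf (e1 k)).
move=> i j E; apply/eqP; rewrite -subr_eq0; apply/eqP/H.
by rewrite expfzDr // -invr_expz -E mulfV // expfz_neq0.
Qed.

(* Fewer than n + 1 powers of 2 are eigenvalues, so a chain of left
   eigenvectors whose eigenvalues double at each step meets 0. *)
Lemma eigen_chain (g : 'M[K]_n) (c : int) (s : int) (v : nat -> 'rV[K]_n) : s != 0 ->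
  (forall k, v k *m g = 2%:R ^ (c + s * k%:Z) *: v k) ->
  exists2 k, (k <= n)%N & v k = 0.
Proof.
move=> s0 vE; apply: contrapT => nv.
pose rs := [seq 2%:R ^ (c + s * k%:Z) : K | k <- iota 0 n.+1].
have: (size rs < size (char_poly g))%N.
  apply: max_poly_roots; first by rewrite -size_poly_eq0 size_char_poly.
    apply/allP => _ /mapP[k + ->]; rewrite mem_iota add0n => /andP[_ kn].
    rewrite -eigenvalue_root_char; apply/eigenvalueP; exists (v k) => //.
    by apply/eqP => vk0; apply: nv; exists k.
  rewrite map_inj_uniq ?iota_uniq // => i j E.
  by have /addrI/(mulfI s0)[] := exp2z_inj E.
by rewrite size_char_poly size_map size_iota ltnn.
Qed.

End Fixed.

Lemma span_ind (K : fieldType) (V : vectType K) (s : seq V) (P : V -> Prop) :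
  P 0 -> (forall a u v, P u -> P v -> P (a *: u + v)) ->
  {in s, forall u, P u} -> forall v, v \in << s >>%VS -> P v.
Proof.
move=> P0 PD Ps v /(@coord_span _ _ _ (in_tuple s)) ->.
apply: (big_ind P) => // [u u' Pu Pu'|i _]; first by rewrite -[u]scale1r; apply: PD.
rewrite -[_ *: _]addr0; apply: PD => //; apply: Ps.
by apply: mem_nth; case: i.
Qed.

Section FixedPoints.
Variables (K : numClosedFieldType) (r n wm : nat).
Implicit Types (x : quiver_data K r n) (m : mono r) (D : 'I_n -> mono r).

(* For degree reasons the eigenspace annihilates the image of i; if it also
   annihilated those of B1 and B2, its kernel would destabilise x. *)
Lemma left_eigen_chain x g (k : int) (v : 'rV[K]_n) : stable x -> torus_eigen wm 2%:R x g ->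
  k <= -2 -> v != 0 -> v *m g = 2%:R ^ k *: v ->
  exists2 v' : 'rV[K]_n, v' != 0 & v' *m g = 2%:R ^ (k - 1) *: v'.
Proof.
move=> xst [h1 h2 h3 _] k2 v0 vk; apply: contrapT => nex.
have two0 : (2 : K) != 0 by rewrite pnatr_eq0.
pose E := kermx (g - (2%:R ^ k)%:M).
have EgE : E *m g = 2%:R ^ k *: E.
  have : E *m (g - (2%:R ^ k)%:M) = 0 by apply: mulmx_ker.
  by rewrite mulmxBr mul_mx_scalar => /subr0_eq.
have EB (B : 'M[K]_n) : g *m B = 2%:R *: (B *m g) -> E *m B = 0.
  move=> gB; apply/row_matrixP => i; rewrite row0; apply/eqP/negPn/negP => ri0.
  apply: nex; exists (row i (E *m B)) => //.
  have : E *m B *m g = 2%:R ^ (k - 1) *: (E *m B).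
    rewrite -mulmxA -[B *m g](scalerK two0) -gB -scalemxAr mulmxA EgE -scalemxAl.
    by rewrite scalerA expfzDr // mulrC.
  by move=> /(congr1 (row i)); rewrite row_mul linearZ.
have Ei : E *m qi x = 0.
  have H : 2%:R ^ k *: (E *m qi x) = E *m qi x *m wdiag r wm (2%:R : K) (-1).
    by rewrite -mulmxA -h3 mulmxA EgE -scalemxAl.
  apply/matrixP => a l; move/matrixP: H => /(_ a l).
  rewrite /wdiag mul_mx_diag !mxE => H; apply/eqP/negPn/negP => X0.
  move: H; rewrite mulrC => /(mulfI X0)/exp2z_inj.
  (* The columns of i have exponent 0 or - 1, which k <= - 2 excludes. *)
  by rewrite /weight; case: ifP; lia.
apply: xst; exists (lker (linfun (mulmx E : 'cV[K]_n -> 'cV[K]_n))); split.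
- apply/eqP => full; have E0 : E = 0.
    apply/matrixP => i j; have: delta_mx j 0 \in lker (linfun (mulmx E : 'cV[K]_n -> 'cV[K]_n)).
      by rewrite full memvf.
    rewrite memv_ker lfunE /= -colE => /eqP/colP/(_ i).
    by rewrite !mxE.
  have : (v <= E)%MS by apply/sub_kermxP; rewrite mulmxBr mul_mx_scalar vk subrr.
  by rewrite E0 submx0 (negPf v0).
- by move=> u _; rewrite memv_ker lfunE /= mulmxA EB // mul0mx.
- by move=> u _; rewrite memv_ker lfunE /= mulmxA EB // mul0mx.
by move=> u; rewrite memv_ker lfunE /= mulmxA Ei mul0mx.
Qed.

Lemma torus_eigen_qj0 x g : stable x -> torus_eigen wm 2%:R x g -> qj x = 0.
Proof.
move=> xst gh; apply/row_matrixP => l; rewrite row0; apply/eqP/negPn/negP => v0.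
have two0 : (2 : K) != 0 by rewrite pnatr_eq0.
(* Row l of j satisfies row = 2^(2 + w_l) row g, so it is a left eigenvector with exponent - 2 -
   w_l, low enough for the descending chain to start. *)
pose c : int := - 2 - weight wm l.
have c2 : c <= -2 by rewrite /c /weight; case: ifP; lia.
have vc : row l (qj x) *m g = 2%:R ^ c *: row l (qj x).
  have [_ _ _ h4] := gh; have h : row l (qj x) = 2%:R ^ (- c) *: (row l (qj x) *m g).
    rewrite {1}h4 linearZ /= row_mul.
    have -> : row l (wdiag r wm 2%:R 1 *m qj x) = 2%:R ^ weight wm l *: row l (qj x).
      by apply/rowP => k; rewrite /wdiag mul_diag_mx !mxE mul1r.
    by rewrite -scalemxAl scalerA /c opprB opprK addrC expfzDr.
  by rewrite {2}h scalerA -expfzDr // subrr expr0z scale1r.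
have H k : exists v : 'rV[K]_n, v != 0 /\ v *m g = 2%:R ^ (c + (-1) * k%:Z) *: v.
  elim: k => [|k [v [vn0 vE]]]; first by exists (row l (qj x)); rewrite mulr0 addr0.
  have [|v' v'0 v'E] := left_eigen_chain xst gh _ vn0 vE; first by lia.
  exists v'; split=> //; rewrite v'E; congr (_ ^ _ *: _); lia.
have [v vP] := choice H.
have [//|k _ vk] := @eigen_chain _ _ g c (-1) v _ (fun k => (vP k).2).
by have := (vP k).1; rewrite vk eqxx.
Qed.

Lemma stable_qcomm x : adhm_eq x -> qj x = 0 -> qcomm x.
Proof. by rewrite /adhm_eq => + j0; rewrite j0 mulmx0 addr0 => /subr0_eq. Qed.

(** Multiplication by x or y doubles the eigenvalue, so one of n + 1 successive multiples vanishes,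
    and all later ones with it. Transposition turns these vectors into left eigenvectors, as
    [eigen_chain] expects. *)
Lemma uvec_out x g m : torus_eigen wm 2%:R x g -> qcomm x ->
  (n <= xdeg m)%N || (n <= ydeg m)%N -> uvec x m = 0.
Proof.
move=> gh xC; have two0 : (2 : K) != 0 by rewrite pnatr_eq0.
case: m => -[l a] b; rewrite /xdeg /ydeg /= => /orP[na|nb].
  pose v k := (uvec x (l, k, b))^T.
  have [|k|k kn] := @eigen_chain _ _ g^T (dg wm (l, 0%N, b)) 1 v => //.
    rewrite -trmx_mul (torus_eigen_uvec _ two0 gh) linearZ /=; congr (_ ^ _ *: _).
    by rewrite /dg /lab /xdeg /ydeg /=; lia.
  move=> /(congr1 trmx); rewrite trmxK trmx0 => vk.
  rewrite -(subnK (leq_trans kn na)); elim: (a - k)%N => // d IH.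
  by rewrite addSn -[(l, _, b)]/(mulx (l, (d + k)%N, b)) uvec_mulx IH mulmx0.
pose v k := (uvec x (l, a, k))^T.
have [|k|k kn] := @eigen_chain _ _ g^T (dg wm (l, a, 0%N)) 1 v => //.
  rewrite -trmx_mul (torus_eigen_uvec _ two0 gh) linearZ /=; congr (_ ^ _ *: _).
  by rewrite /dg /lab /xdeg /ydeg /=; lia.
move=> /(congr1 trmx); rewrite trmxK trmx0 => vk.
rewrite -(subnK (leq_trans kn nb)); elim: (b - k)%N => // d IH.
by rewrite addSn -[(l, a, _)]/(muly (l, a, (d + k)%N)) uvec_muly // IH mulmx0.
Qed.

End FixedPoints.

(** * Groebner bases *)

Section Greedy.
Variables (K : numClosedFieldType) (r n wm : nat).
Implicit Types (x : quiver_data K r n) (m : mono r) (D : 'I_n -> mono r).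

(** Linear in the exponents, so multiplication by x or y adds a constant. Ties are allowed: only
    reductions have to lower the weight strictly. *)
Definition mweight (wl : 'I_r -> nat) (wx wy : nat) m : nat :=
  (wl (lab m) + wx * xdeg m + wy * ydeg m)%N.

Definition reducible (wt : mono r -> nat) x D m : Prop :=
  (exists p, D p = m) \/
  exists2 c : 'cV[K]_n, uvec x m = bmx x D *m c
    & forall p, c p 0 != 0 -> (wt (D p) < wt m)%N.

(* The D_p are the standard monomials for the weight wt; the relations are only
   required on the border of D. *)
Definition groebner_basis wt x D : Prop :=
  [/\ injective D, div_closed D, bmx x D \in unitmx,
      forall q, reducible wt x D (mulx (D q)) /\ reducible wt x D (muly (D q))
    & forall l, reducible wt x D (gen l)].

(* Injective on the box of exponents below n, outside of which monomials vanish. *)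
Let greedy_weight m := mweight (fun l => l * n * n)%N n 1 m.

(** Sorted by decreasing weight: in [greedy_free] each head then lies outside the span of its
    tail. *)
Let box : seq (mono r) := sort (fun m m' => greedy_weight m' <= greedy_weight m)%N
  [seq (la, b) | la <- [seq (l, a) | l <- enum 'I_r, a <- iota 0 n], b <- iota 0 n].

Lemma mem_box m : (m \in box) = (xdeg m < n)%N && (ydeg m < n)%N.
Proof.
rewrite mem_sort; case: m => -[l a] b; rewrite /xdeg /ydeg /=.
apply/allpairsP/andP => [[[la b'] /= [/allpairsP[[l' a'] /= [_ + ->]] + [_ -> ->]]]|[an bn]].
  by rewrite !mem_iota !add0n.
exists ((l, a), b); rewrite mem_iota bn; split=> //.
by apply/allpairsP; exists (l, a); rewrite mem_enum mem_iota.
Qed.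

Lemma box_uniq : uniq box.
Proof.
rewrite sort_uniq; apply: allpairs_uniq; rewrite ?iota_uniq //.
  by apply: allpairs_uniq; rewrite ?enum_uniq ?iota_uniq // => -[? ?] [? ?].
by move=> [? ?] [? ?].
Qed.

Lemma greedy_weight_inj : {in box &, injective greedy_weight}.
Proof.
move=> [[l a] b] [[l' a'] b']; rewrite !mem_box /greedy_weight /mweight /lab /xdeg /ydeg /=.
move=> /andP[an bn] /andP[an' bn']; rewrite !mul1n => E.
have n0 : (0 < n)%N by lia.
have e1 u v y : (u * n + v = y * n + v)%N -> u = y by move=> /addIn/eqP; rewrite eqn_pmul2r // => /eqP.
have E1 : ((l * n + a) * n + b = (l' * n + a') * n + b')%N by nia.
have bb : b = b' by have := congr1 (modn^~ n) E1; rewrite !modnMDl !modn_small.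
rewrite bb in E1; have {}E1 := e1 _ _ _ E1.
have aa : a = a' by have := congr1 (modn^~ n) E1; rewrite !modnMDl !modn_small.
rewrite aa in E1; have /ord_inj -> := e1 _ _ _ E1.
by rewrite aa bb.
Qed.

Section Point.
Variables (x : quiver_data K r n) (g : 'M[K]_n).
Hypotheses (xs : stable_locus K r n x) (xg : torus_eigen wm 2%:R x g).

Let u := uvec x.
Let xC : qcomm x.
Proof. by apply: stable_qcomm xs.1 _; apply: torus_eigen_qj0 xs.2 xg. Qed.

Let lower (s : seq (mono r)) N := <<[seq u m' | m' <- s & (greedy_weight m' < N)%N] >>%VS.
Let G := [seq m <- box | u m \notin lower box (greedy_weight m)].

Lemma lowerS s N N' : (N <= N')%N -> (lower s N <= lower s N')%VS.
Proof.
move=> NN'; apply: sub_span => _ /mapP[m + ->]; rewrite mem_filter => /andP[mN ms].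
by apply: map_f; rewrite mem_filter ms (leq_trans mN).
Qed.

(** Monomials outside the box vanish, so the span is closed under B1 and B2; it contains the image
    of i, and stability makes it everything. *)
Lemma box_span : (<<map u box>> = fullv)%VS.
Proof.
apply/eqP/negPn/negP => nS; apply: xs.2; exists <<map u box>>%VS.
have H z (B : 'M[K]_n) : (forall m, B *m u m = u (z m)) ->
    (forall m, z m \in box -> m \in box) ->
    (forall m, z m \notin box -> u (z m) = 0) ->
    forall v, v \in <<map u box>>%VS -> B *m v \in <<map u box>>%VS.
  move=> Bz zb z0.
  apply: (@span_ind _ _ _ (fun v => B *m v \in <<map u box>>%VS)).
    by rewrite mulmx0 mem0v.
    by move=> a v v' Hv Hv'; rewrite mulmxDr -scalemxAr memvD // memvZ.
  move=> _ /mapP[m mb ->]; rewrite Bz; have [zmb|zmb] := boolP (z m \in box).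
    by apply/memv_span/map_f.
  by rewrite z0 // mem0v.
have out m : m \notin box -> u m = 0.
  by rewrite mem_box negb_and -!leqNgt => mb; apply: uvec_out xg xC mb.
split=> //.
- apply: (H (@mulx r)) => // m; last exact: out.
  by rewrite !mem_box /= => /andP[/ltnW -> ->].
- apply: (H (@muly r)) => [m|m|m]; [by rewrite /u uvec_muly| |exact: out].
  by rewrite !mem_box /= => /andP[-> /ltnW ->].
move=> v; rewrite mulmx_sum_col; apply: rpred_sum => l _; apply: rpredZ.
have -> : col l (qi x) = u (gen l) by [].
by have [/map_f/memv_span->//|/out ->] := boolP (gen l \in box); rewrite mem0v.
Qed.

Lemma greedy_span N m : m \in box -> (greedy_weight m < N)%N -> u m \in lower G N.
Proof.
elim: N m => // N IH m mb; rewrite ltnS => mN.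
have [mG|mG] := boolP (m \in G).
  by apply/memv_span/map_f; rewrite mem_filter ltnS mN.
move: mG; rewrite mem_filter mb andbT negbK => /(subvP (lowerS _ mN)).
move=> uN; apply: (subvP (lowerS _ (leqnSn N))).
move: uN; apply/subvP/span_subvP => _ /mapP[m' + ->].
by rewrite mem_filter => /andP[m'N m'b]; apply: IH.
Qed.

Lemma greedy_lower m : m \in box -> m \notin G -> u m \in lower G (greedy_weight m).
Proof.
move=> mb; rewrite mem_filter mb andbT negbK.
apply/subvP/span_subvP => _ /mapP[m' + ->].
by rewrite mem_filter => /andP[m'N m'b]; apply: greedy_span.
Qed.

Lemma greedy_free : free (map u G).
Proof.
have Gs : sorted (fun m m' => greedy_weight m' <= greedy_weight m)%N G.
  apply: sorted_filter; first by move=> ? ? ? h1 h2; apply: leq_trans h2 h1.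
  by apply: sort_sorted => m m'; apply: leq_total.
have Gu : uniq G by rewrite filter_uniq // box_uniq.
suff: forall s, sorted (fun m m' => greedy_weight m' <= greedy_weight m)%N s -> uniq s ->
    {subset s <= G} -> free (map u s) by apply.
elim=> [|m s IH] /=; first by rewrite nil_free.
rewrite path_sortedE; last by move=> ? ? ? h1 h2; apply: leq_trans h2 h1.
move=> /andP[/allP ms ss] /andP[nms us] sub.
rewrite free_cons IH // ?andbT; last by move=> m' m's; apply: sub; rewrite inE m's orbT.
have mG : m \in G by apply: sub; rewrite mem_head.
move: mG; rewrite mem_filter => /andP[mlow mb]; apply: contra mlow.
apply/subvP/sub_span => _ /mapP[m' m's ->]; apply: map_f.
have m'b : m' \in box by have := sub m'; rewrite inE m's orbT mem_filter => /(_ isT)/andP[].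
rewrite mem_filter m'b andbT ltn_neqAle ms // andbT.
by apply: contra nms => /eqP/greedy_weight_inj <-.
Qed.

Lemma greedy_full : (<<map u G>> = fullv)%VS.
Proof.
apply/eqP; rewrite eqEsubv subvf -box_span /=.
apply/span_subvP => _ /mapP[m mb ->].
apply: (subvP _ _ (greedy_span mb (leqnn _))).
apply: sub_span => _ /mapP[m' + ->]; rewrite mem_filter => /andP[_ ?].
exact: map_f.
Qed.

Lemma greedy_size : size G = n.
Proof.
have := greedy_free; rewrite /free greedy_full size_map => /eqP <-.
by rewrite dimvf /dim /= muln1.
Qed.

Let T : n.-tuple (mono r) := Tuple (introT eqP greedy_size).
Let D := tnth T.

Let mem_D m : m \in G <-> exists p, D p = m.
Proof.
split=> [mG|[p <-]]; last exact: (mem_tnth p T).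
by have /tnthP[p ->] : m \in T by []; exists p.
Qed.

Let coords (s : seq (mono r)) (P : pred (mono r)) v : {subset s <= [seq m <- G | P m]} ->
  v \in <<map u s>>%VS ->
  exists2 c : 'cV[K]_n, v = bmx x D *m c & forall p, c p 0 != 0 -> P (D p).
Proof.
move=> sG; apply: (@span_ind _ _ _ (fun v => exists2 c : 'cV[K]_n,
  v = bmx x D *m c & forall p, c p 0 != 0 -> P (D p))).
- by exists 0 => [|p]; rewrite ?mulmx0 // mxE eqxx.
- move=> a _ _ [c -> cP] [c' -> c'P]; exists (a *: c + c').
    by rewrite mulmxDr -scalemxAr.
  move=> p; rewrite !mxE; have [c0|/cP//] := eqVneq (c p 0) 0.
  by rewrite c0 mulr0 add0r => /c'P.
move=> _ /mapP[m /sG + ->]; rewrite mem_filter => /andP[Pm /mem_D[p pm]].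
exists (delta_mx p 0); first by rewrite -colE col_bmx pm.
move=> q; rewrite mxE andbT; case: (eqVneq q p) => [->|_]; rewrite ?pm //.
by rewrite eqxx.
Qed.

Let box_reducible m : (m \notin box -> u m = 0) -> reducible greedy_weight x D m.
Proof.
move=> out; have [mb|/out um0] := boolP (m \in box); last first.
  right; exists 0 => [|p]; first by rewrite mulmx0.
  by rewrite mxE eqxx.
have [/mem_D|mG] := boolP (m \in G); first by left.
right; have [] := @coords _ (fun m' => greedy_weight m' < greedy_weight m)%N _ _ (greedy_lower mb mG).
  by move=> m'; rewrite !mem_filter andbC.
by move=> c uE cP; exists c.
Qed.

(** The basis is closed under division because multiplication by x or y preserves strict
    inequalities of weight: a reduction of m yields one of its multiples, in which the terms leaving
    the box vanish. *)
Lemma greedy_basis : groebner_basis greedy_weight x D.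
Proof.
have out m : m \notin box -> u m = 0.
  by rewrite mem_box negb_and -!leqNgt => mb; apply: uvec_out xg xC mb.
split.
- by apply/tuple_uniqP; rewrite filter_uniq // box_uniq.
- move=> p m Dp; apply/mem_D.
  have pG : D p \in G by apply/mem_D; exists p.
  have mb : m \in box.
    move: pG; rewrite mem_filter => /andP[_].
    by case: Dp => ->; rewrite !mem_box /= => /andP[h1 h2]; rewrite ?h1 ?h2 // ltnW.
  apply/negPn/negP => mG; move: pG; rewrite mem_filter => /andP[/negP + _]; apply.
  have := mG; rewrite mem_filter mb andbT negbK.
  have H z (B : 'M[K]_n) : (forall m, B *m u m = u (z m)) ->
     (forall m m', greedy_weight m' < greedy_weight m -> greedy_weight (z m') < greedy_weight (z m))%N ->
     u m \in lower box (greedy_weight m) -> u (z m) \in lower box (greedy_weight (z m)).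
    move=> Bz zw; rewrite -Bz.
    apply: (@span_ind _ _ _ (fun v => B *m v \in lower box (greedy_weight (z m)))).
    + by rewrite mulmx0 mem0v.
    + by move=> a v v' Hv Hv'; rewrite mulmxDr -scalemxAr memvD // memvZ.
    move=> _ /mapP[m' + ->]; rewrite mem_filter Bz => /andP[m'm _].
    have [zb|/out ->] := boolP (z m' \in box); last exact: mem0v.
    by apply/memv_span/map_f; rewrite mem_filter zb zw.
  case: Dp => ->.
    by apply: (H (@mulx r)) => // m1 m2; rewrite /greedy_weight /mweight /= /lab /xdeg /ydeg /= ?mulnS !mul1n; move: (_ * n * n)%N (_ * n * n)%N (n * _)%N (n * _)%N => ? ? ? ?; lia.
  apply: (H (@muly r)) => [m1|m1 m2]; first by rewrite /u uvec_muly.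
  by rewrite /greedy_weight /mweight /= /lab /xdeg /ydeg /= ?mulnS !mul1n; move: (_ * n * n)%N (_ * n * n)%N (n * _)%N (n * _)%N => ? ? ? ?; lia.
- have H i : exists c : 'cV[K]_n, delta_mx i 0 = bmx x D *m c.
    have [] := @coords G predT (delta_mx i 0).
    + by move=> m mG; rewrite mem_filter.
    + by rewrite greedy_full memvf.
    by move=> c cE _; exists c.
  have [c cE] := choice H.
  have /mulmx1_unit[] // : bmx x D *m (\matrix_(i, j) c j i 0) = 1%:M.
  apply/matrixP => i j; have /colP/(_ i) := cE j; rewrite !mxE andbT => ->.
  by apply: eq_bigr => k _; rewrite !mxE.
- by move=> q; split; apply: box_reducible; apply: out.
by move=> l; apply: box_reducible; apply: out.
Qed.

End Point.
End Greedy.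

(** * Paths in the fixed locus *)

Lemma continuous_mx (T : topologicalType) (K : numFieldType) a b (f : T -> 'M[K]_(a, b)) :
  (forall i j, continuous (fun t => f t i j)) -> continuous f.
Proof.
move=> fc t A [P fP PA]; rewrite /nbhs /=.
suff: \forall s \near t, forall i j, P i j (f s i j).
  by apply: filterS => s; apply: PA.
apply: filter_forall => i; apply: filter_forall => j.
exact: (fc i j t (P i j) (fP i j)).
Qed.

Lemma continuous_pair (T U V : topologicalType) (f : T -> U) (g : T -> V) :
  continuous f -> continuous g -> continuous (fun t => (f t, g t)).
Proof. by move=> cf cg t; apply: (cvg_pair (cf t) (cg t)). Qed.

Lemma continuous_quiver (T : topologicalType) (K : numClosedFieldType) r n
    (f : T -> quiver_data K r n) :
  continuous (fun t => qB1 (f t)) -> continuous (fun t => qB2 (f t)) ->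
  continuous (fun t => qi (f t)) -> continuous (fun t => qj (f t)) ->
  continuous f.
Proof.
move=> c1 c2 c3 c4.
have -> : f = fun t => (qB1 (f t), qB2 (f t), qi (f t), qj (f t)).
  by apply/funext => s; case: (f s) => [[[]]].
by do 3! apply: continuous_pair => //.
Qed.

Section StableGl.
Variables (K : numClosedFieldType) (r n : nat).
Implicit Types (x : quiver_data K r n).

Lemma stable_gl g x : g \in unitmx -> stable_locus K r n x -> stable_locus K r n (gl_act g x).
Proof.
move=> gU [xeq xst]; split.
  have -> : adhm_eq (gl_act g x) = (g *m (qB1 x *m qB2 x - qB2 x *m qB1 x + qi x *m qj x)
      *m invmx g = 0).
    rewrite /adhm_eq /gl_act /qB1 /qB2 /qi /qj /= mulmxDr mulmxDl mulmxBr mulmxBl.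
    by rewrite -!mulmxA !(mulKmx gU).
  by rewrite xeq mulmx0 mul0mx.
move=> [S [SnT S1 S2 Si]]; apply: xst.
pose h : 'Hom('cV[K]_n, 'cV[K]_n) := linfun (mulmx g : 'cV[K]_n -> 'cV[K]_n).
exists (h @^-1: S)%VS; split.
- apply: contra SnT => /eqP full; rewrite eqEsubv subvf; apply/subvP => v _.
  by rewrite -[v](mulKVmx gU) -[g *m _](lfunE (mulmx g : 'cV[K]_n -> 'cV[K]_n))
    memv_preim full memvf.
- move=> v; rewrite -!memv_preim !lfunE /= => /S1.
  by rewrite /qB1 /= -!mulmxA mulKmx.
- move=> v; rewrite -!memv_preim !lfunE /= => /S2.
  by rewrite /qB2 /= -!mulmxA mulKmx.
by move=> v; rewrite -memv_preim lfunE /= mulmxA; apply: Si.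
Qed.

End StableGl.

Section RealPaths.
Variable (R : realType).
Local Notation K := (R[i] : numClosedFieldType).

(** Paths are parametrised by the real line, connected as an interval, and enter the complex scalars
    through this map. *)
Definition rc (t : R) : K := t%:C%C.

Lemma rc_continuous : continuous rc.
Proof.
move=> t A /nbhs_ballP[e e0 eA].
have e0' : 0 < complex.Re e by move: e0; rewrite /= ltcE /= => /andP[].
apply/nbhs_ballP; exists (complex.Re e) => // s ts; apply: eA.
move: ts; rewrite -!ball_normE /ball_ /= -[rc t - rc s]rmorphB normc_def /=.
rewrite expr0n addr0 sqrtr_sqr ltcE /= => ->.
by move: e0; rewrite /= ltcE => /andP[/eqP -> _]; rewrite eqxx.
Qed.

Section Conn.
Variables (r n wm : nat).
Implicit Types (x y z : quiver_data K r n) (D : 'I_n -> mono r).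

Let M : set (moduli K r n) := fixed_locus (subtorus 1 1 (@weight r wm)).

Definition mclass x (xs : stable_locus K r n x) : moduli K r n :=
  \pi_(moduli K r n) (SigSub (mem_set xs) : stable_locus K r n).

Definition fixed_point x : Prop := stable_locus K r n x /\
  forall t : K, t != 0 -> exists2 g, g \in unitmx & torus_eigen wm t x g.

Lemma mclass_fixed x (xs : stable_locus K r n x) : fixed_point x -> M (mclass xs).
Proof. by move=> [_ xf]; apply/fixedP => t t0; exact: (xf t t0). Qed.

Lemma mclass_surj u : M u -> exists x (xs : stable_locus K r n x),
  fixed_point x /\ u = mclass xs.
Proof.
move=> uM; pose x := repr u.
have ux : u = \pi_(moduli K r n) x by rewrite reprK.
have xs : stable_locus K r n (set_val x) := set_valP x.
exists (set_val x), xs; split; last first.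
  by rewrite /mclass ux; congr (\pi_(_) _); apply: val_inj.
by split=> // t t0; move: uM; rewrite ux => /fixedP; apply.
Qed.

(** The stability proofs are quantified inside, so that the relation is one between bare quadruples
    and allows rewriting. *)
Definition conn x y : Prop := exists (xs : stable_locus K r n x)
  (ys : stable_locus K r n y), connected_component M (mclass xs) (mclass ys).

Lemma mclass_irr x (h h' : stable_locus K r n x) : mclass h = mclass h'.
Proof. by congr (\pi_(_) _); apply: val_inj. Qed.

Lemma conn_sym x y : conn x y -> conn y x.
Proof. by case=> xs [ys xy]; exists ys, xs; apply: connected_component_sym. Qed.

Lemma conn_trans x y z : conn x y -> conn y z -> conn x z.
Proof.
case=> xs [ys xy] [ys' [zs yz]]; exists xs, zs.
apply: connected_component_trans xy _; by rewrite (mclass_irr ys ys').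
Qed.

Lemma conn_refl x : fixed_point x -> conn x x.
Proof.
move=> xf; exists xf.1, xf.1; apply: connected_component_refl.
exact: mclass_fixed.
Qed.

Lemma conn_gl g x : g \in unitmx -> fixed_point x -> conn x (gl_act g x).
Proof.
move=> gU xf; have gs := stable_gl gU xf.1.
exists xf.1, gs; have -> : mclass gs = mclass xf.1.
  by apply/esym/eqmodP/asboolP; exists g.
by apply: connected_component_refl; apply: mclass_fixed.
Qed.

Lemma conn_path (f : R -> quiver_data K r n) s t :
  continuous f -> (forall t, fixed_point (f t)) -> conn (f s) (f t).
Proof.
move=> cf ff; exists (ff s).1, (ff t).1.
pose F u := mclass (ff u).1; rewrite -[mclass (ff s).1]/(F s) -[mclass _]/(F t).
pose f' u : stable_locus K r n := SigSub (mem_set (ff u).1).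
have fc' : continuous f' by apply: (@continuous_comp_initial _ _ _ set_val f').
have Fc : continuous F.
  by move=> u; apply: (continuous_comp (fc' u) (@pi_continuous _ _ (f' u))).
have FM : F @` setT `<=` connected_component M (F s).
  apply: connected_component_max.
  - by exists s.
  - by move=> _ [u _ <-]; apply/mclass_fixed/ff.
  apply: connected_continuous_connected; last by apply: continuous_subspaceT.
  by apply/connected_intervalP => ? ? ? ? ?.
by apply: FM; exists t.
Qed.

End Conn.
End RealPaths.

(** * Degeneration along a weight *)

Section Degeneration.
Variables (K : numClosedFieldType) (r n wm : nat).
Implicit Types (x : quiver_data K r n) (m : mono r) (D : 'I_n -> mono r).

(** The diagonal matrices with entries t^(d p) are then lifts for all t at once. As a condition on
    single entries it survives their rescaling along a path. *)
Definition graded (d : 'I_n -> int) x : Prop :=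
  [/\ forall p q, qB1 x p q != 0 -> d p = d q + 1,
      forall p q, qB2 x p q != 0 -> d p = d q + 1,
      forall p l, qi x p l != 0 -> d p = - weight wm l & qj x = 0].

Lemma graded_eigen d x (t : K) : graded d x -> t != 0 ->
  exists2 g, g \in unitmx & torus_eigen wm t x g.
Proof.
move=> [g1 g2 g3 g4] t0; exists (diag_mx (\row_p t ^ d p)).
  by rewrite unitmxE det_diag unitfE; apply/prodf_neq0 => p _; rewrite mxE expfz_neq0.
have B (A : 'M[K]_n) : (forall p q, A p q != 0 -> d p = d q + 1) ->
    diag_mx (\row_p t ^ d p) *m A = t *: (A *m diag_mx (\row_p t ^ d p)).
  move=> Ad; apply/matrixP => p q; rewrite mul_diag_mx mul_mx_diag !mxE.
  have [->|/Ad ->] := eqVneq (A p q) 0; first by rewrite mul0r !mulr0.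
  by rewrite (@expfzDr _ t (d q) 1 t0) mulrAC mulrC [_ * A p q]mulrC.
split; [exact: B|exact: B| |by rewrite g4 mulmx0 mul0mx scaler0].
apply/matrixP => p l; rewrite mul_diag_mx /wdiag mul_mx_diag !mxE.
have [->|/g3 ->] := eqVneq (qi x p l) 0; first by rewrite mul0r mulr0.
by rewrite mulN1r mulrC.
Qed.

(** When the vectors of D are the standard basis, g is diagonal with entries 2^(dg), and equal
    powers of 2 have equal exponents. So t = 2 alone forces the grading. *)
Lemma eigen_graded x D (g : 'M[K]_n) : bmx x D = 1%:M -> qj x = 0 ->
  torus_eigen wm 2%:R x g -> graded (fun p => dg wm (D p)) x.
Proof.
move=> xD j0 gh; have two0 : (2 : K) != 0 by rewrite pnatr_eq0.
have gE : g = diag_mx (\row_p 2%:R ^ dg wm (D p)).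
  apply/matrixP => p q; have := torus_eigen_uvec (D q) two0 gh.
  rewrite -col_bmx xD => /colP/(_ p); rewrite colE mul1mx -colE !mxE => ->.
  rewrite eqxx andbT eq_sym; case: eqP => [->|]; rewrite ?mulr1 ?mulr0 ?mulr1n ?mulr0n //.
case: gh; rewrite gE => h1 h2 h3 _.
have B (A : 'M[K]_n) : diag_mx (\row_p 2%:R ^ dg wm (D p)) *m A =
    2%:R *: (A *m diag_mx (\row_p 2%:R ^ dg wm (D p))) ->
    forall p q, A p q != 0 -> dg wm (D p) = dg wm (D q) + 1.
  move=> /matrixP E p q A0; have := E p q; rewrite mul_diag_mx mul_mx_diag !mxE.
  rewrite mulrC mulrCA => /(mulfI A0) H.
  suff /exp2z_inj : (2%:R : K) ^ dg wm (D p) = 2%:R ^ (dg wm (D q) + 1) by [].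
  by rewrite (@expfzDr _ _ (dg wm (D q)) 1 two0) H mulrC.
split=> //; [exact: B|exact: B|] => p l i0.
move/matrixP: h3 => /(_ p l); rewrite mul_diag_mx /wdiag mul_mx_diag !mxE.
by rewrite mulrC mulN1r => /(mulfI i0)/exp2z_inj.
Qed.

Section Path.
Variables (x : quiver_data K r n) (D : 'I_n -> mono r).
Variables (wl : 'I_r -> nat) (wx wy : nat).
Let wt := mweight wl wx wy.
Hypotheses (xD : bmx x D = 1%:M) (xC : qcomm x) (j0 : qj x = 0).
Hypothesis gb : groebner_basis wt x D.

(** For t <> 0 this conjugates by the diagonal matrix with entries t^(wt) and rescales B1, B2 and
    the framing. Truncated subtraction is safe because reducibility makes the entries with a
    negative exponent vanish; at t = 0 only the exponents 0 survive. *)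
Definition gpath (t : K) : quiver_data K r n :=
  (\matrix_(p, q) (t ^+ (wt (mulx (D q)) - wt (D p)) * qB1 x p q),
   \matrix_(p, q) (t ^+ (wt (muly (D q)) - wt (D p)) * qB2 x p q),
   \matrix_(p, l) (t ^+ (wt (gen l) - wt (D p)) * qi x p l), 0).

Lemma wt_mulx m : wt (mulx m) = (wx + wt m)%N.
Proof. by rewrite /wt /mweight mulnS -!addnA addnCA. Qed.

Lemma wt_muly m : wt (muly m) = (wy + wt m)%N.
Proof. by rewrite /wt /mweight mulnS addnCA. Qed.

Let uD q : uvec x (D q) = delta_mx q 0.
Proof. by rewrite -col_bmx xD colE mul1mx. Qed.

Lemma col_qB1 q : col q (qB1 x) = uvec x (mulx (D q)).
Proof. by rewrite uvec_mulx uD colE. Qed.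

Lemma col_qB2 q : col q (qB2 x) = uvec x (muly (D q)).
Proof. by rewrite uvec_muly // uD colE. Qed.

Lemma reducible_coord m p : reducible wt x D m ->
  uvec x m p 0 = (D p == m)%:R \/ (wt (D p) < wt m)%N.
Proof.
have [Dinj _ _ _ _] := gb.
case=> [[q <-]|[c uE cw]].
  by left; rewrite uD mxE andbT (inj_eq Dinj).
have uc : uvec x m = c by rewrite uE xD mul1mx.
rewrite uc; have [c0|cp0] := eqVneq (c p 0) 0; last by right; apply: cw.
left; rewrite c0; case: eqVneq => // pm; move: c0.
by rewrite -uc -pm uD mxE !eqxx => /eqP; rewrite oner_eq0.
Qed.

Let red_mulx q : reducible wt x D (mulx (D q)).
Proof. by have [_ _ _ /(_ q)[]] := gb. Qed.

Let red_muly q : reducible wt x D (muly (D q)).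
Proof. by have [_ _ _ /(_ q)[]] := gb. Qed.

Let red_gen l : reducible wt x D (gen l).
Proof. by have [_ _ _ _] := gb. Qed.

Let red_wt m p : reducible wt x D m -> uvec x m p 0 != 0 -> (wt (D p) <= wt m)%N.
Proof.
move=> /(reducible_coord p)[->|/ltnW//].
by case: (D p =P m) => [->|_]; rewrite ?eqxx.
Qed.

Let wt_B1 p q : qB1 x p q != 0 -> (wt (D p) <= wx + wt (D q))%N.
Proof.
have -> : qB1 x p q = uvec x (mulx (D q)) p 0 by rewrite -col_qB1 mxE.
by move/(red_wt (red_mulx q)); rewrite wt_mulx.
Qed.

Let wt_B2 p q : qB2 x p q != 0 -> (wt (D p) <= wy + wt (D q))%N.
Proof.
have -> : qB2 x p q = uvec x (muly (D q)) p 0 by rewrite -col_qB2 mxE.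
by move/(red_wt (red_muly q)); rewrite wt_muly.
Qed.

Let wt_i p l : qi x p l != 0 -> (wt (D p) <= wt (gen l))%N.
Proof.
have -> : qi x p l = uvec x (gen l) p 0 by rewrite /uvec /= mxE.
exact/red_wt/red_gen.
Qed.

Let scale_mul (t : K) (A : 'M[K]_n) (v : 'I_n -> K) e N p :
  (forall p q, A p q != 0 -> (wt (D p) <= e + wt (D q))%N) ->
  (forall q, v q != 0 -> (wt (D q) <= N)%N) ->
  \sum_q t ^+ (e + wt (D q) - wt (D p)) * A p q * (t ^+ (N - wt (D q)) * v q) =
  t ^+ (e + N - wt (D p)) * \sum_q A p q * v q.
Proof.
move=> Ae vN; rewrite mulr_sumr; apply: eq_bigr => q _.
have [->|A0] := eqVneq (A p q) 0; first by rewrite mulr0 !mul0r mulr0.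
have [->|v0] := eqVneq (v q) 0; first by rewrite !mulr0.
have h1 := Ae _ _ A0; have h2 := vN _ v0.
have -> : (e + N - wt (D p) = (e + wt (D q) - wt (D p)) + (N - wt (D q)))%N by lia.
by rewrite exprD; ring.
Qed.

Let sum_wt (A : 'M[K]_n) (v : 'I_n -> K) e N p :
  (forall p q, A p q != 0 -> (wt (D p) <= e + wt (D q))%N) ->
  (forall q, v q != 0 -> (wt (D q) <= N)%N) ->
  \sum_q A p q * v q != 0 -> (wt (D p) <= e + N)%N.
Proof.
move=> Ae vN; apply: contraR; rewrite -ltnNge => Np; rewrite big1 // => q _.
apply/eqP; rewrite mulf_eq0; apply: contraLR Np; rewrite negb_or => /andP[A0 v0].
by have := Ae _ _ A0; have := vN _ v0; lia.
Qed.

Lemma gpath_comm t : qcomm (gpath t).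
Proof.
apply/matrixP => p q; rewrite !mxE.
have E : \sum_k qB1 x p k * qB2 x k q = \sum_k qB2 x p k * qB1 x k q.
  by move/matrixP: xC => /(_ p q); rewrite !mxE.
transitivity (t ^+ (wx + (wy + wt (D q)) - wt (D p)) * \sum_k qB1 x p k * qB2 x k q).
  rewrite -(@scale_mul t _ (fun k => qB2 x k q)) //; last by move=> k; apply: wt_B2.
  by apply: eq_bigr => k _; rewrite !mxE wt_mulx wt_muly.
rewrite E addnCA -(@scale_mul t _ (fun k => qB1 x k q)) //; last by move=> k; apply: wt_B1.
by apply: eq_bigr => k _; rewrite !mxE wt_mulx wt_muly.
Qed.

(** Coordinates are only rescaled, and not at all at the basis monomials, so D remains a basis for
    every t, including 0; this keeps the path in the stable locus. *)
Lemma uvec_gpath t m p :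
  uvec (gpath t) m p 0 = t ^+ (wt m - wt (D p)) * uvec x m p 0 /\
  (uvec x m p 0 != 0 -> (wt (D p) <= wt m)%N).
Proof.
case: m => -[l a] b; elim: a p => [|a IH] p; last first.
  rewrite -[(l, a.+1, b)]/(mulx (l, a, b)) !uvec_mulx !mxE wt_mulx.
  have h q := (IH q).2; split; last exact: sum_wt wt_B1 h.
  rewrite -scale_mul //; apply: eq_bigr => q _.
  by rewrite (IH q).1 !mxE wt_mulx.
elim: b p => [|b IH] p.
  by rewrite /uvec /= !mxE; split=> // /wt_i.
rewrite -[(l, 0%N, b.+1)]/(muly (l, 0%N, b)) !uvec_muly //; last exact: gpath_comm.
rewrite !mxE wt_muly.
have h q := (IH q).2; split; last exact: sum_wt wt_B2 h.
rewrite -scale_mul //; apply: eq_bigr => q _.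
by rewrite (IH q).1 !mxE wt_muly.
Qed.

Lemma bmx_gpath t : bmx (gpath t) D = 1%:M.
Proof.
apply/matrixP => p q; rewrite !mxE (uvec_gpath t (D q) p).1 uD mxE andbT.
by case: eqP => [->|_]; rewrite ?mulr0 // subnn expr0 mulr1.
Qed.

Lemma gpath_stable t : stable_locus K r n (gpath t).
Proof.
split; first by rewrite /adhm_eq [qj _]/(0 : 'M[K]_(r, n)) mulmx0 addr0 gpath_comm // subrr.
by apply: (@bmx_stable _ _ _ _ D (gpath_comm t)); rewrite bmx_gpath unitmx1.
Qed.

Lemma gpath_graded d t : graded d x -> graded d (gpath t).
Proof.
move=> [g1 g2 g3 _]; split=> // p q; rewrite mxE mulf_eq0 negb_or => /andP[_].
- exact: g1.
- exact: g2.
exact: g3.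
Qed.

Let degen (t : K) m p : reducible wt x D m -> t ^+ (wt m - wt (D p)) * uvec x m p 0 =
  if t == 1 then uvec x m p 0 else if t == 0 then (D p == m)%:R
  else t ^+ (wt m - wt (D p)) * uvec x m p 0.
Proof.
move=> mr; case: eqP => [->|_]; first by rewrite expr1n mul1r.
case: eqP => [->|//]; have [uE|pm] := reducible_coord p mr.
  rewrite uE; case: eqP => [->|_]; last by rewrite mulr0.
  by rewrite subnn expr0 mulr1.
rewrite expr0n subn_eq0 leqNgt pm mul0r.
by case: eqP pm => [->|//]; rewrite ltnn.
Qed.

Lemma gpath1 : gpath 1 = x.
Proof.
move: j0; rewrite /gpath; case: (x) => [[[B1 B2] i] j]; rewrite /qB1 /qB2 /qi /qj /= => ->.
by congr (_, _, _, _); apply/matrixP => p q; rewrite mxE expr1n mul1r.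
Qed.

Lemma gpath0 : gpath 0 = pt K D.
Proof.
congr (_, _, _, _); apply/matrixP => p q; rewrite !mxE.
- have -> : qB1 x p q = uvec x (mulx (D q)) p 0 by rewrite -col_qB1 mxE.
  by rewrite degen // eq_sym oner_eq0 eqxx.
- have -> : qB2 x p q = uvec x (muly (D q)) p 0 by rewrite -col_qB2 mxE.
  by rewrite degen // eq_sym oner_eq0 eqxx.
have -> : qi x p q = uvec x (gen q) p 0 by rewrite /uvec /= mxE.
by rewrite degen // eq_sym oner_eq0 eqxx.
Qed.

End Path.
End Degeneration.

(** * Separation of components *)

Section OpenRank.
Variables (K : numClosedFieldType) (r n : nat).
Implicit Types (x : quiver_data K r n) (m : mono r) (D : 'I_n -> mono r).

Lemma continuous_mulmx_entry (T : topologicalType) a b c (A : T -> 'M[K]_(a, b))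
    (B : T -> 'M[K]_(b, c)) i j :
  (forall i j, continuous (fun t => A t i j)) ->
  (forall i j, continuous (fun t => B t i j)) ->
  continuous (fun t => (A t *m B t) i j).
Proof.
move=> cA cB; under eq_fun do rewrite mxE.
apply: continuous_big => [|k _ t]; first exact: add_continuous.
by apply: continuousM; [exact: cA|exact: cB].
Qed.

Lemma continuous_det (T : topologicalType) c (A : T -> 'M[K]_c) :
  (forall i j, continuous (fun t => A t i j)) -> continuous (fun t => \det (A t)).
Proof.
move=> cA; apply: continuous_big => [|s _ t]; first exact: add_continuous.
pose G (y : T) := \prod_i A y i (perm.fun_of_perm.body s i).
have cG : continuous G.
  by apply: continuous_big => [|i _]; [exact: mul_continuous|exact: cA].
exact: (continuousM (@cst_continuous _ _ ((-1) ^+ perm.odd_perm s : K) t) (cG t)).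
Qed.

Let cfst (U V : topologicalType) : continuous (@fst U V).
Proof. by move=> x; apply: cvg_fst. Qed.

Let csnd (U V : topologicalType) : continuous (@snd U V).
Proof. by move=> x; apply: cvg_snd. Qed.

Lemma continuous_uvec m i : continuous (fun x : quiver_data K r n => uvec x m i 0).
Proof.
have c1 : continuous (@qB1 K r n).
  move=> x; apply: (@continuous_comp _ _ _ (fun x : quiver_data K r n => x.1.1) fst); last exact: cfst.
  apply: (@continuous_comp _ _ _ (fun x : quiver_data K r n => x.1) fst); exact: cfst.
have c2 : continuous (@qB2 K r n).
  move=> x; apply: (@continuous_comp _ _ _ (fun x : quiver_data K r n => x.1.1) snd); last exact: csnd.
  apply: (@continuous_comp _ _ _ (fun x : quiver_data K r n => x.1) fst); exact: cfst.
have c3 : continuous (@qi K r n).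
  move=> x; apply: (@continuous_comp _ _ _ (fun x : quiver_data K r n => x.1) snd).
    exact: cfst.
  exact: csnd.
have entry a b (f : quiver_data K r n -> 'M[K]_(a, b)) : continuous f ->
    forall i j, continuous (fun x => f x i j).
  by move=> cf ii j x; apply: continuous_comp (cf x) (@coord_continuous _ _ _ ii j _).
case: m => -[l a] b; rewrite /uvec /lab /xdeg /ydeg /=.
suff: forall k : 'I_1, continuous (fun x : quiver_data K r n => iter a (mulmx (qB1 x))
  (iter b (mulmx (qB2 x)) (col l (qi x))) i k) by apply.
elim: a i => [|a IH] i k /=; last by apply: continuous_mulmx_entry; [exact: entry|exact: IH].
elim: b i k => [|b IH] i k /=; last by apply: continuous_mulmx_entry; [exact: entry|exact: IH].
by under eq_fun do rewrite mxE; apply: entry.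
Qed.

(** The vectors of the monomials in S span dimension at least c. A nonzero determinant after a
    projection P makes the condition visibly open. *)
Definition rank_ge (S : pred (mono r)) c x : Prop :=
  exists P : 'M[K]_(c, n), exists2 ms : 'I_c -> mono r, forall i, S (ms i) &
    \det (P *m \matrix_(i, j) uvec x (ms j) i 0) != 0.

Lemma rank_ge_open S c : open [set x | rank_ge S c x].
Proof.
have -> : [set x | rank_ge S c x] = \bigcup_(P : 'M[K]_(c, n))
    \bigcup_(ms in [set ms : 'I_c -> mono r | forall i, S (ms i)])
    [set x | \det (P *m \matrix_(i, j) uvec x (ms j) i 0) != 0].
  apply/seteqP; split=> [x [P [ms Sms dP]]|x [P _ [ms Sms dP]]].
    by exists P => //; exists ms.
  by exists P, ms.
apply: bigcup_open => P _; apply: bigcup_open => ms _.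
pose f x := \det (P *m \matrix_(i, j) uvec x (ms j) i 0).
rewrite -[mkset _]/(f @^-1` [set z | z != 0]); apply: open_comp.
  move=> x _; apply: continuous_det => i j; apply: continuous_mulmx_entry => i' j'.
    exact: cst_continuous.
  by under eq_fun do rewrite mxE; apply: continuous_uvec.
have -> : [set z : K | z != 0] = ~` [set 0].
  by apply/seteqP; split=> z /= /eqP.
by rewrite openC; apply/accessible_closed_set1/hausdorff_accessible/norm_hausdorff.
Qed.

Lemma rank_ge_gl S c g x : g \in unitmx -> rank_ge S c x -> rank_ge S c (gl_act g x).
Proof.
move=> gU [P [ms Sms dP]]; exists (P *m invmx g), ms => //.
have -> : \matrix_(i, j) uvec (gl_act g x) (ms j) i 0 =
    g *m \matrix_(i, j) uvec x (ms j) i 0.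
  by apply/matrixP => i j; rewrite mxE uvec_gl // !mxE; apply: eq_bigr => k _; rewrite !mxE.
by rewrite mulmxA mulmxKV.
Qed.

Lemma gl_actK g x : g \in unitmx -> gl_act (invmx g) (gl_act g x) = x.
Proof. by move=> gU; rewrite -gl_actM ?unitmx_inv // mulVmx // gl_act1. Qed.

Lemma rank_ge_glE S c g x : g \in unitmx -> rank_ge S c (gl_act g x) <-> rank_ge S c x.
Proof.
move=> gU; split; last exact: rank_ge_gl.
by rewrite -{2}(gl_actK x gU); apply: rank_ge_gl; rewrite unitmx_inv.
Qed.

(** If monomials in S only involve basis vectors from S, their span is a coordinate subspace, whose
    dimension is a count. *)
Lemma rank_ge_card (S : pred (mono r)) c x D : bmx x D = 1%:M ->
  (forall m p, uvec x m p 0 != 0 -> S m -> S (D p)) ->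
  rank_ge S c x <-> (c <= #|[pred p | S (D p)]|)%N.
Proof.
move=> xD xS; split=> [[P [ms Sms dP]]|cS].
  pose A := [pred p | S (D p)].
  pose U : 'M[K]_(n, c) := \matrix_(i, j) uvec x (ms j) i 0.
  pose E : 'M[K]_(n, #|A|) := \matrix_(i, a) (i == enum_val a)%:R.
  have UE : U = E *m \matrix_(a, j) U (enum_val a) j.
    apply/matrixP => i j; rewrite !mxE; have [Ai|nAi] := boolP (i \in A).
      rewrite (bigD1 (enum_rank_in Ai i)) //= !mxE enum_rankK_in // eqxx mul1r.
      rewrite big1 ?addr0 // => a ai; rewrite !mxE; case: eqP => [ia|]; last by rewrite mul0r.
      by move: ai; rewrite [X in enum_rank_in _ X]ia enum_valK_in eqxx.
    rewrite big1 => [|a _]; last first.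
      rewrite !mxE; case: eqP => [ia|]; last by rewrite mul0r.
      by move: nAi; rewrite ia enum_valP.
    by apply/eqP/negPn/negP => /xS/(_ (Sms j)); apply/negP.
  have: (\rank (P *m U) <= #|A|)%N.
    by rewrite UE mulmxA; apply: mulmx_max_rank.
  have PU : P *m U \in unitmx by rewrite unitmxE unitfE.
  by rewrite mxrank_unit.
pose e (i : 'I_c) := enum_val (widen_ord cS i).
exists (\matrix_(i, p) (e i == p)%:R), (fun i => D (e i)).
  by move=> i; have := enum_valP (widen_ord cS i); rewrite inE.
have -> : \matrix_(i, p) (e i == p)%:R *m \matrix_(i, j) uvec x (D (e j)) i 0 = 1%:M :> 'M[K]_c.
  apply/matrixP => i j; rewrite !mxE (bigD1 (e i)) //= !mxE eqxx mul1r.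
  rewrite big1 ?addr0; last first.
    by move=> k /negPf ki; rewrite !mxE eq_sym ki mul0r.
  by rewrite -col_bmx xD !mxE (inj_eq enum_val_inj) -val_eqE.
by rewrite det1 oner_neq0.
Qed.

End OpenRank.

Lemma continuous_expM (T : topologicalType) (K : numFieldType) (f : T -> K) k (a : K) :
  continuous f -> continuous (fun t => f t ^+ k * a).
Proof.
move=> cf; have cX : continuous (fun t => f t ^+ k).
  elim: k => [|k IH].
    have -> : (fun t => f t ^+ 0) = fun=> 1 by apply/funext => t; rewrite expr0.
    exact: cst_continuous.
  have -> : (fun t => f t ^+ k.+1) = f \* (fun t => f t ^+ k).
    by apply/funext => t; rewrite exprS.
  by move=> t; exact: (continuousM (cf t) (IH t)).
by move=> t; exact: (continuousM (cX t) (@cst_continuous _ _ a t)).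
Qed.

Section Coordinates.
Variables (K : numClosedFieldType) (r n wm : nat).
Implicit Types (x : quiver_data K r n) (m : mono r) (D : 'I_n -> mono r).

Lemma groebner_basis_gl wt x D : groebner_basis wt x D ->
  groebner_basis wt (gl_act (invmx (bmx x D)) x) D.
Proof.
case=> Dinj Dcl U red1 red2; pose V := invmx (bmx x D).
have VU : V \in unitmx by rewrite unitmx_inv.
have red m : reducible wt x D m -> reducible wt (gl_act V x) D m.
  case=> [pm|[c uE cw]]; [by left|right; exists c => //].
  by rewrite uvec_gl // bmx_gl // uE mulmxA.
split=> //; first by rewrite bmx_gl // unitmx_mul VU.
  by move=> q; split; apply: red; case: (red1 q).
by move=> l; apply: red.
Qed.

Lemma bmx_coord x D : bmx x D \in unitmx -> bmx (gl_act (invmx (bmx x D)) x) D = 1%:M.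
Proof. by move=> U; rewrite bmx_gl ?unitmx_inv // mulVmx. Qed.

Lemma graded_uvec d x D m p : graded wm d x -> (forall p, d p = dg wm (D p)) ->
  uvec x m p 0 != 0 -> dg wm (D p) = dg wm m.
Proof.
move=> [g1 g2 g3 _] dE; case: m => -[l a] b.
have sumN0 (A : 'I_n -> K) : \sum_k A k != 0 -> exists k, A k != 0.
  by apply: contraPP => nex; apply/negP/negPn/eqP/big1 => k _; apply/eqP/negPn/negP => Ak;
    apply: nex; exists k.
elim: a p => [|a IH] p; last first.
  rewrite -[(l, a.+1, b)]/(mulx (l, a, b)) uvec_mulx mxE => /sumN0[k].
  by rewrite mulf_eq0 negb_or -dE => /andP[/g1 -> /IH]; rewrite dg_mulx dE => ->.
rewrite /uvec /=; elim: b p => [|b IH] p /=.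
  by rewrite mxE -dE => /g3 ->; rewrite /dg /lab /xdeg /ydeg /= sub0r.
rewrite mxE => /sumN0[k]; rewrite mulf_eq0 negb_or -dE => /andP[/g2 -> /IH].
by rewrite -[(l, 0%N, b.+1)]/(muly (l, 0%N, b)) dg_muly dE => ->.
Qed.

Lemma pt_graded D : graded wm (fun p => dg wm (D p)) (pt K D).
Proof.
split=> // p q; rewrite mxE pnatr_eq0 eqb0 negbK => /eqP ->.
- by rewrite dg_mulx.
- by rewrite dg_muly.
by rewrite /dg /lab /xdeg /ydeg /= sub0r.
Qed.

End Coordinates.

Section RealPaths.
Variable (R : realType) (r n wm : nat).
Local Notation K := (R[i] : numClosedFieldType).
Implicit Types (x y z : quiver_data K r n) (D : 'I_n -> mono r).

Lemma graded_fixed_point x d : stable_locus K r n x -> graded wm d x -> fixed_point wm x.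
Proof. by move=> xs xg; split=> // t t0; apply: graded_eigen xg t0. Qed.

Lemma pt_fixed D : injective D -> div_closed D -> fixed_point wm (pt K D).
Proof.
by move=> Dinj Dcl; apply: graded_fixed_point (pt_stable _ Dinj Dcl) (pt_graded _ _ _).
Qed.

Lemma fixed_point_gl g x : g \in unitmx -> fixed_point wm x -> fixed_point wm (gl_act g x).
Proof.
move=> gU xf; have gs := stable_gl gU xf.1; split=> // t t0.
have /fixedP H : fixed_locus (subtorus 1 1 (weight wm)) (mclass gs).
  have -> : mclass gs = mclass xf.1 by apply/esym/eqmodP/asboolP; exists g.
  exact: mclass_fixed.
exact: H.
Qed.

Lemma fixed_point_qj0 x : fixed_point wm x -> qj x = 0.
Proof.
case=> xs /(_ 2%:R); rewrite pnatr_eq0 => /(_ isT)[g _ gh].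
exact: torus_eigen_qj0 xs.2 gh.
Qed.

Lemma fixed_point_comm x : fixed_point wm x -> qcomm x.
Proof. by move=> xf; apply: stable_qcomm xf.1.1 (fixed_point_qj0 xf). Qed.

Lemma fixed_point_graded x D : fixed_point wm x -> bmx x D = 1%:M ->
  graded wm (fun p => dg wm (D p)) x.
Proof.
move=> xf xD; have [_ /(_ 2%:R)] := xf; rewrite pnatr_eq0 => /(_ isT)[g _ gh].
exact: eigen_graded xD (fixed_point_qj0 xf) gh.
Qed.

(** A change of coordinates makes D the standard basis; [gpath] then joins the point, at t = 1, to
    the monomial point, at t = 0. *)
Lemma conn_groebner x D wl wx wy : fixed_point wm x ->
  groebner_basis (mweight wl wx wy) x D -> conn wm x (pt K D).
Proof.
move=> xf gb; have [_ _ U _ _] := gb.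
set y := gl_act (invmx (bmx x D)) x.
have VU : invmx (bmx x D) \in unitmx by rewrite unitmx_inv.
apply: conn_trans (conn_gl VU xf) _; rewrite -/y.
have yf : fixed_point wm y by apply: fixed_point_gl.
have yD : bmx y D = 1%:M by apply: bmx_coord.
have gy : groebner_basis (mweight wl wx wy) y D by apply: groebner_basis_gl.
have yC := fixed_point_comm yf; have j0 := fixed_point_qj0 yf.
have yg := fixed_point_graded yf yD.
pose f (t : R) := gpath y D wl wx wy (rc t).
rewrite -(gpath1 D wl wx wy j0) -(gpath0 yD yC gy).
have -> : gpath y D wl wx wy 1 = f 1 by rewrite /f /rc rmorph1.
have -> : gpath y D wl wx wy 0 = f 0 by rewrite /f /rc rmorph0.
apply: conn_path => [|t]; last first.
  by apply: graded_fixed_point (gpath_graded _ _ _ _ _ yg); apply: gpath_stable.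
have cX k (a : K) : continuous (fun t => rc t ^+ k * a).
  by apply: continuous_expM; apply: rc_continuous.
apply: continuous_quiver; last exact: cst_continuous.
- by apply: continuous_mx => i j; rewrite /qB1 /=; under eq_fun do rewrite mxE; apply: cX.
- by apply: continuous_mx => i j; rewrite /qB2 /=; under eq_fun do rewrite mxE; apply: cX.
by apply: continuous_mx => i j; rewrite /qi /=; under eq_fun do rewrite mxE; apply: cX.
Qed.

Lemma conn_pt x : fixed_point wm x ->
  exists D, [/\ injective D, div_closed D & conn wm x (pt K D)].
Proof.
move=> xf; have [xs /(_ 2%:R)] := xf; rewrite pnatr_eq0 => /(_ isT)[g _ gh].
have gb := greedy_basis xs gh.
have [Dinj Dcl _ _ _] := gb.
by exists (tnth (Tuple (introT eqP (greedy_size xs gh)))); split=> //; apply: conn_groebner gb.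
Qed.

End RealPaths.

Section Separation.
Variable (R : realType) (r n wm : nat).
Local Notation K := (R[i] : numClosedFieldType).
Implicit Types (x y z : quiver_data K r n) (D : 'I_n -> mono r).

Let M : set (moduli K r n) := fixed_locus (subtorus 1 1 (@weight r wm)).

Definition mrank_ge (S : pred (mono r)) c : set (moduli K r n) :=
  [set u | exists x (xs : stable_locus K r n x), u = mclass xs /\ rank_ge S c x].

Lemma mrank_geP S c x (xs : stable_locus K r n x) :
  mrank_ge S c (mclass xs) <-> rank_ge S c x.
Proof.
split=> [[y [ys [/eqmodP/asboolP[g gU yE] yr]]]|xr]; last by exists x, xs.
have {}yE : y = gl_act g x := yE.
by move: yr; rewrite yE => /(rank_ge_glE _ _ _ gU).
Qed.

Lemma mrank_ge_open S c : open (mrank_ge S c).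
Proof.
suff : open ((\pi_(moduli K r n) : stable_locus K r n -> _) @^-1` mrank_ge S c) by [].
have -> : (\pi_(moduli K r n) : stable_locus K r n -> _) @^-1` mrank_ge S c =
   set_val @^-1` [set x | rank_ge S c x].
  apply/seteqP; split=> z /=.
    have zs : stable_locus K r n (set_val z) := set_valP z.
    have -> : \pi_(moduli K r n) z = mclass zs by congr (\pi_(_) _); apply: val_inj.
    by move/mrank_geP.
  move=> zr; have zs : stable_locus K r n (set_val z) := set_valP z.
  have -> : \pi_(moduli K r n) z = mclass zs by congr (\pi_(_) _); apply: val_inj.
  exact/mrank_geP.
by apply: open_comp (@rank_ge_open K r n S c) => u _; apply: initial_continuous.
Qed.

Definition deg_le (k : int) : pred (mono r) := [pred m | dg wm m <= k].
Definition deg_gt (k : int) : pred (mono r) := [pred m | k < dg wm m].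

Lemma rank_ge_pt (S : pred (mono r)) c D : injective D -> div_closed D ->
  rank_ge S c (pt K D) <-> (c <= #|[pred p | S (D p)]|)%N.
Proof.
move=> Dinj Dcl; apply: rank_ge_card (bmx_pt K Dinj Dcl) _ => m p.
rewrite uvec_pt // mxE pnatr_eq0 eqb0 negbK => /eqP -> //.
Qed.

(** A homogeneous basis is split into the degrees <= k and > k, and the two counts add up to n. *)
Lemma rank_ge_fixed k c x : (c <= n)%N -> fixed_point wm x ->
  rank_ge (deg_le k) c x <-> ~ rank_ge (deg_gt k) (n - c).+1 x.
Proof.
move=> cn xf; have [xs /(_ 2%:R)] := xf; rewrite pnatr_eq0 => /(_ isT)[g _ gh].
have := greedy_basis xs gh; set D := tnth _ => -[_ _ U _ _].
pose V := invmx (bmx x D); have VU : V \in unitmx by rewrite unitmx_inv.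
have yD := bmx_coord U; rewrite -/V in yD.
have yg := fixed_point_graded (fixed_point_gl VU xf) yD.
rewrite -(rank_ge_glE (deg_le k) _ x VU) -(rank_ge_glE (deg_gt k) _ x VU) !(rank_ge_card _ yD); last first.
- by move=> m p /(graded_uvec yg (fun=> erefl)) E; rewrite /deg_le /= E.
- by move=> m p /(graded_uvec yg (fun=> erefl)) E; rewrite /deg_gt /= E.
have := cardC [pred p | deg_le k (D p)]; rewrite card_ord.
rewrite [X in (_ + X)%N](eq_card (B := [pred p | deg_gt k (D p)])); last first.
  by move=> p; rewrite /deg_le /deg_gt !inE /= ltNge.
move: #|_| #|_| => u v E; split=> [h|/negP]; [apply/negP; lia|lia].
Qed.

(* On the fixed locus, having at least c independent monomials of degree <= k and
   having more than n - c of degree > k are complementary, and both are open. *)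
Lemma conn_sep D D' k : injective D -> div_closed D -> injective D' -> div_closed D' ->
  conn wm (pt K D) (pt K D') ->
  #|[pred p | deg_le k (D p)]| = #|[pred p | deg_le k (D' p)]|.
Proof.
suff H : forall D D', injective D -> div_closed D -> injective D' -> div_closed D' ->
    conn wm (pt K D) (pt K D') ->
    (#|[pred p | deg_le k (D p)]| <= #|[pred p | deg_le k (D' p)]|)%N.
  move=> Di Dc Di' Dc' DD'; apply/eqP.
  rewrite eqn_leq (H D D' Di Dc Di' Dc' DD').
  exact: (H D' D Di' Dc' Di Dc (conn_sym DD')).
move=> {}D {}D' Di Dc Di' Dc' [h [h' DD']]; set c := #|_|.
have cn : (c <= n)%N by rewrite /c -[X in (_ <= X)%N]card_ord max_card.
pose C := connected_component M (mclass h).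
pose O1 := mrank_ge (deg_le k) c; pose O2 := mrank_ge (deg_gt k) (n - c).+1.
have OE u : C u -> O1 u <-> ~ O2 u.
  move=> /connected_component_sub/mclass_surj[x [xs [xf ->]]].
  by rewrite /O1 /O2 !mrank_geP; apply: rank_ge_fixed.
have DO : O1 (mclass h) by apply/mrank_geP/rank_ge_pt.
have : C `&` O1 = C.
  apply: (component_connected (x := mclass h)).
  - exists (mclass h); split=> //; apply: connected_component_refl.
    by apply: mclass_fixed; apply: pt_fixed.
  - by exists O1 => //; apply: mrank_ge_open.
  exists (~` O2); first by rewrite closedC; apply: mrank_ge_open.
  by apply/seteqP; split=> u [Cu h2]; split=> //; [exact: (OE u Cu).1|exact: (OE u Cu).2].
move=> CO; have : (C `&` O1) (mclass h') by rewrite CO.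
by case=> _ /mrank_geP/rank_ge_pt; apply.
Qed.

End Separation.

(** * Lexicographic degeneration *)

(* The operator X d/dX - j kills the j-th coefficient and lowers the order of
   vanishing at -1 by at most one. *)
Lemma sparse_poly_eq0 (F : numFieldType) (N s : nat) (p u : {poly F}) :
  (size p <= N)%N -> p = u * ('X + 1) ^+ s ->
  (#|[pred i : 'I_N | (p`_i != 0)%R]| <= s)%N -> p = 0.
Proof.
elim: s p u => [|s IH] p u sp pE cp.
  apply/polyP => i; rewrite coef0; have [iN|Ni] := ltnP i N.
    apply/eqP/negPn/negP => pi; move: cp; rewrite leqn0 => /eqP/card0_eq/(_ (Ordinal iN)).
    by rewrite !inE pi.
  by rewrite nth_default // (leq_trans sp).
apply/eqP/negPn/negP => p0.
pose j := (size p).-1.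
have pj : p`_j != 0 by rewrite -[p`_j]/(lead_coef p) lead_coef_eq0.
have jN : (j < N)%N by rewrite /j; move: sp; rewrite -size_poly_gt0 in p0; lia.
pose t := 'X * p^`() - j%:R *: p.
have tE i : t`_i = (i%:R - j%:R) * p`_i.
  rewrite coefB coefZ coefXM coef_deriv; case: i => [|i] /=; first by ring.
  by rewrite -mulr_natr; ring.
have t0 : t = 0.
  apply: (IH t ('X * (u^`() * ('X + 1) + u *+ s.+1) - j%:R *: (u * ('X + 1)))).
  - apply/leq_sizeP => i Ni; rewrite tE [p`_i]nth_default ?mulr0 //.
    exact: leq_trans sp Ni.
  - rewrite /t pE derivM deriv_exp derivD derivX -polyC1 derivC addr0 polyC1 /= exprS.
    by rewrite -!mul_polyC; ring.
  rewrite -ltnS; apply: leq_trans cp; apply: proper_card; apply/properP.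
  split; last first.
    by exists (Ordinal jN); rewrite !inE // tE subrr mul0r eqxx.
  apply/fintype.subsetP => i; rewrite !inE tE mulf_eq0 negb_or => /andP[_ ->] //.
have pX : p = p`_j *: 'X^j.
  apply/polyP => i; rewrite coefZ coefXn; have := tE i; rewrite t0 coef0.
  case: eqVneq => [->|ij]; first by rewrite mulr1.
  move/esym/eqP; rewrite mulf_eq0 subr_eq0 eqr_nat (negPf ij) => /eqP ->.
  by rewrite mulr0.
have : p.[-1] = 0 by rewrite pE hornerM horner_exp hornerD hornerX hornerC addNr expr0n mulr0.
rewrite pX hornerZ hornerXn => /eqP; rewrite mulf_eq0 (negPf pj) expf_eq0 oppr_eq0.
by rewrite oner_eq0 andbF.
Qed.

Local Close Scope classical_set_scope.
Local Open Scope nat_scope.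

Section Lex.
Variables (r n : nat).
Implicit Types (m : mono r) (D : 'I_n -> mono r) (l : 'I_r).

Definition tdeg m := xdeg m + ydeg m.

Definition block D l k : {set 'I_n} := [set p | (lab (D p) == l) && (tdeg (D p) == k)].

Definition prof D l k := #|block D l k|.

Lemma mono_eq m m' : lab m = lab m' -> xdeg m = xdeg m' -> tdeg m = tdeg m' -> m = m'.
Proof.
case: m m' => [[l a] b] [[l' a'] b']; rewrite /tdeg /lab /xdeg /ydeg /=.
by move=> -> -> /addnI ->.
Qed.

Lemma in_block D p : p \in block D (lab (D p)) (tdeg (D p)).
Proof. by rewrite inE !eqxx. Qed.

Lemma xdeg_block_inj D l k : injective D -> {in block D l k &, injective (fun p => xdeg (D p))}.
Proof.
move=> Dinj p q; rewrite !inE => /andP[/eqP pl /eqP pk] /andP[/eqP ql /eqP qk] /= pq.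
by apply/Dinj/mono_eq; rewrite ?pl ?pk ?ql ?qk.
Qed.

Lemma prof_le D l k : injective D -> prof D l k <= k.+1.
Proof.
move=> Dinj; rewrite -[k.+1]card_ord /prof.
rewrite -(card_in_imset (f := fun p => inord (xdeg (D p)) : 'I_k.+1)); first exact: max_card.
move=> p q pB qB; have pk := pB; have qk := qB; rewrite !inE in pk qk.
move/(congr1 val); rewrite /= !inordK; [exact: xdeg_block_inj pB qB| |];
  [case/andP: qk|case/andP: pk] => _ /eqP; rewrite /tdeg; lia.
Qed.

Lemma div_closed_mulx D p l a b : div_closed D -> D p = (l, a.+1, b) ->
  exists q, D q = (l, a, b).
Proof. by move=> Dcl Dp; apply: (Dcl p); left. Qed.

Lemma div_closed_muly D p l a b : div_closed D -> D p = (l, a, b.+1) ->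
  exists q, D q = (l, a, b).
Proof. by move=> Dcl Dp; apply: (Dcl p); right. Qed.

Lemma mono_exp m : m = (lab m, xdeg m, ydeg m).
Proof. by case: m => [[]]. Qed.

(** A degree that is not full misses some power x^a. One degree higher, monomials with x-exponent at
    most a are divided by y and the others by x; the images lie on different sides of a, so this is
    injective. *)
Lemma prof_succ D l k : injective D -> div_closed D ->
  prof D l k.+1 <= prof D l k \/ prof D l k = k.+1.
Proof.
move=> Dinj Dcl; have [full|nfull] := eqVneq (prof D l k) k.+1; [by right|left].
have [a ak na] : exists2 a, a <= k & forall p, p \in block D l k -> xdeg (D p) != a.
  have /properP[_ [a _ na]] : [set (inord (xdeg (D p)) : 'I_k.+1) | p in block D l k]
      \proper [set: 'I_k.+1].
    rewrite properEcard finset.subsetT cardsT card_ord card_in_imset.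
      by rewrite ltn_neqAle nfull prof_le.
    move=> p q pB qB; have pk := pB; have qk := qB; rewrite !inE in pk qk.
    move/(congr1 val); rewrite /= !inordK; [exact: xdeg_block_inj pB qB| |];
     [case/andP: qk|case/andP: pk] => _ /eqP; rewrite /tdeg; lia.
  exists a; first by rewrite -ltnS.
  move=> p pB; apply: contra na => /eqP pa; apply/imsetP; exists p => //.
  by apply: val_inj; rewrite /= inordK pa.
pose down (p : 'I_n) (q : 'I_n) := D q = if xdeg (D p) <= a then (lab (D p), xdeg (D p), (ydeg (D p)).-1)
  else (lab (D p), (xdeg (D p)).-1, ydeg (D p)).
have ex p : p \in block D l k.+1 -> exists q, down p q.
  rewrite inE => /andP[_ /eqP pk]; rewrite /down; case: leqP => pa.
    have [b bE] : exists b, ydeg (D p) = b.+1 by exists (ydeg (D p)).-1; rewrite /tdeg in pk; lia.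
    rewrite bE; apply: (div_closed_muly (p := p) Dcl); by rewrite -bE -mono_exp.
  have [b bE] : exists b, xdeg (D p) = b.+1 by exists (xdeg (D p)).-1; lia.
  rewrite bE; apply: (div_closed_mulx (p := p) Dcl); by rewrite -bE -mono_exp.
pose f p := odflt p [pick q | D q == if xdeg (D p) <= a then (lab (D p), xdeg (D p), (ydeg (D p)).-1)
  else (lab (D p), (xdeg (D p)).-1, ydeg (D p))].
have fP p : p \in block D l k.+1 -> down p (f p).
  move=> /ex[q qE]; rewrite /f; case: pickP => [q' /eqP //|/(_ q)].
  by rewrite qE eqxx.
have fB p : p \in block D l k.+1 -> f p \in block D l k.
  move=> pB; have := fP p pB; rewrite /down; move: pB; rewrite !inE => /andP[/eqP pl /eqP pk] ->.
  by rewrite /tdeg in pk *; case: leqP => pa; rewrite /lab /xdeg /ydeg /= in pl pk pa *; rewrite pl eqxx /=; lia.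
rewrite /prof -(card_in_imset (f := f)).
  by apply/subset_leq_card/fintype.subsetP => _ /imsetP[p pB ->]; apply: fB.
move=> p q pB qB fpq; apply: (xdeg_block_inj Dinj pB qB) => /=.
have := fP p pB; have := fP q qB; rewrite /down fpq => -> /(congr1 (@xdeg r)).
have := na _ (fB p pB); have := na _ (fB q qB).
have := fP p pB; have := fP q qB; rewrite /down => -> ->.
by case: leqP => qa; case: leqP => pa; rewrite /xdeg /=; rewrite /xdeg in pa qa; lia.
Qed.

Definition rk D p := #|[set q in block D (lab (D p)) (tdeg (D p)) | xdeg (D q) < xdeg (D p)]|.

(* Pushes the monomials of each label and total degree to the smallest powers of
   x: the initial monomials after a generic change of y. *)
Definition lexD D p : mono r := (lab (D p), rk D p, tdeg (D p) - rk D p).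

Lemma rk_lt D p : rk D p < prof D (lab (D p)) (tdeg (D p)).
Proof.
apply: proper_card; apply/properP; split; first by apply/fintype.subsetP => q; rewrite inE => /andP[].
by exists p; rewrite ?in_block // inE ltnn andbF.
Qed.

Lemma rk_le D p : injective D -> rk D p <= tdeg (D p).
Proof. by move=> Dinj; rewrite -ltnS; apply: leq_trans (rk_lt D p) (prof_le _ _ Dinj). Qed.

Lemma lab_lexD D p : lab (lexD D p) = lab (D p). Proof. by []. Qed.

Lemma xdeg_lexD D p : xdeg (lexD D p) = rk D p. Proof. by []. Qed.

Lemma tdeg_lexD D p : injective D -> tdeg (lexD D p) = tdeg (D p).
Proof. by move=> Dinj; rewrite {1}/tdeg /xdeg /ydeg /= subnKC // rk_le. Qed.

Lemma block_lexD D l k : injective D -> block (lexD D) l k = block D l k.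
Proof. by move=> Dinj; apply/setP => p; rewrite !inE lab_lexD tdeg_lexD. Qed.

Lemma prof_lexD D l k : injective D -> prof (lexD D) l k = prof D l k.
Proof. by move=> Dinj; rewrite /prof block_lexD. Qed.

Lemma rk_mono D l k p q : p \in block D l k -> q \in block D l k ->
  xdeg (D p) < xdeg (D q) -> rk D p < rk D q.
Proof.
rewrite !inE => /andP[/eqP pl /eqP pk] /andP[/eqP ql /eqP qk] pq.
apply: proper_card; rewrite pl pk ql qk; apply/properP; split.
  by apply/fintype.subsetP => s; rewrite !inE => /andP[-> /= sp]; apply: ltn_trans pq.
by exists p; rewrite !inE pl pk !eqxx // ltnn.
Qed.

Lemma rk_inj D l k : injective D -> {in block D l k &, injective (rk D)}.
Proof.
move=> Dinj p q pB qB E; apply: (xdeg_block_inj Dinj pB qB) => /=.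
case: (ltngtP (xdeg (D p)) (xdeg (D q))) => //.
  by move/(rk_mono pB qB); rewrite E ltnn.
by move/(rk_mono qB pB); rewrite E ltnn.
Qed.

Lemma lexD_inj D : injective D -> injective (lexD D).
Proof.
move=> Dinj p q E; have pq : tdeg (D p) = tdeg (D q).
  by rewrite -tdeg_lexD // E tdeg_lexD.
have plq : lab (D p) = lab (D q) by rewrite -lab_lexD E.
apply: (rk_inj (D := D) (l := lab (D q)) (k := tdeg (D q)) Dinj).
- by rewrite -plq -pq in_block.
- exact: in_block.
by rewrite -xdeg_lexD E.
Qed.

Lemma lexDP D m : injective D ->
  (exists p, lexD D p = m) <-> xdeg m < prof D (lab m) (tdeg m).
Proof.
move=> Dinj; split=> [[p <-]|mk].
  by rewrite lab_lexD xdeg_lexD tdeg_lexD // rk_lt.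
set l := lab m in mk *; set k := tdeg m in mk *.
have cn : prof D l k <= n by rewrite -[X in _ <= X]card_ord max_card.
pose c := prof D l k.
have E : [set (inord (rk D p) : 'I_c.-1.+1) | p in block D l k] = [set: 'I_c.-1.+1].
  apply/eqP; rewrite eqEcard finset.subsetT cardsT card_ord card_in_imset; first by rewrite -/(prof D l k) /c; lia.
  move=> p q pB qB; move/(congr1 val); rewrite /= !inordK; first exact: (rk_inj Dinj pB qB).
    by move: qB; rewrite inE => /andP[/eqP ql /eqP qk]; have := rk_lt D q; rewrite ql qk -/c; lia.
  by move: pB; rewrite inE => /andP[/eqP ql /eqP qk]; have := rk_lt D p; rewrite ql qk -/c; lia.
have : (inord (xdeg m) : 'I_c.-1.+1) \in [set: 'I_c.-1.+1] by rewrite inE.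
rewrite -E => /imsetP[p pB /(congr1 val)] /=.
move: (pB); rewrite inE => /andP[/eqP pl /eqP pk].
have := rk_lt D p; rewrite pl pk -/c => pc.
rewrite !inordK; [|lia|lia] => xE; exists p; apply: mono_eq => //.
by rewrite tdeg_lexD.
Qed.

Lemma lexD_closed D : injective D -> div_closed D -> div_closed (lexD D).
Proof.
move=> Dinj Dcl p m Dp; apply/lexDP => //.
have le := prof_le (lab m) (tdeg m) Dinj.
have := prof_succ (lab m) (tdeg m) Dinj Dcl.
have /(lexDP _ Dinj) : exists q, lexD D q = lexD D p by exists p.
have xm : xdeg m <= tdeg m by rewrite leq_addr.
by case: Dp => ->; rewrite /mulx /muly /tdeg /lab /xdeg /ydeg /= in le xm *;
  rewrite ?addSn ?addnS; lia.
Qed.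

End Lex.

Local Open Scope classical_set_scope.
Local Open Scope ring_scope.

Section Shear.
Variables (K : numClosedFieldType) (r n wm : nat).
Implicit Types (x : quiver_data K r n) (m : mono r) (D : 'I_n -> mono r).

Definition shear (c : K) x : quiver_data K r n :=
  (qB1 x, qB2 x + c *: qB1 x, qi x, qj x).

Lemma shear0 x : shear 0 x = x.
Proof. by rewrite /shear scale0r addr0; case: x => [[[]]]. Qed.

Lemma qB2_shear1 x : qB2 (shear 1 x) = qB2 x + qB1 x.
Proof. by rewrite -[in RHS](scale1r (qB1 x)). Qed.

Lemma shear_stable c x : stable_locus K r n x -> stable_locus K r n (shear c x).
Proof.
move=> [xeq xst]; split.
  move: xeq; rewrite /adhm_eq /shear /qB1 /qB2 /qi /qj /= => <-.
  by rewrite mulmxDr mulmxDl -scalemxAr -scalemxAl opprD addrACA subrr addr0.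
move=> [S [SnT S1 S2 Si]]; apply: xst; exists S; split=> // v vS.
have := S2 v vS; rewrite /shear /qB2 /= mulmxDl -scalemxAl => H.
by rewrite -[_ *m v](addrK (c *: (qB1 x *m v))) memvB // memvZ // S1.
Qed.

Lemma shear_graded d c x : graded wm d x -> graded wm d (shear c x).
Proof.
move=> [g1 g2 g3 g4]; split=> // p q; rewrite /shear /qB2 /= !mxE => H.
have [b1|] := eqVneq (qB1 x p q) 0; last exact: g1.
by apply: g2; move: H; rewrite b1 mulr0 addr0.
Qed.

Lemma pt_mulx_entry D (f : mono r -> K) p : injective D -> div_closed D ->
  (qB1 (pt K D) *m \col_q f (D q)) p 0 =
  if xdeg (D p) is a.+1 then f (lab (D p), a, ydeg (D p)) else 0.
Proof.
move=> Dinj Dcl; rewrite !mxE; case E : (xdeg (D p)) => [|a].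
  rewrite big1 // => q _; rewrite !mxE; case: eqP => [Dp|]; last by rewrite mul0r.
  by rewrite Dp in E.
have [q Dq] := div_closed_mulx (p := p) Dcl (etrans (mono_exp (D p)) (congr1 (fun a => (_, a, _)) E)).
have pq : D p = mulx (D q) by rewrite Dq /mulx /lab /xdeg /ydeg /= (mono_exp (D p)) -E.
rewrite (bigD1 q) //= !mxE pq eqxx mul1r Dq big1 ?addr0 // => k kq.
rewrite !mxE pq; case: eqP => [/mulx_inj/Dinj E'|]; last by rewrite mul0r.
by rewrite E' eqxx in kq.
Qed.

Lemma pt_muly_entry D (f : mono r -> K) p : injective D -> div_closed D ->
  (qB2 (pt K D) *m \col_q f (D q)) p 0 =
  if ydeg (D p) is b.+1 then f (lab (D p), xdeg (D p), b) else 0.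
Proof.
move=> Dinj Dcl; rewrite !mxE; case E : (ydeg (D p)) => [|b].
  rewrite big1 // => q _; rewrite !mxE; case: eqP => [Dp|]; last by rewrite mul0r.
  by rewrite Dp in E.
have [q Dq] := div_closed_muly (p := p) Dcl (etrans (mono_exp (D p)) (congr1 (fun b => (_, _, b)) E)).
have pq : D p = muly (D q) by rewrite Dq /muly /lab /xdeg /ydeg /= (mono_exp (D p)) -E.
rewrite (bigD1 q) //= !mxE pq eqxx mul1r Dq big1 ?addr0 // => k kq.
rewrite !mxE pq; case: eqP => [/muly_inj/Dinj E'|]; last by rewrite mul0r.
by rewrite E' eqxx in kq.
Qed.

(** The dehomogenisation at y = 1 of x^a (x + y)^b, into which the shear turns x^a y^b; its
    coefficients are coordinates in the old monomials. *)
Definition shear_poly m : {poly K} := 'X^(xdeg m) * ('X + 1) ^+ ydeg m.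

Definition shear_coef m m' : K :=
  ((lab m' == lab m) && (tdeg m' == tdeg m))%:R * (shear_poly m)`_(xdeg m').

Lemma size_shear_poly m : (size (shear_poly m) <= (tdeg m).+1)%N.
Proof.
apply: leq_trans (size_polyMleq _ _) _; rewrite size_polyXn.
by have := size_poly_exp_leq ('X + 1 : {poly K}) (ydeg m); rewrite -polyC1 size_XaddC /tdeg; lia.
Qed.

Lemma uvec_shear_pt D m : injective D -> div_closed D ->
  uvec (shear 1 (pt K D)) m = \col_p shear_coef m (D p).
Proof.
move=> Dinj Dcl; case: m => -[l a] b; elim: a => [|a IH]; last first.
  rewrite -[(l, a.+1, b)]/(mulx (l, a, b)) uvec_mulx IH; apply/colP => p.
  rewrite [LHS]pt_mulx_entry // mxE /shear_coef /shear_poly /tdeg /mulx /lab /xdeg /ydeg /=.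
  rewrite exprS -mulrA coefXM; case: (D p) => -[l' [|a']] b' /=; first by rewrite mulr0.
  by rewrite eqSS.
elim: b => [|b IH].
  apply/colP => p; rewrite /uvec /= !mxE /shear_coef /shear_poly /tdeg /lab /xdeg /ydeg /=.
  rewrite expr0 mulr1 coef1; case: (D p) => -[l' a'] b' /=.
  rewrite -natrM mulnb /gen !xpair_eqE addn0 addn_eq0.
  by congr (nat_of_bool _)%:R; case: (l' == l) => //=; case: a'; case: b'.
rewrite -[(l, 0%N, b.+1)]/(muly (l, 0%N, b)) uvec_muly; last first.
  rewrite /qcomm /shear /qB1 /qB2 /= mulmxDr mulmxDl -scalemxAr -scalemxAl.
  by congr (_ + _); apply: pt_comm.
rewrite IH; apply/colP => p.
rewrite qB2_shear1 mulmxDl [LHS]mxE.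
rewrite (pt_mulx_entry (shear_coef (l, 0%N, b))) //.
rewrite (pt_muly_entry (shear_coef (l, 0%N, b))) // mxE.
have := size_shear_poly (l, 0%N, b).
rewrite /shear_coef /shear_poly /tdeg /muly /lab /xdeg /ydeg /= expr0 !mul1r add0n.
rewrite exprSr; set P := ('X + 1) ^+ b => sP; rewrite mulrDr mulr1 coefD coefMX.
case: (D p) => -[l' [|a']] [|b'] /=; rewrite ?addn0 ?add0n ?addnS ?addSn ?eqSS ?addr0 ?add0r //.
- by rewrite andbF mul0r.
- case: (a' =P b) => [->|]; last by rewrite andbF !mul0r.
  by rewrite [P`_b.+1]nth_default // addr0.
by rewrite mulrDr addrC.
Qed.

End Shear.

Section LexDegeneration.
Variables (K : numClosedFieldType) (r n wm : nat).
Variable D : 'I_n -> mono r.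
Hypotheses (Dinj : injective D) (Dcl : div_closed D).
Let X := shear 1 (pt K D).
Let E := lexD D.
Implicit Types (m : mono r).

Lemma bmx_shear p q : bmx X E p q = shear_coef K (E q) (D p).
Proof. by rewrite mxE uvec_shear_pt // mxE. Qed.

Lemma shear_coef_lex p q l k : p \in block D l k ->
  shear_coef K (E q) (D p) =
  if q \in block D l k then (shear_poly K (E q))`_(xdeg (D p)) else 0.
Proof.
rewrite !inE => /andP[/eqP pl /eqP pk]; rewrite /shear_coef pl pk lab_lexD tdeg_lexD //.
by rewrite ![_ == lab _]eq_sym ![_ == tdeg (D q)]eq_sym; case: andP => _; rewrite ?mul1r ?mul0r.
Qed.

(* A combination of x^a (x + 1)^(k - a), a < c, is divisible by (x + 1)^(k - c + 1);
   vanishing at c exponents, it has too few coefficients to be nonzero. *)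
Lemma lex_comb_eq0 (v : 'I_n -> K) l k :
  (forall p, p \in block D l k ->
     \sum_(q in block D l k) v q * (shear_poly K (E q))`_(xdeg (D p)) = 0) ->
  forall q, q \in block D l k -> v q = 0.
Proof.
move=> v0 q0 q0B; set B := block D l k in v0 q0B *; pose c := prof D l k.
have rkc q : q \in B -> (rk D q < c)%N /\ (rk D q <= k)%N.
  rewrite inE => /andP[/eqP ql /eqP qk]; rewrite /c -{1}ql -qk; split; [exact: rk_lt|exact: rk_le].
have ck : (c <= k.+1)%N := prof_le l k Dinj.
pose Q := \sum_(q in B) v q *: shear_poly K (E q).
have Qc i : Q`_i = \sum_(q in B) v q * (shear_poly K (E q))`_i.
  by rewrite coef_sum; apply: eq_bigr => q _; rewrite coefZ.
have Ek q : q \in B -> tdeg (E q) = k by rewrite tdeg_lexD // inE => /andP[_ /eqP].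
have Q0 : Q = 0.
  apply: (@sparse_poly_eq0 _ k.+1 (k.+1 - c) _
    (\sum_(q in B) v q *: ('X^(rk D q) * ('X + 1) ^+ (c.-1 - rk D q)))).
  - apply: (leq_trans (size_sum _ _ _)); apply/bigmax_leqP => q qB.
    apply: (leq_trans (size_scale_leq _ _)).
    by apply: leq_trans (size_shear_poly _ _) _; rewrite Ek.
  - rewrite mulr_suml; apply: eq_bigr => q qB; rewrite -scalerAl -mulrA -exprD.
    have [h1 h2] := rkc q qB; rewrite /shear_poly xdeg_lexD; congr (_ *: (_ * _ ^+ _)).
    by have := Ek q qB; rewrite /tdeg xdeg_lexD; lia.
  have cB : #|[pred i : 'I_k.+1 | i \in [set (inord (xdeg (D p)) : 'I_k.+1) | p in B]%SET]| = c.
    rewrite (eq_card (B := mem [set (inord (xdeg (D p)) : 'I_k.+1) | p in B]%SET)) //.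
    rewrite card_in_imset // => p q pB qB.
    have pk := pB; have qk := qB; rewrite !inE in pk qk.
    move/(congr1 val); rewrite /= !inordK; [exact: xdeg_block_inj pB qB| |];
      [case/andP: qk|case/andP: pk] => _ /eqP; rewrite /tdeg; lia.
  rewrite -cB -[X in (_ <= X - _)%N]card_ord.
  rewrite -(cardC [pred i : 'I_k.+1 | i \in [set (inord (xdeg (D p)) : 'I_k.+1) | p in B]%SET]) addKn.
  apply/subset_leq_card/fintype.subsetP => i; rewrite !inE; apply: contraNN => /imsetP[p pB ->].
  rewrite inordK ?Qc ?v0 ?eqxx //.
  by move: pB; rewrite inE => /andP[_ /eqP]; rewrite /tdeg; lia.
apply/eqP/negPn/negP => vq0.
pose P := [pred q | (q \in B) && (v q != 0)].
have Pq0 : P q0 by rewrite /= q0B.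
case: (arg_minnP (fun q => rk D q) Pq0) => q /= /andP[qB vq] qmin.
have := Qc (rk D q); rewrite Q0 coef0 (bigD1 q) //= big1 => [|s /andP[sB sq]].
  rewrite /shear_poly xdeg_lexD addr0 coefXnM ltnn subnn -horner_coef0.
  rewrite horner_exp !hornerE expr1n mulr1 => /esym/eqP; by rewrite (negPf vq).
have [->|vs] := eqVneq (v s) 0; first by rewrite mul0r.
have := qmin s; rewrite sB vs => /(_ isT); rewrite leq_eqVlt => /orP[/eqP/(rk_inj Dinj qB sB) qs|lt].
  by rewrite qs eqxx in sq.
by rewrite /shear_poly xdeg_lexD coefXnM lt mulr0.
Qed.

Lemma lex_unit : bmx X E \in unitmx.
Proof.
rewrite -unitmx_tr unitmxE unitfE; apply/negP => /det0P[v v0 vU].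
move/eqP: v0; apply; apply/rowP => q; rewrite [RHS]mxE.
apply: (lex_comb_eq0 (v := fun q => v 0 q) _ (in_block D q)) => p pB.
have := congr1 (fun A : 'rV_n => A 0 p) vU; rewrite !mxE => s0; rewrite -[RHS]s0.
rewrite big_mkcond; apply: eq_bigr => s _; rewrite mxE bmx_shear (shear_coef_lex _ pB).
by case: ifP => _; rewrite ?mulr0.
Qed.

(** The shear preserves label and total degree, so a monomial is expanded within its own block.
    There the basis monomials have x-degree below [prof], hence below that of any monomial outside
    the basis. *)
Lemma lex_reducible m : reducible (mweight (fun=> 0%N) 1 0) X E m.
Proof.
have [mE|mE] := ltnP (xdeg m) (prof D (lab m) (tdeg m)).
  by left; apply/lexDP.
right; set l := lab m in mE *; set k := tdeg m in mE *.
pose c := invmx (bmx X E) *m uvec X m.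
pose c' : 'cV[K]_n := \col_q (if q \in block D l k then c q 0 else 0).
exists c'; last first.
  move=> q; rewrite mxE; case: ifP => [qB _|_]; last by rewrite eqxx.
  have := rk_lt D q; move: qB; rewrite inE => /andP[/eqP -> /eqP ->].
  by rewrite /mweight xdeg_lexD; lia.
have cE : uvec X m = bmx X E *m c by rewrite mulmxA mulmxV ?lex_unit // mul1mx.
apply/colP => p; have [pB|pB] := boolP (p \in block D l k).
  rewrite cE [LHS]mxE [RHS]mxE; apply: eq_bigr => q _.
  rewrite [c' q 0]mxE bmx_shear (shear_coef_lex _ pB).
  by case: ifP => // _; rewrite !mul0r.
rewrite uvec_shear_pt // [LHS]mxE [RHS]mxE /shear_coef.
have -> : (lab (D p) == lab m) && (tdeg (D p) == tdeg m) = false.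
  by apply: contraNF pB; rewrite inE.
rewrite mul0r big1 // => q _; rewrite [c' q 0]mxE bmx_shear; case: ifP => qB; last by rewrite mulr0.
rewrite /shear_coef lab_lexD tdeg_lexD //.
move: qB; rewrite inE => /andP[/eqP -> /eqP ->].
have -> : (lab (D p) == l) && (tdeg (D p) == k) = false.
  by apply: contraNF pB; rewrite inE.
by rewrite !mul0r.
Qed.

Lemma lex_groebner : groebner_basis (mweight (fun=> 0%N) 1 0) X E.
Proof.
split; [exact: lexD_inj|exact: lexD_closed|exact: lex_unit| |].
  by move=> q; split; apply: lex_reducible.
by move=> l; apply: lex_reducible.
Qed.

End LexDegeneration.

(** * Transfer of monomials between labels *)

Section Transfer.
Variables (r n wm : nat) (l l' : 'I_r) (D : 'I_n -> mono r).
Implicit Types m : mono r.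

(* The difference of the weights of the generators l and l'. *)
Definition wgap : nat := ((l < wm) && (wm <= l'))%N.

Definition inD m := [exists p, D p == m].

(** After the change of generators the vector of x^a y^b e_l' gains that of x^a y^(b + gap) e_l. If
    the former vanished, the monomial of label l' can take the place of that of label l. *)
Definition moved m :=
  [&& lab m == l, (wgap <= ydeg m)%N & ~~ inD (l', xdeg m, (ydeg m - wgap)%N)].

Definition transfer m : mono r :=
  if moved m then (l', xdeg m, (ydeg m - wgap)%N) else m.

Let T p := transfer (D p).

Hypotheses (Dinj : injective D) (Dcl : div_closed D) (ll' : l != l').

Lemma inDP m : reflect (exists p, D p = m) (inD m).
Proof.
by apply: (iffP fintype.existsP) => -[p pm]; exists p; [apply/eqP|rewrite pm].
Qed.

Lemma inD_D p : inD (D p).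
Proof. by apply/inDP; exists p. Qed.

Lemma transfer_inj : injective T.
Proof.
have H p q : moved (D p) -> ~~ moved (D q) -> T p <> T q.
  rewrite /T /transfer => pM qM; rewrite pM (negPf qM) => E.
  by case/and3P: pM => _ _; rewrite E inD_D.
move=> p q; have [pM|pM] := boolP (moved (D p)); have [qM|qM] := boolP (moved (D q)).
- rewrite /T /transfer pM qM; case/and3P: pM => /eqP pl pd _; case/and3P: qM => /eqP ql qd _.
  case=> E1 E2; apply: Dinj; rewrite (mono_exp (D p)) (mono_exp (D q)) pl ql.
  by congr (_, _, _) => //; rewrite -(subnK pd) E2 subnK.
- by move=> E; case: (H p q pM qM).
- by move=> E; case: (H q p qM pM).
by rewrite /T /transfer (negPf pM) (negPf qM) => /Dinj.
Qed.

Definition in_transfer m :=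
  if lab m == l then inD m && ~~ moved m
  else inD m || (lab m == l') && inD (l, xdeg m, (ydeg m + wgap)%N).

Lemma in_transferP m : (exists p, T p = m) <-> in_transfer m.
Proof.
rewrite /T /transfer; split=> [[p]|].
  case: ifP => [pM <-|pM <-]; rewrite /in_transfer; last first.
    by rewrite pM inD_D; case: ifP.
  case/and3P: pM => /eqP pl pd _; rewrite eq_sym (negPf ll') eqxx /=.
  by rewrite /xdeg /ydeg /= subnK // -/(xdeg _) -/(ydeg _) -pl -mono_exp inD_D orbT.
rewrite /in_transfer; case: ifP => [_ /andP[/inDP[p <-] pM]|ml].
  by exists p; rewrite (negPf pM).
have [/inDP[p pm] _|nm /= /andP[/eqP ml' /inDP[p pm]]] := boolP (inD m).
  exists p; rewrite pm; case: ifP => // /andP[/eqP ml0].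
  by rewrite ml0 eqxx in ml.
have mE : (l', xdeg m, ydeg m) = m by rewrite -ml' -mono_exp.
exists p; rewrite pm /moved /lab /xdeg /ydeg /= eqxx leq_addl addnK.
by rewrite -/(xdeg m) -/(ydeg m) mE nm.
Qed.

Lemma inD_mulx k a b : inD (k, a.+1, b) -> inD (k, a, b).
Proof. by move=> /inDP[p /(div_closed_mulx Dcl) ?]; apply/inDP. Qed.

Lemma inD_muly k a b : inD (k, a, b.+1) -> inD (k, a, b).
Proof. by move=> /inDP[p /(div_closed_muly Dcl) ?]; apply/inDP. Qed.

Lemma transfer_closed : div_closed T.
Proof.
move=> p m Tp; apply/in_transferP; have : in_transfer (T p) by apply/in_transferP; exists p.
case: m Tp => -[k a] b [] ->; rewrite /in_transfer /moved /mulx /muly /lab /xdeg /ydeg /=.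
  case: ifP => [kl|_].
    move=> /andP[/inD_mulx -> /=]; rewrite kl /=; apply: contra => /andP[-> /=].
    by apply: contra => /inD_mulx.
  by case/orP=> [/inD_mulx ->//|/andP[-> /inD_mulx ->]]; rewrite orbT.
case: ifP => [kl|_].
  move=> /andP[/inD_muly -> /=]; rewrite kl /=; apply: contra => /andP[gb nD].
  rewrite (leqW gb) /=; apply: contra nD; rewrite subSn //; exact: inD_muly.
by case/orP=> [/inD_muly ->//|/andP[-> /inD_muly ->]]; rewrite orbT.
Qed.

End Transfer.

Section GeneratorShear.
Variables (K : numClosedFieldType) (r n wm : nat).
Implicit Types (x : quiver_data K r n) (m : mono r) (D : 'I_n -> mono r).

Definition gshear (c : K) (v : 'cV[K]_n) (l' : 'I_r) x : quiver_data K r n :=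
  (qB1 x, qB2 x, qi x + c *: (v *m delta_mx 0 l'), qj x).

Lemma gshear0 v l' x : gshear 0 v l' x = x.
Proof. by rewrite /gshear scale0r addr0; case: x => [[[]]]. Qed.

Lemma gshear_stable c l l' b x : l != l' -> qj x = 0 -> stable_locus K r n x ->
  stable_locus K r n (gshear c (uvec x (l, 0%N, b)) l' x).
Proof.
move=> ll' j0 [xeq xst]; split.
  by move: xeq; rewrite /adhm_eq -[qj (gshear _ _ _ _)]/(qj x) j0 !mulmx0.
move=> [S [SnT S1 S2 Si]]; apply: xst; exists S; split=> //.
have colS k : k != l' -> col k (qi x) \in S.
  move=> kl; have := Si (delta_mx k 0); rewrite /gshear /qi /= mulmxDl -colE.
  by rewrite -scalemxAl -mulmxA mul_delta_mx_0 1?eq_sym // mulmx0 scaler0 addr0.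
have uS : uvec x (l, 0%N, b) \in S.
  by rewrite /uvec /=; elim: (b) => [|d IH] /=; [apply: colS|apply: S2].
move=> u; rewrite mulmx_sum_col; apply: rpred_sum => k _; apply: rpredZ.
have [->|/colS//] := eqVneq k l'.
have := Si (delta_mx l' 0); rewrite /gshear /qi /= mulmxDl -colE.
rewrite -scalemxAl -mulmxA mul_delta_mx => H.
rewrite -[col _ _](addrK (c *: (uvec x (l, 0%N, b) *m delta_mx 0 0))) memvB // memvZ //.
have -> : delta_mx 0 0 = 1%:M :> 'M[K]_1 by apply/matrixP => i j; rewrite !ord1 !mxE.
by rewrite mulmx1.
Qed.

Lemma gshear_graded d c (v : 'cV[K]_n) l' x : graded wm d x ->
  (forall p, v p 0 != 0 -> d p = - weight wm l') -> graded wm d (gshear c v l' x).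
Proof.
move=> [g1 g2 g3 g4] vd; split=> // p k; rewrite /gshear /qi /= !mxE big_ord1 !mxE eqxx /= => H.
have [i0|] := eqVneq (qi x p k) 0; last exact: g3.
move: H; rewrite i0 add0r; case: (k =P l') => [->|_]; last by rewrite !mulr0 eqxx.
by rewrite mulr1 mulf_eq0 negb_or => /andP[_ /vd].
Qed.

Lemma uvec_gshear l l' b x m : qcomm x ->
  uvec (gshear 1 (uvec x (l, 0%N, b)) l' x) m =
  uvec x m + (lab m == l')%:R *: uvec x (l, xdeg m, (ydeg m + b)%N).
Proof.
move=> xC; case: m => -[k a] d; set y := gshear _ _ _ _.
have yC : qcomm y by [].
elim: a => [|a IH]; last first.
  rewrite -[(k, a.+1, d)]/(mulx (k, a, d)) !uvec_mulx IH mulmxDr -scalemxAr.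
  by rewrite -uvec_mulx.
elim: d => [|d IH]; last first.
  rewrite -[(k, 0%N, d.+1)]/(muly (k, 0%N, d)) !uvec_muly // IH mulmxDr -scalemxAr.
  by rewrite -uvec_muly.
rewrite /lab /xdeg /ydeg /= add0n /y /uvec /gshear /lab /xdeg /ydeg /=.
apply/colP => p; rewrite /qi /= !mxE big_ord1 mxE eqxx mul1r /=.
by rewrite mulrC.
Qed.

End GeneratorShear.

Section TransferDegeneration.
Variables (K : numClosedFieldType) (r n wm : nat) (l l' : 'I_r) (D : 'I_n -> mono r).
Hypotheses (Dinj : injective D) (Dcl : div_closed D) (ll' : l != l').
Let d := wgap wm l l'.
Let T p := transfer wm l l' D (D p).
Let X := gshear 1 (uvec (pt K D) (l, 0%N, d)) l' (pt K D).
Implicit Types m : mono r.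

Let uX m p : uvec X m p 0 = (D p == m)%:R +
  ((lab m == l') && (D p == (l, xdeg m, (ydeg m + d)%N)))%:R.
Proof.
rewrite uvec_gshear; last exact: pt_comm.
by rewrite !uvec_pt // !mxE -natrM mulnb.
Qed.

Let N : 'M[K]_n := \matrix_(p, q) ((lab (D q) == l') && (D p == (l, xdeg (D q), (ydeg (D q) + d)%N)))%:R.

Lemma bmx_transfer : bmx X T = 1%:M + N.
Proof.
apply/matrixP => p q; rewrite !mxE uX /T /transfer; case: ifP => qM; last first.
  by rewrite (inj_eq Dinj).
case/and3P: qM => /eqP ql qd nD; rewrite /lab /xdeg /ydeg /= eqxx subnK //.
rewrite -/(xdeg (D q)) -/(ydeg (D q)) -/(lab (D q)) ql (negPf ll') /= addr0.
have -> : (l, xdeg (D q), ydeg (D q)) = D q by rewrite -[in LHS]ql -mono_exp.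
rewrite (inj_eq Dinj).
by case: eqP => [Dp|_]; [move: nD; rewrite -Dp inD_D|rewrite add0r].
Qed.

Lemma transfer_unit : bmx X T \in unitmx.
Proof.
(* N maps label l' to label l and kills the rest, so 1 - N inverts 1 + N. *)
have NN : N *m N = 0.
  apply/matrixP => p q; rewrite !mxE big1 // => k _; rewrite !mxE.
  case: (eqVneq (D k)) => [->|]; last by rewrite andbF mulr0.
  by rewrite /lab /= (negPf ll') mul0r.
have /mulmx1_unit[] // : bmx X T *m (1%:M - N) = 1%:M.
by rewrite bmx_transfer mulmxBr mulmx1 mulmxDl mul1mx NN addr0 addrK.
Qed.

Let zero_reducible wt m : uvec X m = 0 -> reducible wt X T m.
Proof.
move=> u0; right; exists 0; first by rewrite u0 mulmx0.
by move=> p; rewrite mxE eqxx.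
Qed.

(** Label l weighs 1 and the others 0: a moved monomial has the same vector as its image of label
    l', which is lighter. Every other monomial outside the new basis vanishes. *)
Lemma transfer_reducible m : reducible (mweight (fun k => (k == l) : nat) 0 0) X T m.
Proof.
have [/in_transferP mT|nT] := boolP (in_transfer wm l l' D m); first by left; apply: mT.
have [ml|ml] := eqVneq (lab m) l.
  have uE p : uvec X m p 0 = (D p == m)%:R by rewrite uX ml (negPf ll') addr0.
  have [/inDP[q qm]|nD] := boolP (inD D m); last first.
    apply: zero_reducible; apply/colP => p; rewrite uE mxE.
    by case: eqP => // pm; move: nD; rewrite -pm inD_D.
  have qM : moved wm l l' D m.
    by move: nT; rewrite /in_transfer ml eqxx -qm inD_D negbK.
  right; exists (delta_mx q 0); last first.
    move=> p; rewrite mxE andbT; case: (eqVneq p q) => [-> _|]; last by rewrite eqxx.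
    rewrite /mweight /T /transfer qm qM {1}/lab /= ml eqxx eq_sym (negPf ll').
    by rewrite !mul0n.
  rewrite -colE bmx_transfer; apply/colP => p; rewrite uE !mxE -qm (inj_eq Dinj).
  by rewrite qm ml (negPf ll') addr0.
apply: zero_reducible; apply/colP => p; rewrite uX mxE.
move: nT; rewrite /in_transfer (negPf ml) negb_or => /andP[nD nl].
case: eqP => [pm|_]; first by move: nD; rewrite -pm inD_D.
rewrite add0r; case: andP => // -[ml' /eqP pm].
by move: nl; rewrite ml' -/d -pm inD_D.
Qed.

Lemma transfer_groebner :
  groebner_basis (mweight (fun k => (k == l) : nat) 0 0) X T.
Proof.
split; [exact: transfer_inj|exact: transfer_closed|exact: transfer_unit| |].
  by move=> q; split; apply: transfer_reducible.
by move=> k; apply: transfer_reducible.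
Qed.

End TransferDegeneration.

Lemma continuous_affine (T : topologicalType) (K : numFieldType) (f : T -> K) (a b : K) :
  continuous f -> continuous (fun t => a + f t * b).
Proof.
move=> cf t; have := @continuous_expM _ _ f 1 b cf.
rewrite (_ : (fun t => f t ^+ 1 * b) = fun t => f t * b) // => cb.
exact: (@continuousD _ _ _ (fun=> a) _ t (@cst_continuous _ _ a t) (cb t)).
Qed.

(** * Reindexing, exchange of x and y, and normal position *)

Section Permutation.
Variables (K : numClosedFieldType) (r n : nat) (D D' : 'I_n -> mono r).
Hypotheses (Dinj : injective D) (Dcl : div_closed D).
Hypotheses (D'inj : injective D') (DD' : forall m, inD D m = inD D' m).

(** Monomials outside the common set vanish, so the reordered basis needs no reduction, whatever the
    weight. *)
Lemma perm_groebner wt : groebner_basis wt (pt K D) D'.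
Proof.
have red m : reducible wt (pt K D) D' m.
  have [/inDP mD|nD] := boolP (inD D' m); [by left|right; exists 0].
    rewrite uvec_pt // mulmx0; apply/colP => p; rewrite !mxE.
    by case: eqP => // pm; move: nD; rewrite -DD' -pm inD_D.
  by move=> p; rewrite mxE eqxx.
split=> //.
- move=> p m D'p; have /inDP[q Dq] : inD D (D' p) by rewrite DD' inD_D.
  have [q' q'm] : exists q', D q' = m by apply: (@Dcl q); rewrite Dq.
  by apply/inDP; rewrite -DD' -q'm inD_D.
- pose A := bmx (pt K D) D'.
  have /mulmx1_unit[] // : A *m A^T = 1%:M.
  apply/matrixP => p p'; rewrite [LHS]mxE [RHS]mxE.
  have /inDP[q qp] : inD D' (D p) by rewrite -DD' inD_D.
  have AE i k : A i k = (D i == D' k)%:R by rewrite !mxE uvec_pt // mxE.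
  rewrite (bigD1 q) //= [A^T _ _]mxE !AE qp eqxx mul1r (inj_eq Dinj) eq_sym.
  rewrite big1 ?addr0 // => k kq.
  by rewrite AE -qp (inj_eq D'inj) eq_sym (negPf kq) mul0r.
Qed.

End Permutation.

Section Swap.
Variables (r n : nat) (l' : 'I_r) (D : 'I_n -> mono r).
Hypotheses (Dinj : injective D) (Dcl : div_closed D).
Implicit Types m : mono r.

(** Applied after [lexD], it pushes the monomials of the single label l' to the smallest powers of y
    instead. *)
Definition swap_label m : mono r :=
  if lab m == l' then (lab m, ydeg m, xdeg m) else m.

Let S p := swap_label (lexD D p).

Lemma lab_swap m : lab (swap_label m) = lab m.
Proof. by rewrite /swap_label; case: ifP. Qed.

Lemma tdeg_swap m : tdeg (swap_label m) = tdeg m.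
Proof. by rewrite /swap_label; case: ifP => // _; rewrite /tdeg addnC. Qed.

Lemma swapK m : swap_label (swap_label m) = m.
Proof.
case: m => -[l a] b; rewrite /swap_label /lab /xdeg /ydeg /=.
by case E : (l == l'); rewrite /= E.
Qed.

Lemma swap_lex_inj : injective S.
Proof. by move=> p q /(can_inj swapK)/(lexD_inj Dinj). Qed.

Lemma prof_swap_lex l k : prof S l k = prof D l k.
Proof.
rewrite -(prof_lexD l k Dinj); apply: eq_card => p.
by rewrite !inE /S lab_swap tdeg_swap.
Qed.

Lemma swap_lexP m : (exists p, S p = m) <->
  ((if lab m == l' then ydeg m else xdeg m) < prof D (lab m) (tdeg m))%N.
Proof.
have -> : (exists p, S p = m) <-> exists p, lexD D p = swap_label m.
  by split=> -[p pm]; exists p; [rewrite -pm swapK|rewrite /S pm swapK].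
rewrite (lexDP _ Dinj) lab_swap tdeg_swap.
by rewrite /swap_label; case: ifP.
Qed.

Lemma swap_lex_closed : div_closed S.
Proof.
move=> p m Sp; apply/swap_lexP.
have le := prof_le (lab m) (tdeg m) Dinj.
have := prof_succ (lab m) (tdeg m) Dinj Dcl.
have /swap_lexP : exists q, S q = S p by exists p.
have xm : (xdeg m <= tdeg m)%N by rewrite leq_addr.
have ym : (ydeg m <= tdeg m)%N by rewrite leq_addl.
by case: Sp => ->; rewrite /mulx /muly /tdeg /lab /xdeg /ydeg /= in le xm ym *;
  case: ifP => _; rewrite ?addSn ?addnS; lia.
Qed.

End Swap.

Section Normalisation.
Variables (R : realType) (r n wm : nat).
Local Notation K := (R[i] : numClosedFieldType).
Implicit Types (D : 'I_n -> mono r).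

Lemma conn_lexD D : injective D -> div_closed D ->
  conn wm (pt K D) (pt K (lexD D)).
Proof.
move=> Dinj Dcl; have Df := pt_fixed R wm Dinj Dcl.
have sf c : fixed_point wm (shear c (pt K D)).
  apply: graded_fixed_point (shear_stable c Df.1) (shear_graded c (pt_graded K wm D)).
apply: conn_trans (conn_groebner (sf 1) (lex_groebner K Dinj Dcl)).
pose f (t : R) := shear (rc t) (pt K D).
have -> : pt K D = f 0 by rewrite /f /rc rmorph0 shear0.
have -> : shear 1 (f 0) = f 1 by rewrite /f /rc rmorph0 rmorph1 shear0.
apply: conn_path => [|t]; last exact: sf.
apply: continuous_quiver; [exact: cst_continuous| |exact: cst_continuous|exact: cst_continuous].
apply: continuous_mx => i j.
have -> : (fun t => qB2 (f t) i j) = (fun t => qB2 (pt K D) i j + rc t * qB1 (pt K D) i j).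
  by apply/funext => t; rewrite {1}/qB2 /= mxE [X in _ + X]mxE.
exact/continuous_affine/rc_continuous.
Qed.

(** The first m weights are 1 and the others 0, so for l < l' the gap is a natural number and y^gap
    e_l is homogeneous of the degree of e_l'. Adding it to that generator therefore stays in the
    fixed locus. *)
Lemma weight_gap (l l' : 'I_r) : (l < l')%N -> weight wm l - weight wm l' = (wgap wm l l')%:Z.
Proof.
move=> ll'; rewrite /weight /wgap; case: (ltnP l wm) => lw; case: (ltnP l' wm) => lw' //=.
by have := leq_trans lw (ltnW ll'); have := ltn_trans ll' lw'; lia.
Qed.

Lemma conn_transfer D (l l' : 'I_r) : injective D -> div_closed D -> (l < l')%N ->
  conn wm (pt K D) (pt K (fun p => transfer wm l l' D (D p))).
Proof.
move=> Dinj Dcl ll'; have Df := pt_fixed R wm Dinj Dcl.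
have lnl : l != l' by rewrite -val_eqE /= ltn_eqF.
set v := uvec (pt K D) (l, 0%N, wgap wm l l').
have sf c : fixed_point wm (gshear c v l' (pt K D)).
  apply: graded_fixed_point (gshear_stable c _ lnl _ Df.1) (gshear_graded c (pt_graded K wm D) _) => //.
  move=> p; rewrite /v uvec_pt // mxE pnatr_eq0 eqb0 negbK => /eqP ->.
  rewrite /dg /lab /xdeg /ydeg /= add0n -(weight_gap ll'); lia.
have C := conn_groebner (sf 1) (transfer_groebner K wm Dinj Dcl lnl).
apply: conn_trans C.
pose f (t : R) := gshear (rc t) v l' (pt K D).
have f0 : pt K D = f 0 by rewrite /f /rc rmorph0 gshear0.
have f1 : gshear 1 v l' (pt K D) = f 1.
  by congr (gshear _ _ _ _); rewrite /rc rmorph1.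
rewrite f1 {1}f0; apply: conn_path => [|t]; last exact: sf.
apply: continuous_quiver; [exact: cst_continuous|exact: cst_continuous| |exact: cst_continuous].
apply: continuous_mx => i j.
have -> : (fun t => qi (f t) i j) =
    (fun t => qi (pt K D) i j + rc t * (v *m delta_mx 0 l') i j).
  by apply/funext => t; rewrite {1}/qi /= mxE [X in _ + X]mxE.
exact/continuous_affine/rc_continuous.
Qed.

Lemma conn_perm D D' : injective D -> div_closed D -> injective D' ->
  (forall m, inD D m = inD D' m) -> conn wm (pt K D) (pt K D').
Proof.
move=> Dinj Dcl D'inj DD'; apply: (@conn_groebner _ _ _ _ _ _ (fun=> 0%N) 0 0).
  exact: pt_fixed.
exact: perm_groebner.
Qed.

(** Degree k at label l and degree k - gap at label l' belong to the same graded piece: in each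
    piece a lower label is used only when the higher ones are full. *)
Definition normal D : Prop := forall (l l' : 'I_r) k, (l < l')%N -> (wgap wm l l' <= k)%N ->
  prof D l k = 0%N \/ prof D l' (k - wgap wm l l')%N = (k - wgap wm l l').+1%N.

(* Where normality fails at (l, l', k), push the monomials of label l' towards powers
   of x instead: then y^(k - gap) e_l' is missing, and y^k e_l moves there. *)
Lemma label_step D : injective D -> div_closed D -> ~ normal D -> exists D',
  [/\ injective D', div_closed D', conn wm (pt K D) (pt K D')
    & (\sum_p lab (D p) < \sum_p lab (D' p))%N].
Proof.
move=> Dinj Dcl nD.
have [l [l' [k [ll' gk pk pk']]]] : exists (l l' : 'I_r) k, [/\ (l < l')%N,
    (wgap wm l l' <= k)%N, prof D l k <> 0%N &
    prof D l' (k - wgap wm l l')%N <> (k - wgap wm l l').+1%N].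
  apply: contrapT => nex; apply: nD => l l' k ll' gk.
  have [|p0] := pselect (prof D l k = 0%N); [by left|right].
  by apply: contrapT => pk'; apply: nex; exists l, l', k.
pose S p := swap_label l' (lexD D p).
have Sinj : injective S := swap_lex_inj Dinj.
have Scl : div_closed S := swap_lex_closed Dinj Dcl.
(* D and S have the same block sizes, hence the same lexicographic form up to order, through which
   they are connected. *)
have DS : conn wm (pt K D) (pt K S).
  apply: conn_trans (conn_lexD Dinj Dcl) _; apply: conn_sym.
  apply: conn_trans (conn_lexD Sinj Scl) _.
  apply: conn_perm (lexD_inj Sinj) (lexD_closed Sinj Scl) (lexD_inj Dinj) _ => m.
  apply/inDP/inDP => h; apply/lexDP => //; move/lexDP: h => h.
    by rewrite -(prof_swap_lex l') //; apply: h.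
  by rewrite (prof_swap_lex l') //; apply: h.
have lnl : l != l' by rewrite -val_eqE /= ltn_eqF.
exists (fun p => transfer wm l l' S (S p)); split.
- exact: transfer_inj.
- exact: transfer_closed.
- exact: conn_trans DS (conn_transfer Sinj Scl ll').
have labS p : lab (S p) = lab (D p) by rewrite lab_swap.
have [p0 Sp0] : exists p, S p = (l, 0%N, k).
  apply/swap_lexP => //; rewrite /tdeg /lab /xdeg /ydeg /= (negPf lnl) add0n.
  by rewrite lt0n; apply/eqP.
have M : moved wm l l' S (S p0).
  rewrite Sp0 /moved /lab /xdeg /ydeg /= eqxx gk /=.
  apply/negP => /inDP/swap_lexP => /(_ Dinj).
  rewrite /tdeg /lab /xdeg /ydeg /= eqxx add0n => h.
  by have := prof_le l' (k - wgap wm l l')%N Dinj; lia.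
rewrite (bigD1 p0) //= [X in (_ < X)%N](bigD1 p0) //= -addSn leq_add //.
  rewrite /transfer M [X in (_ < X)%N]/(l' : nat) -labS Sp0 //.
apply: leq_sum => p _; rewrite -labS /transfer; case: ifP => // /andP[/eqP -> _].
exact: ltnW.
Qed.

Lemma normalise D : injective D -> div_closed D -> exists D',
  [/\ injective D', div_closed D', conn wm (pt K D) (pt K D') & normal D'].
Proof.
have labn D0 : (\sum_p lab (D0 p) <= n * r)%N.
  rewrite -[X in (_ <= X * _)%N](card_ord n) -sum_nat_const.
  by apply: leq_sum => p _; apply: ltnW.
have [N DN] : exists N, (n * r - \sum_p lab (D p) <= N)%N by exists (n * r - \sum_p lab (D p))%N.
elim: N D DN => [|N IH] D DN Dinj Dcl; have [nD|nD] := pselect (normal D);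
  try by exists D; split=> //; apply/conn_refl/pt_fixed.
  have [D' [_ _ _ lt]] := label_step Dinj Dcl nD.
  by have := labn D'; have := labn D; lia.
have [D' [D'inj D'cl DD' lt]] := label_step Dinj Dcl nD.
have [|E [Einj Ecl D'E nE]] := IH D' _ D'inj D'cl.
  by have := labn D'; have := labn D; lia.
by exists E; split; [exact: Einj|exact: Ecl|exact: conn_trans DD' D'E|exact: nE].
Qed.

End Normalisation.

(** * Normal forms *)

Local Open Scope nat_scope.

Section StrictSeq.
Implicit Types (s : seq nat) (f : nat -> nat).

Lemma strictp_ex f N : (forall a, 0 < f a.+1 -> f a.+1 < f a) -> f N = 0 ->
  exists2 s, strictp s & forall a, nth 0 s a = f a.
Proof.
elim: N f => [|N IH] f fd fN.
  exists [::] => // a; rewrite nth_nil; elim: a => //= a IHa.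
  by have := fd a; rewrite -IHa; lia.
have [s /andP[ss s0] sf] := IH (fun a => f a.+1) (fun a => fd a.+1) fN.
have [f0|f0] := posnP (f 0).
  exists [::] => // a; rewrite nth_nil; elim: a => //= a IHa.
  by have := fd a; rewrite -IHa; lia.
exists (f 0 :: s); last by case.
rewrite /strictp inE negb_or eq_sym -lt0n f0 s0 /= andbT.
case: s ss s0 sf => //= b s -> ; rewrite inE negb_or => /andP[b0 _] /(_ 0) /= bE.
by rewrite andbT /gtn /= bE fd // -bE lt0n eq_sym.
Qed.

Lemma strictp_nth_gt0 s a : strictp s -> (0 < nth 0 s a) = (a < size s).
Proof.
case/andP=> _ s0; have [sa|sa] := ltnP a (size s); last by rewrite nth_default.
by rewrite lt0n; apply: contra s0 => /eqP <-; apply: mem_nth.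
Qed.

Lemma strictp_nth_ltn s a : strictp s -> 0 < nth 0 s a.+1 -> nth 0 s a.+1 < nth 0 s a.
Proof.
move=> sp; rewrite strictp_nth_gt0 // => sa; case/andP: sp => ss _.
have gtn_trans : transitive gtn by move=> x y z /= yx zx; apply: ltn_trans zx yx.
by apply: (sorted_ltn_nth gtn_trans 0 ss); rewrite ?inE //; apply: ltnW.
Qed.

Lemma strictp_size_head s : strictp s -> size s <= head 0 s.
Proof.
move=> sp; suff H a : a < size s -> a < head 0 s.
  by have [->//|s0] := posnP (size s); have := H (size s).-1; lia.
suff G : a < size s -> nth 0 s a + a <= head 0 s.
  by move=> sa; have := G sa; have := strictp_nth_gt0 a sp; rewrite sa; lia.
elim: a => [|a IH] sa; first by rewrite addn0 nth0.
have := IH (ltnW sa); have := @strictp_nth_ltn s a sp.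
by rewrite strictp_nth_gt0 // sa => /(_ isT); lia.
Qed.

End StrictSeq.

Section Shape.
Variables (r n : nat).
Implicit Types (m : mono r) (D : 'I_n -> mono r) (lam : nat -> seq nat) (l : 'I_r).

Definition lexicographic D := forall m, inD D m = (xdeg m < prof D (lab m) (tdeg m)).

Definition diagram lam D := forall m, inD D m = (ydeg m < nth 0 (lam (lab m)) (xdeg m)).

Lemma lexD_lexicographic D : injective D -> lexicographic (lexD D).
Proof. by move=> Dinj m; rewrite prof_lexD //; apply/inDP/idP; case: (lexDP m Dinj). Qed.

Lemma diagram_closed lam D : (forall l, strictp (lam l)) -> diagram lam D -> div_closed D.
Proof.
move=> lams Ds p m Dp; apply/inDP; rewrite Ds.
have : inD D (D p) by apply: inD_D.
have := @strictp_nth_ltn _ (xdeg m) (lams (lab m)).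
case: Dp => ->; rewrite Ds /mulx /muly /lab /xdeg /ydeg /=; last by move=> _ /ltnW.
by move=> h h1; apply: ltn_trans h1 (h (leq_ltn_trans (leq0n _) h1)).
Qed.

(** Strictness slides a cell (a + 1, b) to (a, b + 1), so the cells of one degree occupy the
    smallest powers of x. *)
Lemma diagram_lexicographic lam D : injective D -> (forall l, strictp (lam l)) ->
  diagram lam D -> lexicographic D.
Proof.
move=> Dinj lams Ds [[l a] b]; set k := tdeg _; rewrite [lab _]/= [xdeg _]/=.
have slide c d : inD D (l, c.+1, d) -> inD D (l, c, d.+1).
  rewrite !Ds /lab /xdeg /ydeg /= => h.
  by have := @strictp_nth_ltn _ c (lams l); lia.
have slides e c d : inD D (l, c + e, d) -> inD D (l, c, d + e).
  elim: e d => [|e IH] d; first by rewrite !addn0.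
  by rewrite addnS => /slide/IH; rewrite addSnnS.
have inB p : (p \in block D l k) = (lab (D p) == l) && (tdeg (D p) == k) by rewrite inE.
apply/idP/idP => [labD|].
  have /fin_all_exists[f fP] (i : 'I_a.+1) : exists p, D p = (l, val i, k - i).
    apply/inDP; have := slides (a - i) i b; rewrite subnKC ?leq_ord // => /(_ labD).
    by congr (inD D (_, _, _)); rewrite /k /tdeg /xdeg /ydeg /=; have := ltn_ord i; lia.
  have finj : injective f.
    by move=> i j ij; have := fP i; rewrite ij fP => -[] /esym/val_inj.
  rewrite -[a.+1]card_ord -(card_imset _ finj).
  apply/subset_leq_card/fintype.subsetP => _ /imsetP[i _ ->].
  rewrite inB fP {1}/lab /= eqxx /tdeg /xdeg /ydeg /=.
  by apply/eqP; rewrite /k /tdeg /xdeg /ydeg /=; have := ltn_ord i; lia.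
apply: contraTT => nD; rewrite -leqNgt.
have lt p : p \in block D l k -> xdeg (D p) < a.
  rewrite inB => /andP[/eqP pl /eqP pk]; rewrite ltnNge; apply: contra nD => ap.
  have := slides (xdeg (D p) - a) a (ydeg (D p)); rewrite subnKC // -{1}pl -mono_exp inD_D => /(_ isT).
  have {}pk : xdeg (D p) + ydeg (D p) = a + b := pk.
  by congr (inD D (_, _, _)); lia.
have [a0|a0] := posnP a.
  rewrite a0 leqn0 /prof cards_eq0; apply/eqP/setP => p; rewrite [RHS]inE.
  by apply/negP => /lt; rewrite a0.
rewrite -[a]card_ord /prof -(card_in_imset (f := fun p => insubd (Ordinal a0) (xdeg (D p)))).
  exact: max_card.
move=> p q pB qB /(congr1 val); rewrite !val_insubd !lt //.
exact: xdeg_block_inj pB qB.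
Qed.

End Shape.

(** If f exceeds g at l1, equal sums give l2 where g exceeds f. Whichever index is larger, the
    function that is nonzero at the smaller one attains the maximum M at the larger one, where the
    other function would have to exceed M. *)
Lemma staircase_sum_inj r (f g M : 'I_r -> nat) :
    (forall l, f l <= M l) -> (forall l, g l <= M l) ->
    (forall l l' : 'I_r, l < l' -> f l = 0 \/ f l' = M l') ->
    (forall l l' : 'I_r, l < l' -> g l = 0 \/ g l' = M l') ->
  \sum_l f l = \sum_l g l -> f =1 g.
Proof.
have half f0 g0 : (forall l, f0 l <= M l) -> (forall l, g0 l <= M l) ->
    (forall l l' : 'I_r, l < l' -> f0 l = 0 \/ f0 l' = M l') ->
    (forall l l' : 'I_r, l < l' -> g0 l = 0 \/ g0 l' = M l') ->
    \sum_l f0 l = \sum_l g0 l -> forall l, f0 l <= g0 l.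
  move=> fM gM fs gs E l1; rewrite leqNgt; apply/negP => lt1.
  have [l2 lt2] : exists l2, f0 l2 < g0 l2.
    apply/fintype.existsP; apply: contraPT E; rewrite negb_exists => /fintype.forallP le.
    apply/eqP; rewrite eq_sym neq_ltn; apply/orP; left.
    rewrite (bigD1 l1) //= [X in _ < X](bigD1 l1) //= -addSn leq_add //.
    by apply: leq_sum => i _; rewrite leqNgt.
  have := fM l1; have := gM l2; case: (ltngtP l1 l2) => l12.
  - by case: (fs _ _ l12); lia.
  - by case: (gs _ _ l12); lia.
  by move: lt1 lt2; rewrite (val_inj l12); lia.
by move=> fM gM fs gs E l; apply/eqP; rewrite eqn_leq !half.
Qed.

(** * Recovering the profiles from the dimensions of the graded pieces *)

Section Hilbert.
Variables (r n wm : nat).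
Implicit Types (m : mono r) (D : 'I_n -> mono r) (l : 'I_r).

(* The size and the maximal size of the part of label l and degree k - 1. *)
Definition dgprof D l k := if l < wm then prof D l k else if k is k'.+1 then prof D l k' else 0.
Definition dgmax l k := if l < wm then k.+1 else k.

Lemma dgprof_le D l k : injective D -> dgprof D l k <= dgmax l k.
Proof.
by move=> Dinj; rewrite /dgprof /dgmax; case: ifP => _; [|case: k => // k]; apply: prof_le.
Qed.

Lemma sum_dgprof D k : \sum_l dgprof D l k = #|[pred p | dg wm (D p) == (k%:Z - 1)%R]|.
Proof.
rewrite -sum1_card (partition_big (fun p => lab (D p)) xpredT) //=.
apply: eq_bigr => l _; rewrite sum1_card /dgprof /prof.
have E p : (p \in [pred p | [pred p | dg wm (D p) == (k%:Z - 1)%R] p & lab (D p) == l]) =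
    (lab (D p) == l) && (tdeg (D p) + ~~ (l < wm) == k).
  rewrite inE /= andbC /dg /weight -/(tdeg _); case: (lab (D p) =P l) => //= ->.
  by case: ifP => _ /=; lia.
case: ifP E => lw E.
  by apply: eq_card => p; rewrite [RHS]E inE addn0.
case: k E => [|k] E.
  by apply/esym/eq_card0 => p; rewrite [LHS]E addn1 andbF.
by apply: eq_card => p; rewrite [RHS]E inE addn1 eqSS.
Qed.

Lemma normal_dgprof D k l l' : normal wm D -> l < l' ->
  dgprof D l k = 0 \/ dgprof D l' k = dgmax l' k.
Proof.
move=> nD ll'; have := nD l l' _ ll'; rewrite /dgprof /dgmax /wgap.
case: (ltnP l wm) => lw; case: (ltnP l' wm) => lw' /= H.
- by have := H k isT; rewrite subn0.
- case: k => [|k]; first by right.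
  by have := H k.+1 isT; rewrite subn1.
- by have := leq_trans lw (ltnW ll'); rewrite leqNgt lw'.
case: k => [|k]; first by left.
by have := H k isT; rewrite subn0.
Qed.

(** Differences of the counts in degrees <= k give the dimension of each graded piece, and normality
    lets [staircase_sum_inj] distribute it among the labels. *)
Lemma normal_inj D D' : injective D -> injective D' -> normal wm D -> normal wm D' ->
  (forall k : int, #|[pred p | deg_le wm k (D p)]| = #|[pred p | deg_le wm k (D' p)]|) ->
  forall l k, prof D l k = prof D' l k.
Proof.
move=> Dinj D'inj nD nD' H.
have dE l k : dgprof D l k = dgprof D' l k.
  apply: (@staircase_sum_inj r (fun l => dgprof D l k) (fun l => dgprof D' l k)
    (fun l => dgmax l k)) => [?|?|? ?|? ?|]; try exact: dgprof_le; try exact: normal_dgprof.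
  rewrite !sum_dgprof.
  have cE0 D0 : #|[pred p | deg_le wm (k%:Z - 1)%R (D0 p)]| =
     #|[pred p | deg_le wm (k%:Z - 1 - 1)%R (D0 p)]| + #|[pred p | dg wm (D0 p) == (k%:Z - 1)%R]|.
    rewrite -cardUI [X in _ = _ + X]eq_card0 ?addn0; last first.
      by move=> p; rewrite !inE /deg_le /=; lia.
    by apply: eq_card => p; rewrite !inE /deg_le /=; lia.
  by have := H (k%:Z - 1)%R; rewrite (cE0 D) (cE0 D') H => /addnI.
move=> l k; have := dE l k; have := dE l k.+1; rewrite /dgprof.
by case: ifP.
Qed.

End Hilbert.

Definition cells (s : seq nat) : seq (nat * nat) :=
  [seq (a, b) | a <- iota 0 (size s), b <- iota 0 (nth 0 s a)].

Lemma mem_cells s a b : ((a, b) \in cells s) = (b < nth 0 s a).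
Proof.
apply/allpairsPdep/idP => [[a' [b' [_ ib [-> ->]]]]|ba].
  by move: ib; rewrite mem_iota.
exists a, b; rewrite !mem_iota !add0n ba; split=> //.
by have [//|sa] := ltnP a (size s); rewrite nth_default in ba.
Qed.

Lemma cells_uniq s : uniq (cells s).
Proof.
apply: allpairs_uniq_dep => [||[a b] [a' b'] _ _ [-> ->]] //; first exact: iota_uniq.
by move=> a _; apply: iota_uniq.
Qed.

Lemma size_cells s : size (cells s) = sumn s.
Proof.
rewrite size_allpairs_dep; congr sumn; have := map_nth_iota0 0 (leqnn (size s)).
by rewrite take_size => sE; rewrite -[RHS]sE; apply: eq_map => a; rewrite size_iota.
Qed.

Section Monos.
Variables (r : nat).
Implicit Types (m : mono r) (lam : nat -> seq nat) (l : 'I_r).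

Definition monos lam : seq (mono r) :=
  [seq (l, x.1, x.2) | l <- enum 'I_r, x <- cells (lam l)].

Lemma mem_monos lam m : (m \in monos lam) = (ydeg m < nth 0 (lam (lab m)) (xdeg m)).
Proof.
case: m => -[l a] b; rewrite /lab /xdeg /ydeg /= -mem_cells.
apply/allpairsPdep/idP => [[l' [[a' b'] [_ x [-> -> ->]]]]|x] //.
by exists l, (a, b); rewrite mem_enum.
Qed.

Lemma monos_uniq lam : uniq (monos lam).
Proof.
apply: allpairs_uniq_dep => [||[l [a b]] [l' [a' b']] _ _ [-> -> ->]] //.
  exact: enum_uniq.
by move=> l _; apply: cells_uniq.
Qed.

Lemma size_monos lam : size (monos lam) = \sum_(l < r) sumn (lam l).
Proof.
rewrite size_allpairs_dep sumnE big_map big_enum /=.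
by apply: eq_bigr => l _; rewrite size_cells.
Qed.

(** The default m0 is never reached when the total size is n, as every index p is then in range. *)
Definition lamD n m0 lam (p : 'I_n) : mono r := nth m0 (monos lam) p.

End Monos.

Section LamD.
Variables (r n wm : nat).
Implicit Types (m : mono r) (lam : nat -> seq nat) (l : 'I_r) (D : 'I_n -> mono r).

Lemma lamD_inj m0 lam : \sum_(l < r) sumn (lam l) = n -> injective (@lamD r n m0 lam).
Proof.
rewrite -size_monos => sn p q /eqP; rewrite /lamD nth_uniq ?sn ?monos_uniq //.
by move/eqP/val_inj.
Qed.

Lemma lamD_diagram m0 lam : \sum_(l < r) sumn (lam l) = n -> diagram lam (@lamD r n m0 lam).
Proof.
rewrite -size_monos => sn m; rewrite -mem_monos; apply/inDP/idP => [[p <-]|mM].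
  by rewrite mem_nth ?sn.
have im : index m (monos r lam) < n by rewrite -sn index_mem.
by exists (Ordinal im); rewrite /lamD nth_index.
Qed.

Lemma diagram_sum lam D : injective D -> diagram lam D -> \sum_(l < r) sumn (lam l) = n.
Proof.
have sz : size [seq D p | p <- enum 'I_n] = n by rewrite size_map size_enum_ord.
move=> Dinj Ds; rewrite -size_monos -[RHS]sz.
apply/perm_size/uniq_perm => [||m].
- exact: monos_uniq.
- by rewrite map_inj_uniq //; apply: enum_uniq.
rewrite mem_monos -Ds; apply/inDP/mapP => [[p <-]|[p _ ->]]; last by exists p.
by exists p; rewrite ?mem_enum.
Qed.

(** Adjacent inequalities chain across labels because a strict partition has at most as many parts
    as its largest part. A nonempty block then contains y^k e_l, so x^(k - gap) e_l' is present, and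
    in lexicographic position the presence of a pure power of x makes its block full. *)
Lemma diagram_normal lam D : injective D -> (forall l, strictp (lam l)) -> diagram lam D ->
    (forall k, k.+1 < r -> head 0 (lam k) <= size (lam k.+1) + (k.+1 == wm)) ->
  normal wm D.
Proof.
move=> Dinj ls Ds hs l l' k ll' gk.
have lD := diagram_lexicographic Dinj ls Ds.
have hh : head 0 (lam l) <= size (lam l') + wgap wm l l'.
  have H d : l + d.+1 < r -> head 0 (lam l) <= size (lam (l + d.+1)) + ((l < wm) && (wm <= l + d.+1)).
    elim: d => [|d IH] lr.
      rewrite addn1; have := hs l; rewrite -addn1 => /(_ lr).
      by case: eqP => E; lia.
    have lr' : l + d.+1 < r by lia.
    have := hs (l + d.+1); rewrite -addnS => /(_ lr).
    have := strictp_size_head (ls (Ordinal lr')) => /=.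
    by have := IH lr'; case: eqP => E; lia.
  by have := H (l' - l.+1); rewrite addnS -addSn subnKC // => /(_ (ltn_ord _)).
have [|p0] := posnP (prof D l k); [by left|right].
have : inD D (l, 0, k) by rewrite lD /tdeg /lab /xdeg /ydeg /=.
rewrite Ds /lab /xdeg /ydeg /= nth0 => kh.
have : inD D (l', k - wgap wm l l', 0).
  rewrite Ds /lab /xdeg /ydeg /= strictp_nth_gt0 //; lia.
rewrite lD /tdeg /lab /xdeg /ydeg /= addn0 => h.
by apply/eqP; rewrite eqn_leq h prof_le.
Qed.

Lemma normal_diagram D : injective D -> div_closed D -> lexicographic D -> normal wm D ->
  exists lam, [/\ forall l, strictp (lam l), diagram lam D &
    forall k, k.+1 < r -> head 0 (lam k) <= size (lam k.+1) + (k.+1 == wm)].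
Proof.
move=> Dinj Dcl lD nD; pose B := \max_p tdeg (D p).
have Bm m : inD D m -> tdeg m <= B.
  by move=> /inDP[p <-]; apply: leq_bigmax.
have ex (l : 'I_r) a : exists b, ~~ inD D (l, a, b).
  exists B.+1; apply/negP => /Bm; rewrite /tdeg /xdeg /ydeg /=; lia.
pose f l a := ex_minn (ex l a).
have fP l a b : inD D (l, a, b) = (b < f l a).
  rewrite /f; case: ex_minnP => c cD cmin; apply/idP/idP => [bD|bc].
    rewrite ltnNge; apply: contra cD => cb.
    have := bD; rewrite -(subnKC cb); elim: (b - c) => [|d IH]; rewrite ?addn0 //.
    by rewrite addnS => /(inD_muly Dcl)/IH.
  by apply: contraLR bc => /cmin; rewrite leqNgt.
have /fin_all_exists[s sP] (l : 'I_r) : exists s, strictp s /\ forall a, nth 0 s a = f l a.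
  have [a fa||s ss sf] := @strictp_ex (f l) B.+1; last by exists s.
    (* In lexicographic position the top cell of column a + 1 can be replaced by the cell of the
       same degree in column a, one higher; so the heights decrease strictly. *)
    have : inD D (l, a.+1, (f l a.+1).-1) by rewrite fP prednK.
    rewrite -fP !lD /tdeg /lab /xdeg /ydeg /= addSn -addnS prednK //.
    exact: ltnW.
  apply/eqP; rewrite -leqn0 leqNgt -fP; apply/negP => /Bm.
  by rewrite /tdeg /xdeg /ydeg /=; lia.
pose lam k := if insub k is Some l then s l else [::].
have lamE (l : 'I_r) : lam l = s l by rewrite /lam valK.
have Ds : diagram lam D.
  by move=> m; rewrite lamE (sP _).2 -fP -mono_exp.
have ls l : strictp (lam l) by rewrite lamE (sP _).1.
exists lam; split=> // l lr; rewrite leqNgt; apply/negP => lt.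
pose i := Ordinal (ltnW lr); pose j := Ordinal lr.
(* If the inequality failed, y^k of label l would be present and x^(k - gap) of label l + 1 absent,
   against both alternatives of normality. *)
set k := size _ + _ in lt.
have gE : wgap wm i j = (l.+1 == wm) by rewrite /wgap /=; congr nat_of_bool; lia.
have := nD i j k (leqnn _); rewrite gE leq_addl => /(_ isT).
rewrite addnK => -[pk|pk].
  have : inD D (i, 0, k) by rewrite Ds /lab /xdeg /ydeg /= nth0.
  by rewrite lD /tdeg /lab /xdeg /ydeg /= add0n pk.
have : inD D (j, size (lam j), 0).
  by rewrite lD /tdeg /lab /xdeg /ydeg /= addn0 pk.
by rewrite Ds /lab /xdeg /ydeg /= nth_default.
Qed.

Lemma diagram_inj lam lam' D D' : injective D -> injective D' ->
    (forall l, strictp (lam l)) -> (forall l, strictp (lam' l)) ->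
    diagram lam D -> diagram lam' D' -> (forall l k, prof D l k = prof D' l k) ->
  forall l, lam l = lam' l.
Proof.
move=> Dinj D'inj ls ls' Ds Ds' DD' l.
have E a b : (b < nth 0 (lam l) a) = (b < nth 0 (lam' l) a).
  have := diagram_lexicographic Dinj ls Ds (l, a, b); rewrite DD' Ds.
  by rewrite -(diagram_lexicographic D'inj ls' Ds') Ds'.
have En a : nth 0 (lam l) a = nth 0 (lam' l) a.
  apply/eqP; rewrite eqn_leq; apply/andP; split; rewrite leqNgt; apply/negP.
    by rewrite E ltnn.
  by rewrite -E ltnn.
have Es a : (a < size (lam l)) = (a < size (lam' l)).
  by rewrite -!strictp_nth_gt0 ?En.
apply: (@eq_from_nth _ 0) => //; apply/eqP.
by rewrite eqn_leq leqNgt Es ltnn leqNgt -Es ltnn.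
Qed.

End LamD.

Local Open Scope classical_set_scope.

Lemma card_fset_set_image (T U : choiceType) (s : seq T) (f : T -> U) :
  uniq s -> {in s &, injective f} -> #|` fset_set (f @` [set` s])|%fset = size s.
Proof.
move=> us fi; have -> : f @` [set` s] = [set` [fset f x | x in s]%fset].
  apply/seteqP; split=> [_ [x /= xs <-]|y /= /imfsetP[x /= xs ->]]; last by exists x.
  by apply/imfsetP; exists x.
by rewrite set_fsetK card_in_imfset //= undup_id.
Qed.

(** * The bijection between tuples and components *)

Section NormalForms.
Variables (R : realType) (r n wm : nat).
Local Notation K := (R[i] : numClosedFieldType).
Implicit Types (lam : nat -> seq nat) (D : 'I_n -> mono r) (x : quiver_data K r n).

Definition staircase lam : Prop := (forall l : 'I_r, strictp (lam l)) /\
  forall k, k.+1 < r -> head 0 (lam k) <= size (lam k.+1) + (k.+1 == wm).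

Lemma conn_normal_form x : fixed_point wm x -> exists lam D,
  [/\ injective D, staircase lam, diagram lam D & conn wm x (pt K D)].
Proof.
move=> xf; have [D0 [D0inj D0cl xD0]] := conn_pt xf.
have [D [Dinj Dcl D0D nD]] := normalise R wm D0inj D0cl.
have Linj := lexD_inj Dinj; have Lcl := lexD_closed Dinj Dcl.
have nL : normal wm (lexD D) by move=> l l' k; rewrite !prof_lexD //; apply: nD.
have [lam [ls Ds hs]] := normal_diagram Linj Lcl (lexD_lexicographic Dinj) nL.
exists lam, (lexD D); split; [exact: Linj|by split|exact: Ds|].
exact: conn_trans xD0 (conn_trans D0D (conn_lexD R wm Dinj Dcl)).
Qed.

(** Connected points share their graded dimensions, these determine the profiles of normal sets, and
    the profiles determine the strict partitions. *)
Lemma conn_normal_form_inj lam lam' D D' : injective D -> injective D' ->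
    staircase lam -> staircase lam' -> diagram lam D -> diagram lam' D' ->
  conn wm (pt K D) (pt K D') -> forall l : 'I_r, lam l = lam' l.
Proof.
move=> Dinj D'inj [ls hs] [ls' hs'] Ds Ds' DD'.
have Dcl := diagram_closed ls Ds; have D'cl := diagram_closed ls' Ds'.
apply: (diagram_inj Dinj D'inj ls ls' Ds Ds').
apply: (normal_inj Dinj D'inj (diagram_normal Dinj ls Ds hs) (diagram_normal D'inj ls' Ds' hs')).
by move=> k; apply: (conn_sep k Dinj Dcl D'inj D'cl DD').
Qed.

Let M : set (moduli K r n) := fixed_locus (subtorus 1 1 (@weight r wm)).

(** Quantifying over the stability proof defines this for every D, as the indexing by arbitrary
    lists requires. *)
Definition pt_component D : set (moduli K r n) :=
  [set u | exists xs : stable_locus K r n (pt K D), connected_component M (mclass xs) u].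

Lemma pt_componentE D (xs : stable_locus K r n (pt K D)) :
  pt_component D = connected_component M (mclass xs).
Proof.
apply/seteqP; split=> [u [xs' xu]|u xu]; last by exists xs.
by rewrite (mclass_irr xs xs').
Qed.

Lemma pt_component_conn D D' : injective D -> div_closed D -> injective D' -> div_closed D' ->
  pt_component D = pt_component D' <-> conn wm (pt K D) (pt K D').
Proof.
move=> Dinj Dcl D'inj D'cl.
have Ds := pt_stable K Dinj Dcl; have D's := pt_stable K D'inj D'cl.
rewrite (pt_componentE Ds) (pt_componentE D's); split=> [E|[h [h' hh']]].
  exists Ds, D's; rewrite E; apply: connected_component_refl.
  exact/mclass_fixed/pt_fixed.
by apply: same_connected_component; rewrite (mclass_irr Ds h) (mclass_irr D's h').
Qed.

Hypothesis r0 : 0 < r.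
Let m0 : mono r := gen (Ordinal r0).

Definition fixed_tuples : seq (seq (seq nat)) :=
  [seq L <- strict_tuples wm r ((n.+1 + n.+1).+2 + (r - wm == 0)) | total_size L == n].

Let lamof (L : seq (seq nat)) := nth [::] (rev L).

Lemma fixed_tuplesP L : L \in fixed_tuples ->
  [/\ staircase (lamof L), \sum_(l < r) sumn (lamof L l) = n & lamlist (lamof L) r = L].
Proof.
rewrite mem_filter => /andP[/eqP Ln LN]; have LE := strict_tuplesE LN.
move: LN; rewrite -{1}LE => /mem_strict_tuples[ls _ hs]; split=> //.
  by split=> // l; apply: ls.
by rewrite -total_size_lamlist LE.
Qed.

Lemma lamlist_fixed_tuples lam : staircase lam -> \sum_(l < r) sumn (lam l) = n ->
  lamlist lam r \in fixed_tuples.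
Proof.
move=> [ls hs] sn; rewrite mem_filter total_size_lamlist sn eqxx /=; apply/mem_strict_tuples; split=> //.
  by move=> l lr; apply: (ls (Ordinal lr)).
move=> _; have rr : r.-1 < r by rewrite prednK.
have : sumn (lam r.-1) <= n by rewrite -sn (bigD1 (Ordinal rr)) //= leq_addr.
by case: (lam r.-1) => [|a s] //=; lia.
Qed.

Let DL L := @lamD r n m0 (lamof L).

(** A normal form found in a component may enumerate its monomials in any order; [conn_perm]
    connects it to the chosen enumeration [lamD]. *)
Lemma components_fixed : components M = (fun L => pt_component (DL L)) @` [set` fixed_tuples].
Proof.
apply/seteqP; split=> [_ [u uM <-]|_ [L /= LT <-]].
  have [x [xs [xf ->]]] := mclass_surj uM.
  have [lam [D [Dinj lst Ds [h [h' xD]]]]] := conn_normal_form xf.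
  have sn := diagram_sum Dinj Ds; have LT := lamlist_fixed_tuples lst sn.
  exists (lamlist lam r) => //=; set L := lamlist lam r.
  have [[ls hs] sL LE] := fixed_tuplesP LT.
  have Lcl := diagram_closed ls (lamD_diagram m0 sL).
  have Linj := lamD_inj (m0 := m0) sL.
  have Dcl := diagram_closed lst.1 Ds.
  have -> : connected_component M (mclass xs) = pt_component D.
    by rewrite (pt_componentE h') (mclass_irr xs h); apply: same_connected_component.
  apply/pt_component_conn => //.
  apply: conn_perm => // m; rewrite Ds (lamD_diagram m0 sL).
  by rewrite (lamlist_inj LE).
have [[ls hs] sL LE] := fixed_tuplesP LT.
have Lcl := diagram_closed ls (lamD_diagram m0 sL).
have Linj := lamD_inj (m0 := m0) sL.
exists (mclass (pt_stable K Linj Lcl)); first exact/mclass_fixed/pt_fixed.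
by rewrite -(pt_componentE (pt_stable K Linj Lcl)).
Qed.

Lemma finite_components_fixed : finite_set (components M).
Proof. by rewrite components_fixed; apply: finite_image. Qed.

Lemma h0_fixed : h0 M = size fixed_tuples.
Proof.
rewrite /h0 components_fixed; apply: card_fset_set_image.
  by rewrite filter_uniq // strict_tuples_uniq.
move=> L L' LT L'T E.
have [[ls hs] sL LE] := fixed_tuplesP LT; have [[ls' hs'] sL' LE'] := fixed_tuplesP L'T.
have Lcl := diagram_closed ls (lamD_diagram m0 sL).
have Linj := lamD_inj (m0 := m0) sL.
have L'cl := diagram_closed ls' (lamD_diagram m0 sL').
have L'inj := lamD_inj (m0 := m0) sL'.
have /pt_component_conn : pt_component (DL L) = pt_component (DL L') by [].
move=> /(_ Linj Lcl L'inj L'cl) C.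
have EE := conn_normal_form_inj Linj L'inj (conj ls hs) (conj ls' hs')
  (lamD_diagram m0 sL) (lamD_diagram m0 sL') C.
rewrite -LE -LE'; move: (leqnn r); elim: {-2}r => [_|k IH kr]; first by [].
by rewrite [LHS]/= [RHS]/= (EE (Ordinal kr)) IH 1?ltnW.
Qed.

End NormalForms.

Local Open Scope ring_scope.

Theorem theorem1p1 (R : realType) (r m : nat) (hr : (1 <= r)%N)
    (hm : (m <= r)%N) :
  let M_T n : set (moduli (R[i] : numClosedFieldType) r n) :=
    fixed_locus (subtorus 1%N 1%N (weight m)) in
  (forall n : nat, finite_set (components (M_T n))) /\
  ((fun n : nat => (h0 (M_T n))%:Z) : fps) =
    fps_mul
      (fps_mul (qpoch (- 'X) 'X) (fps_inv (qpoch 'X 'X)))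
      (qpochs [:: 'X^(m + 1); 'X^(r - m + 1); 'X^(r + 2)] 'X^(r + 2)).
Proof.
split=> [n|]; first exact: finite_components_fixed.
by apply/funext => n; rewrite count_coef // h0_fixed // size_filter.
Qed.
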